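(* Assume the yarns are made of an isotropic and homogeneous material with Lamé constants $\lambda,\mu$, i.e. $a_{ijkl}=\lambda\delta_{ij}\delta_{kl}+\mu(\delta_{ik}\delta_{jl}+\delta_{il}\delta_{jk})$ (constant, positive definite on symmetric matrices) on the textile periodicity cell $\mathcal Y^*$ of the context. Then the homogenized coefficients satisfy $$b^{hom}_{\alpha\beta\alpha'\beta'}=0\qquad\forall(\alpha,\beta,\alpha',\beta')\in\{1,2\}^4,$$ and $$a^{hom}_{1111}=a^{hom}_{2222},\quad a^{hom}_{\alpha\alpha12}=0,\qquad c^{hom}_{1111}=c^{hom}_{2222},\quad c^{hom}_{\alpha\alpha12}=0,\qquad\alpha\in\{1,2\}$$ (no summation over $\alpha$).
   Context: Cell. Let $\kappa\in(0,1/2)$ be small enough that the maps below are diffeomorphisms onto their images. Let $\Phi:\mathbb{R}\to\mathbb{R}$ be the $2$-periodic function with $\Phi(z)=-\kappa$ for $z\in[0,\kappa]$; $\Phi(z)=\kappa\big(6\frac{(z-\kappa)^2}{(1-2\kappa)^2}-4\frac{(z-\kappa)^3}{(1-2\kappa)^3}-1\big)$ for $z\in[\kappa,1-\kappa]$; $\Phi(z)=\kappa$ for $z\in[1-\kappa,1]$; $\Phi(z)=\Phi(2-z)$ for $z\in[1,2]$. With $e_1,e_2,e_3$ the canonical basis, for $p,q\in\{0,1,2\}$ let $M^{(1,q)}(z_1)=z_1e_1+qe_2+(-1)^{q+1}\Phi(z_1)e_3$, $M^{(2,p)}(z_2)=pe_1+z_2e_2+(-1)^p\Phi(z_2)e_3$,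 let $n^{(1,q)}(z_1)$, $n^{(2,p)}(z_2)$ be the unit normals to these curves, in the planes spanned by $e_1,e_3$ and by $e_2,e_3$ respectively, with positive $e_3$-component, and let $\mathcal P^{(1,q)}=\{M^{(1,q)}(z_1)+z_2e_2+z_3n^{(1,q)}(z_1): z_1\in(0,2),\ |z_2|,|z_3|<\kappa\}$, $\mathcal P^{(2,p)}=\{M^{(2,p)}(z_2)+z_1e_1+z_3n^{(2,p)}(z_2): z_2\in(0,2),\ |z_1|,|z_3|<\kappa\}$. Then $\mathcal Y^*=\mathcal Y\cap\big(\bigcup_{q=0}^2\mathcal P^{(1,q)}\cup\bigcup_{p=0}^2\mathcal P^{(2,p)}\big)$ with $\mathcal Y=(0,2)^2\times(-2\kappa,2\kappa)$, where (the yarns being glued along their contact squares in $\{y_3=0\}$) the union is understood as the interior of the union of the closures. $H^1_{per,0}(\mathcal Y^* )$ is the space of functions in $H^1(\mathcal Y^* )$ that are $2$-periodic in the directions $e_1,e_2$ (equal traces on opposite lateral faces) and have zero mean over $\mathcal Y^*$; $e_y(\cdot)$ is the symmetric gradient with respect to $y$; $(aS):T=a_{ijkl}S_{ij}T_{kl}$ (summation over repeated Latin indices). Cell problems and homogenized coefficients. For $\alpha,\beta\in\{1,2\}$ let $M^{\alpha\beta}=\frac12(e_\alpha\otimes e_\beta+e_\beta\otimes e_\alpha)\in\mathbb{R}^{3\times3}$, and let $\widehat\chi^m_{\alpha\beta},\widehat\chi^b_{\alpha\beta}\in H^1_{per,0}(\mathcal Y^* )^3$ be the solutions of $$\int_{\mathcal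 Y^*}a\big(M^{\alpha\beta}+e_y(\widehat\chi^m_{\alpha\beta})\big):e_y(\widehat w)\,dy=0,\qquad\int_{\mathcal Y^*}a\big(-y_3M^{\alpha\beta}+e_y(\widehat\chi^b_{\alpha\beta})\big):e_y(\widehat w)\,dy=0\quad\forall\,\widehat w\in H^1_{per,0}(\mathcal Y^* )^3.$$ Then $$a^{hom}_{\alpha\beta\alpha'\beta'}=\frac1{|\mathcal Y^*|}\int_{\mathcal Y^*}a\big(M^{\alpha\beta}+e_y(\widehat\chi^m_{\alpha\beta})\big):M^{\alpha'\beta'}dy,\quad b^{hom}_{\alpha\beta\alpha'\beta'}=\frac1{|\mathcal Y^*|}\int_{\mathcal Y^*}a\big(-y_3M^{\alpha\beta}+e_y(\widehat\chi^b_{\alpha\beta})\big):M^{\alpha'\beta'}dy,$$ $$c^{hom}_{\alpha\beta\alpha'\beta'}=\frac1{|\mathcal Y^*|}\int_{\mathcal Y^*}a\big(-y_3M^{\alpha\beta}+e_y(\widehat\chi^b_{\alpha\beta})\big):(-y_3M^{\alpha'\beta'})\,dy.$$ *)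

(* Defs.v *)
From HB Require Import structures.
From mathcomp Require Import all_boot all_order all_algebra.
From mathcomp Require Import all_classical all_reals all_analysis.

Set Implicit Arguments.
Unset Strict Implicit.
Unset Printing Implicit Defensive.

Import Order.TTheory GRing.Theory Num.Theory.
Import numFieldNormedType.Exports.

Local Open Scope classical_set_scope.
Local Open Scope ring_scope.

(* Points of R^3 are triples, and the coordinate indices 1, 2, 3 of the        *)
(* mathematics are the elements 0, 1, 2 of 'I_3; the in-plane indices 1, 2     *)
(* are the elements 0, 1 of 'I_2.                                              *)
Notation R3 R := (R * R * R)%type.

Section Euclidean.
Context {R : realType}.

Definition coord3 (i : 'I_3) (y : R3 R) : R :=
  if i == 0 then y.1.1 else if i == 1 then y.1.2 else y.2.

Definition basis3 (i : 'I_3) : R3 R :=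
  ((i == 0)%:R, (i == 1)%:R, (i == 2)%:R).

Definition plane (i : 'I_2) : 'I_3 := widen_ord (leqnSn 2) i.

Definition leb2 : {measure set (measurableTypeR R * measurableTypeR R) -> \bar R} :=
  (@lebesgue_measure R \x @lebesgue_measure R)%E.
Definition leb3 : {measure set (measurableTypeR R * measurableTypeR R *
                                measurableTypeR R) -> \bar R} :=
  (leb2 \x @lebesgue_measure R)%E.

End Euclidean.

Section Textile.
Context {R : realType}.
Variable kappa : R.

(* z - 2 * floor (z / 2) is the representative of z in [0, 2) modulo 2.        *)
Definition Phi (z : R) : R :=
  let r := z - 2 * (Num.floor (z / 2))%:~R in
  let t := if r <= 1 then r else 2 - r in
  let s := (t - kappa) / (1 - 2 * kappa) in
  if t <= kappa then - kappa
  else if t <= 1 - kappa then kappa * (6 * s ^+ 2 - 4 * s ^+ 3 - 1)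
  else kappa.

Definition M1 (q : 'I_3) (z : R) : R3 R :=
  z *: basis3 0 + q%:R *: basis3 1 + ((-1) ^+ q.+1 * Phi z) *: basis3 2.

Definition M2 (p : 'I_3) (z : R) : R3 R :=
  p%:R *: basis3 0 + z *: basis3 1 + ((-1) ^+ p * Phi z) *: basis3 2.

(* The curve z |-> z e + f z e_3 has tangent e + f'(z) e_3, hence upward unit   *)
(* normal (- f'(z) e + e_3) / sqrt (1 + f'(z)^2) in the plane of e and e_3.     *)
Definition unit_normal (e : 'I_3) (f : R -> R) (z : R) : R3 R :=
  (Num.sqrt (1 + derive1 f z ^+ 2))^-1 *:
    (basis3 2 - derive1 f z *: basis3 e).

Definition n1 (q : 'I_3) : R -> R3 R :=
  unit_normal 0 (fun z => (-1) ^+ q.+1 * Phi z).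

Definition n2 (p : 'I_3) : R -> R3 R :=
  unit_normal 1 (fun z => (-1) ^+ p * Phi z).

Definition chart1 (q : 'I_3) (z : R3 R) : R3 R :=
  M1 q (coord3 0 z) + coord3 1 z *: basis3 1 + coord3 2 z *: n1 q (coord3 0 z).

Definition chart2 (p : 'I_3) (z : R3 R) : R3 R :=
  M2 p (coord3 1 z) + coord3 0 z *: basis3 0 + coord3 2 z *: n2 p (coord3 1 z).

Definition box1 : set (R3 R) :=
  [set z | [/\ 0 < coord3 0 z < 2, `|coord3 1 z| < kappa & `|coord3 2 z| < kappa]].

Definition box2 : set (R3 R) :=
  [set z | [/\ 0 < coord3 1 z < 2, `|coord3 0 z| < kappa & `|coord3 2 z| < kappa]].

Definition yarn1 (q : 'I_3) : set (R3 R) := chart1 q @` box1.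
Definition yarn2 (p : 'I_3) : set (R3 R) := chart2 p @` box2.

(* Phi is C^1 with Lipschitz derivative but not C^2 (Phi'' jumps at kappa and  *)
(* 1 - kappa), so the charts, which involve Phi', are only Lipschitz:          *)
(* diffeomorphism onto the image is meant in the bi-Lipschitz category.        *)
Definition lipeo_onto_image (A : set (R3 R)) (f : R3 R -> R3 R) : Prop :=
  exists c C : R, 0 < c /\ forall x y, A x -> A y ->
    c * `|x - y| <= `|f x - f y| <= C * `|x - y|.

Definition charts_diffeo : Prop :=
  forall i : 'I_3, lipeo_onto_image box1 (chart1 i) /\
                   lipeo_onto_image box2 (chart2 i).

Definition full_cell : set (R3 R) :=
  [set y | [/\ 0 < coord3 0 y < 2, 0 < coord3 1 y < 2 &
               - (2 * kappa) < coord3 2 y < 2 * kappa]].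

Definition textile_cell : set (R3 R) :=
  full_cell `&` ((\bigcup_q closure (yarn1 q)) `|`
                 (\bigcup_p closure (yarn2 p)))°.

End Textile.

Section Sobolev.
Context {R : realType}.
Implicit Types (D : set (R3 R)) (u phi : R3 R -> R).

Definition partial (i : 'I_3) u : R3 R -> R := fun y => 'D_(basis3 i) u y.

Fixpoint Ck (k : nat) u : Prop :=
  continuous u /\
  if k is k'.+1 then
    forall i, (forall y, derivable u y (basis3 i)) /\ Ck k' (partial i u)
  else True.

Definition smooth u : Prop := forall k, Ck k u.

Definition supported_in (K : set (R3 R)) u : Prop := forall y, ~ K y -> u y = 0.

Definition test_function D phi : Prop :=
  smooth phi /\ exists K, [/\ compact K, K `<=` D & supported_in K phi].

Definition L2 d (T : measurableType d) (mu : {measure set T -> \bar R}) (D : set T)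
    (f : T -> R) : Prop :=
  measurable_fun D f /\ mu.-integrable D (fun x => (f x ^+ 2)%:E).

Definition weak_partial D (i : 'I_3) u g : Prop :=
  forall phi, test_function D phi ->
    \int[leb3]_(y in D) (u y * partial i phi y) =
    - \int[leb3]_(y in D) (g y * phi y).

(* An element of H^1(D) is given by representatives of its class and of its    *)
(* weak gradient (which the class determines almost everywhere on D).          *)
Record H1 D := MkH1 {
  H1fun :> R3 R -> R;
  H1grad : 'I_3 -> R3 R -> R;
  H1fun_L2 : L2 leb3 D H1fun;
  H1grad_L2 : forall i, L2 leb3 D (H1grad i);
  H1gradP : forall i, weak_partial D i H1fun (H1grad i)
}.

Definition sym_grad D (w : 'I_3 -> H1 D) (y : R3 R) : 'M[R]_3 :=
  \matrix_(i, j) (2^-1 * (H1grad (w i) j y + H1grad (w j) i y)).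

(* The lateral faces y_i = 0 (side = false) and y_i = 2 (side = true) for      *)
(* i = 1, 2, parametrized by the two other coordinates.                        *)
Definition face_pt (i : 'I_2) (side : bool) (x : R * R) : R3 R :=
  let c := if side then 2 else 0 in
  if i == 0 then (c, x.1, x.2) else (x.1, c, x.2).

(* The relatively open part of the plane y_i = 0 or y_i = 2 near which D fills *)
(* the slab 0 < y_i < 2.                                                       *)
Definition lateral_face D (i : 'I_2) (side : bool) : set (R * R) :=
  [set x | \forall z \near face_pt i side x,
             0 < coord3 (plane i) z < 2 -> D z].

(* g is the trace of u on a lateral face: the Gauss-Green formula holds with   *)
(* boundary values g, the outer normal being - e_i or e_i, for the smooth phi  *)
(* vanishing near the rest of the boundary of D.                               *)
Definition is_trace D (i : 'I_2) (side : bool) (u : H1 D) (g : R * R -> R) :=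
  L2 leb2 (lateral_face D i side) g /\
  forall phi (K : set (R3 R)), smooth phi -> compact K -> supported_in K phi ->
    K `&` closure D `<=` D `|` face_pt i side @` lateral_face D i side ->
    \int[leb3]_(y in D)
      (u y * partial (plane i) phi y + H1grad u (plane i) y * phi y) =
    (if side then 1 else -1) *
    \int[leb2]_(x in lateral_face D i side) (g x * phi (face_pt i side x)).

Definition H1per0 D (u : H1 D) : Prop :=
  (forall i : 'I_2, exists g, is_trace i false u g /\ is_trace i true u g) /\
  \int[leb3]_(y in D) u y = 0.

End Sobolev.

Section Homogenization.
Context {R : realType}.

Definition elasticity_tensor := 'I_3 -> 'I_3 -> 'I_3 -> 'I_3 -> R.

Definition contract (a : elasticity_tensor) (S T : 'M[R]_3) : R :=
  \sum_i \sum_j \sum_k \sum_l a i j k l * S i j * T k l.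

Definition positive_definite (a : elasticity_tensor) : Prop :=
  forall S : 'M[R]_3, S^T = S -> S != 0 -> 0 < contract a S S.

Definition isotropic (lambda mu : R) : elasticity_tensor := fun i j k l =>
  lambda * ((i == j)%:R * (k == l)%:R) +
  mu * ((i == k)%:R * (j == l)%:R + (i == l)%:R * (j == k)%:R).

Definition Mstrain (al be : 'I_2) : 'M[R]_3 :=
  2^-1 *: (delta_mx (plane al) (plane be) + delta_mx (plane be) (plane al)).

Definition membrane (al be : 'I_2) (y : R3 R) : 'M[R]_3 := Mstrain al be.

Definition bending (al be : 'I_2) (y : R3 R) : 'M[R]_3 :=
  - coord3 2 y *: Mstrain al be.

Variables (D : set (R3 R)) (a : elasticity_tensor).

(* chi is the corrector on D for the prescribed macroscopic strain F.          *)
Definition corrector (F : R3 R -> 'M[R]_3) (chi : 'I_3 -> H1 D) : Prop :=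
  (forall i, H1per0 (chi i)) /\
  forall w : 'I_3 -> H1 D, (forall i, H1per0 (w i)) ->
    \int[leb3]_(y in D) contract a (F y + sym_grad chi y) (sym_grad w y) = 0.

Definition hom_coef (F : R3 R -> 'M[R]_3) (chi : 'I_3 -> H1 D)
    (G : R3 R -> 'M[R]_3) : R :=
  (fine (leb3 D))^-1 *
  \int[leb3]_(y in D) contract a (F y + sym_grad chi y) (G y).

Definition ahom (chim : 'I_2 -> 'I_2 -> 'I_3 -> H1 D) (al be al' be' : 'I_2) :=
  hom_coef (membrane al be) (chim al be) (membrane al' be').

Definition bhom (chib : 'I_2 -> 'I_2 -> 'I_3 -> H1 D) (al be al' be' : 'I_2) :=
  hom_coef (bending al be) (chib al be) (membrane al' be').

Definition chom (chib : 'I_2 -> 'I_2 -> 'I_3 -> H1 D) (al be al' be' : 'I_2) :=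
  hom_coef (bending al be) (chib al be) (bending al' be').

End Homogenization.

(* Main.v *)
(* The cell problems are linear, so a symmetry of the textile cell that acts on
   the prescribed strains by signs relates the homogenized coefficients: the
   pulled-back corrector need not be compared with the given one, because the
   weak formulations, tested against each other, already determine the integrals
   (this is why neither uniqueness of the correctors nor Korn's inequality is
   needed). Three symmetries suffice. The reflection y1 -> 2 - y1 changes the sign
   of the strain M^12 and fixes M^11 and M^22; the map (y1, y2, y3) ->
   (y2, y1, -y3) exchanges M^11 and M^22; and the seam map, which translates the
   periodic structure by one period of the weave, y1 -> y1 + 1 mod 2, and changes
   the sign of y3, fixes the membrane strains and changes the sign of the bending
   strains, so that b = -b.

   The seam map is discontinuous across y1 = 1. To see that it preserves periodic
   H^1 functions one needs the trace of such a function on the wall y1 = 1. The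
   cell is a cylinder near this wall, and a bump function of y1 equal to 1 on the
   wall turns the trace into an integral over one half of the cell. *)

Require Import Defs.
From HB Require Import structures.
From mathcomp Require Import all_boot all_order all_algebra.
From mathcomp Require Import all_classical all_reals all_analysis.
From mathcomp Require Import measurable_realfun ring lra.

Set Implicit Arguments.
Unset Strict Implicit.
Unset Printing Implicit Defensive.

Import Order.TTheory GRing.Theory Num.Theory.
Import numFieldNormedType.Exports.

Local Open Scope classical_set_scope.
Local Open Scope ring_scope.

(** At the centre of the cell the first family of yarns lies above the second. A rigid symmetry of
    the cell fixes this centre, so if it reverses y3 it exchanges the two families, and such maps
    only give relations like b1111 = - b2222. The vanishing of b needs a translation of the periodic
    structure, and this is what brings in the discontinuous map.

    The hypothesis on the charts enters through a bound on the slope of the yarns, which makes the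
    cell a cylinder near the wall y1 = 1.

    A trace is known only through the Gauss-Green formula, against smooth functions whose support
    avoids the rest of a possibly irregular boundary. All the work is therefore done on test
    functions: they are cut off at the wall, and the limit is taken by dominated convergence. The
    cutoffs have derivatives of order n, which is harmless for test functions vanishing on the wall;
    subtracting a multiple of the bump produces such functions. The subtracted part is itself
    supported inside the cell, so both halves see one and the same wall trace. Under the seam map
    this wall trace becomes the new periodic trace, and the old periodicity becomes the matching
    condition on the wall. *)

Local Ltac blra := repeat match goal with H : is_true (_ && _) |- _ =>
  move: H => /andP[? ?] end; try (apply/andP; split); lra.

(** * Measure-preserving maps *)

Section MeasurePreserving.
Context {R : realType}.
Local Notation lam := (@lebesgue_measure R).

Definition preserves d (T : measurableType d) (m : set T -> \bar R) (f : T -> T) :=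
  measurable_fun setT f /\ forall A, measurable A -> m (f @^-1` A) = m A.

Lemma preserves_measurable d (T : measurableType d) (m : set T -> \bar R)
    (f : T -> T) A :
  preserves m f -> measurable A -> measurable (f @^-1` A).
Proof. by move=> [mf _] mA; rewrite -(setTI (_ @^-1` _)); exact: mf. Qed.

(** The measure m2 is first replaced by the pushforward inside the integral, as the two agree on
    measurable sets; positive and negative parts are then transported separately. *)
Lemma integral_transport d1 d2 (T1 : measurableType d1) (T2 : measurableType d2)
    (m1 : {measure set T1 -> \bar R}) (m2 : {measure set T2 -> \bar R})
    (f : T1 -> T2) A (h : T2 -> \bar R) :
    measurable_fun setT f -> (forall B, measurable B -> m2 B = m1 (f @^-1` B)) ->
    measurable A -> measurable_fun A h ->
  (\int[m2]_(x in A) h x = \int[m1]_(x in f @^-1` A) h (f x))%E.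
Proof.
move=> mf fE mA mh.
rewrite [LHS](_ : _ = \int[@pushforward _ _ T1 T2 R m1 f]_(x in A) h x)%E; last first.
  by apply: eq_measure_integral => B mB _; apply: fE.
rewrite [LHS]integralE [RHS]integralE.
rewrite (ge0_integral_pushforward mf)//; last exact: measurable_funepos.
rewrite (ge0_integral_pushforward mf)//; last exact: measurable_funeneg.
by rewrite -funepos_comp -funeneg_comp.
Qed.

Lemma preserves_integral d (T : measurableType d) (m : {measure set T -> \bar R})
    (f : T -> T) A (h : T -> \bar R) :
    preserves m f -> measurable A -> measurable_fun A h ->
  (\int[m]_(x in f @^-1` A) h (f x) = \int[m]_(x in A) h x)%E.
Proof.
move=> [mf fE] mA mh; apply/esym; apply: integral_transport => // B mB.
exact/esym/fE.
Qed.

Lemma preserves_Rintegral d (T : measurableType d) (m : {measure set T -> \bar R})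
    (f : T -> T) A (h : T -> R) :
    preserves m f -> measurable A -> measurable_fun A h ->
  \int[m]_(x in f @^-1` A) h (f x) = \int[m]_(x in A) h x.
Proof.
move=> pf mA mh; congr fine.
by apply: (preserves_integral (h := EFin \o h) pf mA); exact/measurable_EFinP.
Qed.

Lemma preserves_integrable d (T : measurableType d) (m : {measure set T -> \bar R})
    (f : T -> T) A (h : T -> \bar R) :
    preserves m f -> measurable A -> m.-integrable A h ->
  m.-integrable (f @^-1` A) (h \o f).
Proof.
move=> pf mA /integrableP[mh hoo]; apply/integrableP; split.
  apply: (measurable_comp mA _ mh); first by move=> _ [x ? <-].
  exact: measurable_funTS pf.1.
rewrite (preserves_integral (h := fun x => `|h x|%E) pf mA)//.
exact: measurableT_comp.
Qed.

Lemma preserves_comp d (T : measurableType d) (m : set T -> \bar R) (f g : T -> T) :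
  preserves m f -> preserves m g -> preserves m (f \o g).
Proof.
move=> pf pg; split; first exact: measurableT_comp pf.1 pg.1.
by move=> A mA; rewrite comp_preimage pg.2 ?pf.2//; exact: preserves_measurable pf _.
Qed.

Lemma preserves_id d (T : measurableType d) (m : set T -> \bar R) :
  preserves m (@id T).
Proof. by split. Qed.

(** By uniqueness of Lebesgue measure, it is enough that the image measure gives half-open intervals
    their length. The same argument serves for the reflection and, with rectangles, for products. *)
Lemma lebesgue_preserves_shift (c : R) : preserves lam (fun x => x + c).
Proof.
have mf : measurable_fun [set: measurableTypeR R] ((fun x => x + c) : measurableTypeR R -> measurableTypeR R).
  by apply: measurable_funD => //; exact: measurable_cst.
split => // A mA; apply/esym.
apply: (lebesgue_measure_unique (mu := pushforward lam (fun x : measurableTypeR R => (x + c : measurableTypeR R)))) => //.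
move=> _ [[a b] _ <-] /=; rewrite /pushforward.
rewrite (_ : _ @^-1` _ = `]a - c, b - c]%classic); last first.
  by apply/seteqP; split => x /=; rewrite !in_itv/= => /andP[]; lra.
rewrite !lebesgue_measure_itv/= !lte_fin ltrD2r; case: ifP => // _.
by rewrite -!EFinB; congr (_%:E); lra.
Qed.

Lemma lebesgue_preserves_opp : preserves lam (fun x => - x).
Proof.
have mf : measurable_fun [set: measurableTypeR R] ((fun x => - x) : measurableTypeR R -> measurableTypeR R).
  exact: oppr_measurable.
split => // A mA; apply/esym.
apply: (lebesgue_measure_unique (mu := pushforward lam (fun x : measurableTypeR R => (- x : measurableTypeR R)))) => //.
move=> _ [[a b] _ <-] /=; rewrite /pushforward.
rewrite (_ : _ @^-1` _ = `[ - b, - a[%classic); last first.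
  by apply/seteqP; split => x /=; rewrite !in_itv/= => /andP[]; lra.
rewrite !lebesgue_measure_itv/= !lte_fin ltrN2; case: ifP => // _.
by rewrite -!EFinB; congr (_%:E); lra.
Qed.

Lemma product_preserves d1 d2 (T1 : measurableType d1) (T2 : measurableType d2)
    (m1 : {sigma_finite_measure set T1 -> \bar R})
    (m2 : {sigma_finite_measure set T2 -> \bar R}) f g :
  preserves m1 f -> preserves m2 g ->
  preserves (m1 \x m2)%E (fun x => (f x.1, g x.2)).
Proof.
move=> pf pg; have [[mf fE] [mg gE]] := (pf, pg).
have mfg : measurable_fun setT (fun x : T1 * T2 => (f x.1, g x.2)).
  by apply/measurable_fun_pairP; split; [exact: measurableT_comp mf _|exact: measurableT_comp mg _].
split=> // A mA; apply/esym.
apply: (product_measure_unique (m' := pushforward (m1 \x m2)%E (fun x : T1 * T2 => (f x.1, g x.2)))) => //.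
move=> X Y mX mY.
transitivity ((m1 \x m2)%E ((f @^-1` X) `*` (g @^-1` Y))) => //.
rewrite product_measure1E; first by congr mule; [exact: fE|exact: gE].
  exact: preserves_measurable pf mX.
exact: preserves_measurable pg mY.
Qed.

Lemma product_preserves_swap d1 (T1 : measurableType d1)
    (m1 : {sigma_finite_measure set T1 -> \bar R}) :
  preserves (m1 \x m1)%E (fun x => (x.2, x.1)).
Proof.
have mf : measurable_fun setT (fun x : T1 * T1 => (x.2, x.1)).
  exact: measurable_swap.
split=> // A mA; apply/esym.
apply: (product_measure_unique (m' := pushforward (m1 \x m1)%E (fun x : T1 * T1 => (x.2, x.1)))) => //.
move=> X Y mX mY.
transitivity ((m1 \x m1)%E (Y `*` X)); last by rewrite product_measure1E// muleC.
by congr product_measure1; apply/seteqP; split => x [].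
Qed.

Lemma leb2_preserves f g : preserves lam f -> preserves lam g ->
  preserves (@leb2 R) (fun x => (f x.1, g x.2)).
Proof. move=> pf pg; have := product_preserves pf pg. exact. Qed.

Lemma leb2_preserves_swap : preserves (@leb2 R) (fun x => (x.2, x.1)).
Proof. have := product_preserves_swap lam. exact. Qed.

(* The sigma-finiteness of a product of Lebesgue measures is not found by
   canonical inference, hence this copy of [leb2]. *)
Definition sleb2 : set (measurableTypeR R * measurableTypeR R)%type -> \bar R := leb2.

HB.instance Definition _ := isMeasure.Build _ _ _ sleb2
  (measure0 (@leb2 R)) (measure_ge0 (@leb2 R)) (@measure_semi_sigma_additive _ _ _ (@leb2 R)).

Lemma sleb2_sigma_finite : sigma_finite setT sleb2.
Proof.
have /sigma_finiteP[F [TF ndF Foo]] := sigma_finiteT lam.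
exists (fun n => F n `*` F n).
  rewrite -setXTT TF predeqE => -[x y]; split.
    move=> [/= [n _ Fnx] [k _ Gky]]; exists (maxn n k) => //; split.
    - by move: x Fnx; exact/subsetPset/ndF/leq_maxl.
    - by move: y Gky; exact/subsetPset/ndF/leq_maxr.
  by move=> [n _ []/= ? ?]; split; exists n.
move=> k; have [? ?] := Foo k.
split; first exact: measurableX.
have -> : sleb2 (F k `*` F k) = (lam (F k) * lam (F k))%E by exact: product_measure1E.
by rewrite lte_mul_pinfty// ge0_fin_numE.
Qed.

HB.instance Definition _ := Measure_isSigmaFinite.Build _ _ _ sleb2 sleb2_sigma_finite.

Lemma leb3_preserves (f : R * R -> R * R) (g : R -> R) : preserves (@leb2 R) f -> preserves lam g ->
  preserves (@leb3 R) (fun x => (f x.1, g x.2)).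
Proof. exact: (product_preserves (m1 := sleb2)). Qed.

Definition assoc3 (z : R * (R * R)) : R3 R := (z.1, z.2.1, z.2.2).

(* Slicing R^3 along the first coordinate rather than the last one. *)
Lemma leb3_assoc A : measurable A ->
  @leb3 R A = (lam \x sleb2)%E (assoc3 @^-1` A).
Proof.
move=> mA.
have mF := measurable_fun_xsection lam mA.
transitivity (\int[lam]_x \int[lam]_y lam (xsection A (x, y)))%E.
  by have := fubini_tonelli1 (m1 := lam) (m2 := lam) (lam \o xsection A) mF (fun=> measure_ge0 _ _).
suff E x : (\int[lam]_y lam (xsection A (x, y)) = sleb2 (xsection (assoc3 @^-1` A) x))%E.
  by rewrite /product_measure1; apply: eq_integral => x _; exact: E.
rewrite /sleb2 /leb2 /= /product_measure1; apply: eq_integral => y _ /=.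
by congr (lam _); apply/seteqP; split => z; rewrite /xsection /= !inE/= !inE.
Qed.

Lemma measurable_assoc3 : measurable_fun setT assoc3.
Proof.
apply/measurable_fun_pairP; split; first (apply/measurable_fun_pairP; split).
- exact: measurable_fst.
- exact: (measurableT_comp measurable_fst measurable_snd).
- exact: (measurableT_comp measurable_snd measurable_snd).
Qed.

Lemma leb3_integral_assoc (f : R3 R -> \bar R) : measurable_fun setT f ->
  (\int[leb3]_y f y = \int[lam \x sleb2]_z f (assoc3 z))%E.
Proof.
move=> mf.
have := @integral_transport _ _ _ _ (lam \x sleb2)%E (@leb3 R) assoc3 setT f measurable_assoc3 leb3_assoc measurableT mf.
by rewrite preimage_setT.
Qed.

End MeasurePreserving.

(** * Open sets are measurable for the product sigma-algebras *)

Section OpenMeasurable.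
Context {R : realType}.

(* A countable base of measurable sets. *)
Definition has_base (T : topologicalType) (m : set (set T)) :=
  exists B : nat -> set T, (forall n, m (B n)) /\
    forall x U, nbhs x U -> exists n, B n x /\ B n `<=` U.

(** The measurable sets of R^2 and R^3 are those of a product sigma-algebra, generated by
    rectangles. Open sets belong to it because they are countable unions of measurable basic
    sets. *)
Lemma has_base_open (T : topologicalType) (m : set (set T)) (U : set T) :
  (forall P F, (forall n : nat, P n -> m (F n)) -> m (\bigcup_(n in P) F n)) ->
  has_base m -> open U -> m U.
Proof.
move=> mU [B [mB BU]] oU.
rewrite (_ : U = \bigcup_(n in [set n | B n `<=` U]) B n).
  by apply: mU => n _; exact: mB.
apply/seteqP; split => [x Ux|x [n /= BnU] Bx]; last exact: BnU.
have [n [Bx BnU]] := BU x U (open_nbhs_nbhs (conj oU Ux)).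
by exists n.
Qed.

Lemma has_base_R : has_base (fun A : set R => measurable (A : set (measurableTypeR R))).
Proof.
(* Open intervals with rational end points, enumerated by their codes; an integer that codes no pair
   is given the measurable set [setT]. *)
pose B n : set R := if unpickle n is Some pq then `](ratr (pq : rat * rat).1), (ratr pq.2)[%classic else setT.
exists B; split=> [n|x U].
  by rewrite /B; case: unpickle => [?|]; [exact: measurable_itv|exact: measurableT].
move=> /nbhs_ballP[e /= e0 eU].
have [p] := @rat_in_itvoo R (x - e) x ltac:(lra).
rewrite in_itv /= => /andP[p1 p2].
have [q] := @rat_in_itvoo R x (x + e) ltac:(lra).
rewrite in_itv /= => /andP[q1 q2].
exists (pickle (p, q)); rewrite /B pickleK /= in_itv /= p2 q1; split => // y.
rewrite /= in_itv /= => /andP[py yq]; apply: eU.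
rewrite /ball /= ltr_distl; lra.
Qed.

Lemma has_base_prod (T1 T2 : topologicalType) (m1 : set (set T1)) (m2 : set (set T2))
    (m : set (set (T1 * T2))) :
  m setT -> (forall A B, m1 A -> m2 B -> m (A `*` B)) ->
  has_base m1 -> has_base m2 -> has_base m.
Proof.
move=> mT mX [B1 [mB1 h1]] [B2 [mB2 h2]].
pose B n := if unpickle n is Some pq then B1 (pq : nat * nat).1 `*` B2 pq.2 else setT.
exists B; split => [n|[x y] U [[U1 U2] /= [n1 n2] U12]].
  by rewrite /B; case: unpickle => [[p q]|] //=; exact: mX.
have [p [Bp pU]] := h1 _ _ n1.
have [q [Bq qU]] := h2 _ _ n2.
exists (pickle (p, q)); rewrite /B pickleK /=; split => // z [z1 z2].
by apply: U12; split; [exact: pU|exact: qU].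
Qed.

Lemma has_base_R2 : has_base (fun A : set (R * R) =>
  measurable (A : set (measurableTypeR R * measurableTypeR R))).
Proof.
apply: has_base_prod has_base_R has_base_R; first exact: measurableT.
by move=> A B mA mB; exact: measurableX.
Qed.

Lemma open_measurable2 (U : set (R * R)) : open U ->
  measurable (U : set (measurableTypeR R * measurableTypeR R)).
Proof.
by apply: has_base_open has_base_R2 => P F mF; exact: bigcup_measurable.
Qed.

Lemma open_measurable3 (U : set (R3 R)) : open U ->
  measurable (U : set (measurableTypeR R * measurableTypeR R * measurableTypeR R)).
Proof.
apply: (@has_base_open _ (fun U : set (R3 R) => measurable (U : set (measurableTypeR R * measurableTypeR R * measurableTypeR R)))).
  by move=> P F mF; exact: bigcup_measurable.
apply: has_base_prod has_base_R2 has_base_R; first exact: measurableT.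
by move=> A B mA mB; exact: measurableX.
Qed.

Lemma continuous_measurable3 (u : R3 R -> R) (D : set (R3 R)) : continuous u ->
  measurable_fun D u.
Proof.
move=> /continuousP cu; apply: measurable_funTS.
apply: (measurability _ (RGenOpens.measurableE R)).
move=> _ [_ [a [b ->] <-]]; rewrite setTI; apply: open_measurable3.
exact/cu/interval_open.
Qed.

Lemma continuous_measurable2 (u : R * R -> R) (D : set (R * R)) : continuous u ->
  measurable_fun D u.
Proof.
move=> /continuousP cu; apply: measurable_funTS.
apply: (measurability _ (RGenOpens.measurableE R)).
move=> _ [_ [a [b ->] <-]]; rewrite setTI; apply: open_measurable2.
exact/cu/interval_open.
Qed.

End OpenMeasurable.

(** * Smooth functions *)

Section LineDerivatives.
Context {R : realType} {V : normedModType R}.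
Implicit Types f : V -> R.

(** Smoothness is expressed below by partial derivatives alone. Restriction to a line reduces a
    directional derivative to one real variable, where the chain rule applies. *)
Lemma is_derive_line f x v df :
  is_derive (0 : R) 1 (fun h : R => f (h *: v + x)) df <-> is_derive x v f df.
Proof.
have E : 'D_1 (fun h : R => f (h *: v + x)) (0 : R) = 'D_v f x.
  rewrite /derive; set g1 := fun h => h^-1 *: _; set g2 := fun h => h^-1 *: _.
  suff -> : g1 = g2 by [].
  by apply/funext => h; rewrite /g1 /g2 /= addr0 scale0r add0r [_%:A]mulr1.
split=> -[d1 d2]; apply: DeriveDef.
- exact: (derivable1P f x v).2 d1.
- by rewrite -E.
- exact: (derivable1P f x v).1 d1.
- by rewrite E.
Qed.

Lemma is_derive_lineZ f x v df (e : R) :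
  is_derive x v f df -> is_derive x (e *: v) f (e * df).
Proof.
move=> /is_derive_line d; apply/is_derive_line.
have -> : (fun h : R => f (h *: (e *: v) + x)) =
    (fun h : R => f (h *: v + x)) \o (fun h => e * h).
  by apply/funext => h /=; rewrite scalerA [h * e]mulrC.
have d' : is_derive (0 : R) 1 (fun h : R => e * h) e.
  by rewrite -[X in is_derive _ _ _ X]mulr1; exact: (is_deriveZ e (is_derive_id _ _)).
rewrite mulrC; apply: (is_derive1_comp _ d').
by rewrite mulr0.
Qed.

End LineDerivatives.

Lemma is_derive_affine {R : realType} {V W : normedModType R} (f : W -> R) (A : V -> W) y v w (df : R) :
  (forall h : R, A (h *: v + y) = h *: w + A y) ->
  is_derive (A y) w f df -> is_derive y v (f \o A) df.
Proof.
move=> Ah /is_derive_line d; apply/is_derive_line.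
by under eq_fun do rewrite /= Ah.
Qed.

(** * The functions t^-k exp(-1/t) *)

Section Flat.
Context {R : realType}.

(* All derivatives of exp(-1/t), extended by 0 to t <= 0, are combinations of
   these functions. *)
Definition flat (k : nat) (t : R) : R :=
  if 0 < t then t^-1 ^+ k * expR (- t^-1) else 0.

Lemma flat_ge0 k t : 0 <= flat k t.
Proof.
rewrite /flat; case: ifP => // t0.
by rewrite mulr_ge0 ?expR_ge0// exprn_ge0// invr_ge0 ltW.
Qed.

(** With s = 1/t this is s^k / k! <= exp s, one term of the exponential series. *)
Lemma flat_bound k t : flat k t <= k`!%:R.
Proof.
rewrite /flat; case: ifP => // t0.
have s0 : 0 <= t^-1 by rewrite invr_ge0 ltW.
rewrite expRN ler_pdivrMr ?expR_gt0//.
case: k => [|k]; first by rewrite expr0 fact0 mul1r -expR0 ler_expR.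
have := expR_ge1Dxn k s0.
have f0 : 0 < (k.+1)`!%:R :> R by rewrite ltr0n fact_gt0.
rewrite -ler_pdivrMl// [_^-1 * _]mulrC; lra.
Qed.

(** The bound for the index k + 2, with two powers of 1/t moved to the right. It makes the
    difference quotient at 0 of order h. *)
Lemma flat_sqr k t : flat k t <= (k.+2)`!%:R * t ^+ 2.
Proof.
have [t0|t0] := ltP 0 t; last first.
  by rewrite {1}/flat ltNge t0 /= mulr_ge0// ?ler0n ?sqr_ge0.
have := flat_bound k.+2 t; rewrite /flat t0 => H.
rewrite (_ : t^-1 ^+ k = t^-1 ^+ k.+2 * t ^+ 2); last first.
  by rewrite -addn2 exprD -mulrA -exprMn mulVf ?gt_eqF// expr1n mulr1.
by rewrite mulrAC ler_pM2r// exprn_gt0.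
Qed.

Lemma flat_neg k t : t <= 0 -> flat k t = 0.
Proof. by rewrite /flat leNgt => /negbTE ->. Qed.

(** The family is stable under derivation, so smoothness follows by induction on the order, for all
    indices at once. At t = 0 the derivative vanishes by the quadratic bound. *)
Lemma is_derive_flat k t :
  is_derive t (1 : R) (flat k) (flat k.+2 t - k%:R * flat k.+1 t).
Proof.
have [t0|t0|<-] := ltgtP 0 t.
- have e : (\forall s \near t, (s^-1 ^+ k * expR (- s^-1)) = flat k s).
    near=> s; rewrite /flat; case: ifPn => //; rewrite -leNgt => s0.
    exfalso; move: s0; apply/negP; rewrite -ltNge; near: s.
    exact: lt_nbhsr.
  apply: (near_eq_is_derive e).
  have t1 : t != 0 by rewrite gt_eqF.
  have dV : is_derive t (1 : R) (fun s : R => s^-1) (- t^-1 ^+ 2).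
    apply: is_derive_eq; first exact: (is_deriveV (f := id)).
    by rewrite /GRing.scale /= mulr1 exprVn.
  have dN : is_derive t (1 : R) (fun s : R => - s^-1) (t^-1 ^+ 2).
    by rewrite -[X in is_derive _ _ _ X]opprK; exact: is_deriveN.
  have d2 : is_derive t (1 : R) (fun s : R => expR (- s^-1)) (expR (- t^-1) * t^-1 ^+ 2).
    have H := @is_derive1_comp R expR (fun s : R => - s^-1) t _ _ (is_derive_expR (- t^-1)) dN.
    exact H.
  have dX (x : R) : is_derive x (1 : R) (fun s : R => s ^+ k) (k%:R * x ^+ k.-1).
    by apply: DeriveDef; [exact: exprn_derivable|rewrite exp_derive /GRing.scale /= mulr1].
  have d1 : is_derive t (1 : R) (fun s : R => s^-1 ^+ k) (k%:R * t^-1 ^+ k.-1 * (- t^-1 ^+ 2)).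
    have H := @is_derive1_comp R (fun s : R => s ^+ k) (fun s : R => s^-1) t _ _ (dX t^-1) dV.
    exact H.
  have H := is_deriveM d1 d2.
  suff <- : t^-1 ^+ k *: (expR (- t^-1) * t^-1 ^+ 2) + expR (- t^-1) *: (k%:R * t^-1 ^+ k.-1 * - t^-1 ^+ 2) =
      flat k.+2 t - k%:R * flat k.+1 t by exact H.
  rewrite /flat t0 /GRing.scale /=.
  case: k {e d1 dX H} => [|k]; first by rewrite !mul0r expr0; ring.
  by rewrite /= !exprS; ring.
- have e : (\forall s \near t, cst 0 s = flat k s).
    near=> s; rewrite flat_neg//=; apply: ltW; near: s; exact: lt_nbhsl.
  apply: (near_eq_is_derive e); rewrite !flat_neg ?ltW// mulr0 subr0.
  exact: is_derive_cst.
- rewrite !flat_neg// mulr0 subr0.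
  have H : (h^-1 *: (flat k (h *: 1 + 0) - flat k 0)) @[h --> (0:R)^'] --> (0:R).
    apply/cvgr0Pnorm_le => /= e e0.
    have C0 : 0 < (k.+2)`!%:R :> R by rewrite ltr0n fact_gt0.
    near=> h.
    have h0 : h != 0 by near: h; exact: nbhs_dnbhs_neq.
    rewrite addr0 [_%:A]mulr1 (flat_neg k (lexx 0)) subr0 /GRing.scale /= normrM.
    rewrite normfV ler_pdivrMl ?normr_gt0// ger0_norm ?flat_ge0//.
    apply: (le_trans (flat_sqr k h)); rewrite -real_normK ?num_real// expr2 mulrA.
    rewrite mulrC ler_pM2l ?normr_gt0// -ler_pdivlMl//.
    near: h; apply: dnbhs0_le; rewrite mulr_gt0// invr_gt0//.
  apply: DeriveDef; first by apply/cvg_ex; exists 0; exact: H.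
  by apply: cvg_lim => //; exact: H.
Unshelve. all: by end_near. Qed.

Lemma flat_continuous k : continuous (flat k).
Proof.
move=> t; apply: differentiable_continuous; apply/derivable1_diffP.
by have [] := is_derive_flat k t.
Qed.

Lemma flat0_le1 t : flat 0 t <= 1.
Proof. by have := flat_bound 0 t; rewrite fact0. Qed.

Lemma flat0_ge t : 0 < t -> 1 - t^-1 <= flat 0 t.
Proof. by move=> t0; rewrite /flat t0 expr0 mul1r; exact: expR_ge1Dx. Qed.

End Flat.

(** * Smoothness through partial derivatives *)

Section Smooth.
Context {R : realType}.
Implicit Types (u v phi : R3 R -> R) (K : set (R3 R)).

Lemma I3P (P : 'I_3 -> Prop) : P 0 -> P 1 -> P 2 -> forall i, P i.
Proof.
by move=> P0 P1 P2 [[|[|[|//]]] Hi];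
  [move: P0|move: P1|move: P2]; congr P; apply: val_inj.
Qed.

Lemma I2P (P : 'I_2 -> Prop) : P 0 -> P 1 -> forall i, P i.
Proof.
by move=> P0 P1 [[|[|//]] Hi]; [move: P0|move: P1]; congr P; apply: val_inj.
Qed.

Lemma continuous_coord3 (i : 'I_3) : continuous (@coord3 R i).
Proof.
elim/I3P: i => /= y.
- apply: (continuous_comp (f := fst) (g := fst)); exact: cvg_fst.
- apply: (continuous_comp (f := fst) (g := snd)); [exact: cvg_fst|exact: cvg_snd].
- exact: cvg_snd.
Qed.

Lemma continuous_R3 (T : topologicalType) (f g h : T -> R) :
  continuous f -> continuous g -> continuous h -> continuous (fun t => (f t, g t, h t)).
Proof.
by move=> cf cg ch t; exact: (cvg_pair (cvg_pair (cf t) (cg t)) (ch t)).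
Qed.

Lemma Ck_continuous k u : Ck k u -> continuous u.
Proof. by case: k => [|k] []. Qed.

Lemma CkS k u : Ck k.+1 u -> Ck k u.
Proof.
elim: k u => [|k IH] u [cu du]; first by split.
by split => // i; have [d c] := du i; split => //; exact: IH.
Qed.

Lemma Ck_cst k c : Ck k (cst c : R3 R -> R).
Proof.
elim: k c => [|k IH] c; first by split => // y; exact: cvg_cst.
split => [y|i]; first exact: cvg_cst.
split => [y|]; first exact: derivable_cst.
rewrite (_ : partial i _ = cst 0); first exact: IH.
by apply/funext => y; rewrite /partial derive_cst.
Qed.

Lemma CkD k u v : Ck k u -> Ck k v -> Ck k (fun y => u y + v y).
Proof.
elim: k u v => [|k IH] u v [cu du] [cv dv]; split => //.
- by move=> y; apply: cvgD; [exact: cu|exact: cv].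
- by move=> y; apply: cvgD; [exact: cu|exact: cv].
- move=> i; have [d1 c1] := du i; have [d2 c2] := dv i; split => [y|].
    exact: derivableD.
  rewrite (_ : partial i _ = fun y => partial i u y + partial i v y); first exact: IH.
  by apply/funext => y; apply: deriveD.
Qed.

Lemma partialM i u v y : derivable u y (basis3 i) -> derivable v y (basis3 i) ->
  partial i (fun y => u y * v y) y = u y * partial i v y + v y * partial i u y.
Proof. by move=> du dv; exact: (deriveM du dv). Qed.

Lemma CkM k u v : Ck k u -> Ck k v -> Ck k (fun y => u y * v y).
Proof.
elim: k u v => [|k IH] u v cu cv.
  by split => // y; apply: cvgM; [exact: Ck_continuous cu y|exact: Ck_continuous cv y].
split => [y|i]; first by apply: cvgM; [exact: Ck_continuous cu y|exact: Ck_continuous cv y].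
have [d1 c1] := cu.2 i; have [d2 c2] := cv.2 i; split => [y|]; first exact: derivableM.
rewrite (_ : partial i _ = fun y => u y * partial i v y + v y * partial i u y).
  by apply: CkD; apply: IH => //; exact: CkS.
by apply/funext => y; apply: partialM.
Qed.

Lemma smooth_continuous u : smooth u -> continuous u.
Proof. by move=> /(_ 0%N)[]. Qed.

Lemma smooth_derivable u i y : smooth u -> derivable u y (basis3 i).
Proof. by move=> /(_ 1%N)[_ /(_ i)[]]. Qed.

Lemma smooth_partial u i : smooth u -> smooth (partial i u).
Proof. by move=> su k; have [_ /(_ i)[]] := su k.+1. Qed.

Lemma smoothM u v : smooth u -> smooth v -> smooth (fun y => u y * v y).
Proof. by move=> su sv k; exact: CkM. Qed.

Lemma smoothD u v : smooth u -> smooth v -> smooth (fun y => u y + v y).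
Proof. by move=> su sv k; exact: CkD. Qed.

Lemma smooth_cst c : smooth (cst c : R3 R -> R).
Proof. by move=> k; exact: Ck_cst. Qed.

(** The linear part sends each basis vector to a multiple of a basis vector, so a partial derivative
    of a composite is again a single partial derivative. This covers translations, reflections and
    the exchange of the yarns, and, with a factor 0, the projection onto the wall y1 = 1. *)
Definition monomial_affine (A : R3 R -> R3 R) (pi : 'I_3 -> 'I_3) (eps : 'I_3 -> R) :=
  continuous A /\
  forall i (h : R) y, A (h *: basis3 i + y) = h *: (eps i *: basis3 (pi i)) + A y.

Lemma is_derive_monomial A pi eps phi i y : monomial_affine A pi eps ->
  derivable phi (A y) (basis3 (pi i)) ->
  is_derive y (basis3 i) (phi \o A) (eps i * partial (pi i) phi (A y)).
Proof.
move=> [_ hA] d; have dphi : is_derive (A y) (eps i *: basis3 (pi i)) phi (eps i * partial (pi i) phi (A y)).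
  by apply: is_derive_lineZ; exact: derivableP.
exact: (is_derive_affine (fun h => hA i h y) dphi).
Qed.

Lemma partial_monomial A pi eps phi i y : monomial_affine A pi eps -> smooth phi ->
  partial i (phi \o A) y = eps i * partial (pi i) phi (A y).
Proof.
move=> hA sphi; have d := @smooth_derivable phi (pi i) (A y) sphi.
by have [_ <-] := is_derive_monomial hA d.
Qed.

Lemma smooth_monomial A pi eps phi : monomial_affine A pi eps -> smooth phi ->
  smooth (phi \o A).
Proof.
move=> hA sphi k; elim: k phi sphi => [|k IH] phi sphi.
  split=> // y; apply: continuous_comp; first exact: hA.1.
  exact: smooth_continuous sphi _.
split=> [y|i].
  by apply: continuous_comp; [exact: hA.1|exact: smooth_continuous sphi _].
split=> [y|].
  by have [] := is_derive_monomial hA (@smooth_derivable phi (pi i) (A y) sphi).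
rewrite (_ : partial i _ = fun y => cst (eps i) y * (partial (pi i) phi \o A) y).
  by apply: CkM; [exact: Ck_cst|apply: IH; exact: smooth_partial].
by apply/funext => y; rewrite (partial_monomial _ _ hA).
Qed.

Lemma coord3_line i j (h : R) y :
  coord3 i (h *: basis3 j + y) = h * (i == j)%:R + coord3 i y.
Proof. by elim/I3P: i; elim/I3P: j; case: y => [[a b] c]; rewrite /coord3/=. Qed.

Lemma is_derive_coord (f : R -> R) i j a b df y :
  is_derive (a * coord3 i y + b) 1 f df ->
  is_derive y (basis3 j) (fun y => f (a * coord3 i y + b)) (df * (a * (i == j)%:R)).
Proof.
move=> d; apply/is_derive_line.
pose g (h : R) := h * (a * (i == j)%:R) + (a * coord3 i y + b).
have dg : is_derive (0 : R) (1 : R) g (a * (i == j)%:R).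
  have H := is_deriveD (is_deriveZ (a * (i == j)%:R) (is_derive_id (0 : R) (1 : R))) (is_derive_cst (a * coord3 i y + b) (0 : R) (1 : R)).
  rewrite [X in is_derive _ _ _ X](_ : _ = (a * (i == j)%:R) *: 1 + 0); last first.
    by rewrite addr0 /GRing.scale /= mulr1.
  rewrite (_ : g = (a * (i == j)%:R) \*: id + cst (a * coord3 i y + b)); first exact H.
  by apply/funext => h; rewrite /g mulrC.
have -> : (fun h : R => f (a * coord3 i (h *: basis3 j + y) + b)) = f \o g.
  by apply/funext => h /=; congr f; rewrite coord3_line /g; ring.
by apply: (is_derive1_comp _ dg); rewrite /g mul0r add0r.
Qed.

Lemma smooth_flat n i a b : smooth (fun y : R3 R => flat n (a * coord3 i y + b)).
Proof.
move=> k; elim: k n => [|k IH] n.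
  split=> // y; apply: (continuous_comp (f := fun y => a * coord3 i y + b) (g := flat n)); last exact: flat_continuous.
  apply: cvgD; last exact: cvg_cst.
  by apply: cvgM; [exact: cvg_cst|exact: continuous_coord3].
split=> [y|j].
  apply: (continuous_comp (f := fun y => a * coord3 i y + b) (g := flat n)); last exact: flat_continuous.
  apply: cvgD; last exact: cvg_cst.
  by apply: cvgM; [exact: cvg_cst|exact: continuous_coord3].
split=> [y|]; first by have [] := is_derive_coord j (is_derive_flat n (a * coord3 i y + b)).
rewrite (_ : partial j _ = fun y => (flat n.+2 (a * coord3 i y + b) + cst (- n%:R) y * flat n.+1 (a * coord3 i y + b)) * cst (a * (i == j)%:R) y).
  apply: CkM; last exact: Ck_cst.
  by apply: CkD => //; apply: CkM => //; exact: Ck_cst.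
apply/funext => y; have [_] := is_derive_coord j (is_derive_flat n (a * coord3 i y + b)).
by rewrite /partial => ->; rewrite /= mulNr.
Qed.

Lemma compact_closed3 K : compact K -> closed K.
Proof. by apply: compact_closed; exact: norm_hausdorff. Qed.

Lemma supported_partial K u i : compact K -> supported_in K u -> supported_in K (partial i u).
Proof.
move=> /compact_closed3 cK sK y Ky; rewrite /partial.
rewrite (near_eq_derive (g := cst 0)); first exact: derive_cst.
have : nbhs y (~` K) by apply: open_nbhs_nbhs; split => //; exact: closed_openC.
by apply: filterS => z Kz; rewrite sK.
Qed.

Lemma supported_bounded K u : compact K -> continuous u -> supported_in K u ->
  exists M, 0 <= M /\ forall y, `|u y| <= M.
Proof.
move=> cK cu sK.
have := compact_bounded (continuous_compact (continuous_subspaceT cu) cK).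
move=> [M [_ /(_ (`|M| + 1))]].
have -> : M < `|M| + 1 by have := ler_norm M; lra.
move=> /(_ isT) H; exists (`|M| + 1); split; first by have := normr_ge0 M; lra.
move=> y; have [Ky|nKy] := pselect (K y); first by apply: H; exists y.
by rewrite sK// normr0; have := normr_ge0 M; lra.
Qed.

(** Used with t = 1: a test function vanishing on the wall is bounded by a constant times the
    distance to the wall. *)
Lemma smooth_lipschitz0 u M : smooth u -> (forall y, `|partial 0 u y| <= M) ->
  forall s t x z, `|u (s, x, z) - u (t, x, z)| <= M * `|s - t|.
Proof.
move=> su uM.
have lt_case s t x z : s < t -> `|u (t, x, z) - u (s, x, z)| <= M * `|t - s|.
  move=> st.
  have d (r : R) : is_derive r (1 : R) (fun r => u (r, x, z)) (partial 0 u (r, x, z)).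
    have -> : (fun r => u (r, x, z)) = u \o (fun r : R => (r, x, z)) by [].
    apply: (is_derive_affine (w := basis3 0)) => [h|]; last exact: derivableP (@smooth_derivable u 0 (r, x, z) su).
    rewrite (_ : h *: basis3 0 = (h, 0, 0)); last first.
      by congr (_, _, _); rewrite /= /GRing.scale /= ?mulr1 ?mulr0.
    by congr (_, _, _); rewrite /= ?add0r// [_%:A]mulr1.
  have [|c _ ->] := MVT st (fun r _ => d r).
    apply: continuous_subspaceT => r.
    by apply: differentiable_continuous; apply/derivable1_diffP; have [] := d r.
  by rewrite normrM ler_wpM2r.
move=> s t x z; have [st|ts|->] := ltgtP s t.
- by rewrite distrC [`|s - t|]distrC; exact: lt_case.
- exact: lt_case.
- by rewrite !subrr normr0 mulr0.
Qed.

End Smooth.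

(** * Energies and symmetries *)

Section L2.
Context d (T : measurableType d) {R : realType} (m : {measure set T -> \bar R}) (D : set T).
Hypothesis mD : measurable D.
Implicit Types f g : T -> R.

Lemma integrable_le f g : measurable_fun D f -> m.-integrable D (EFin \o g) ->
  (forall x, D x -> `|f x| <= g x) -> m.-integrable D (EFin \o f).
Proof.
move=> mf ig fg; apply: le_integrable ig => //; first exact/measurable_EFinP.
move=> x Dx /=; rewrite lee_fin (le_trans (fg x Dx))//; exact: ler_norm.
Qed.

Lemma integrableRD f g : m.-integrable D (EFin \o f) -> m.-integrable D (EFin \o g) ->
  m.-integrable D (EFin \o (fun x => f x + g x)).
Proof. by move=> i1 i2; have := integrableD mD i1 i2. Qed.

Lemma integrableRZ c f : m.-integrable D (EFin \o f) ->
  m.-integrable D (EFin \o (fun x => c * f x)).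
Proof. by move=> i1; have := integrableZl mD c i1. Qed.

Lemma integrableR_sum (I : Type) (s : seq I) (h : I -> T -> R) :
  (forall i, m.-integrable D (EFin \o h i)) ->
  m.-integrable D (EFin \o (fun x => \sum_(i <- s) h i x)).
Proof.
move=> ih; have := integrable_sum mD s (P := xpredT) (fun i _ => ih i).
by apply: eq_integrable => // x _ /=; rewrite sumEFin.
Qed.

Lemma L2M_integrable f g : L2 m D f -> L2 m D g ->
  m.-integrable D (EFin \o (fun x => f x * g x)).
Proof.
move=> [mf f2] [mg g2].
apply: (@integrable_le _ (fun x => f x ^+ 2 + g x ^+ 2)).
- exact: measurable_funM.
- exact: integrableRD.
- move=> x _; rewrite normrM.
  rewrite -(@real_normK _ (f x)) ?num_real// -(@real_normK _ (g x)) ?num_real//.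
  have := sqr_ge0 (`|f x| - `|g x|); have := normr_ge0 (f x); have := normr_ge0 (g x); nra.
Qed.

Lemma L2D f g : L2 m D f -> L2 m D g -> L2 m D (fun x => f x + g x).
Proof.
move=> Lf Lg; have [[mf f2] [mg g2]] := (Lf, Lg); split; first exact: measurable_funD.
have i2 := integrableRD (integrableRD f2 (integrableRZ 2 (L2M_integrable Lf Lg))) g2.
by apply: eq_integrable i2 => // x _ /=; congr (_%:E); ring.
Qed.

Lemma L2Z c f : L2 m D f -> L2 m D (fun x => c * f x).
Proof.
move=> [mf f2]; split; first by apply: measurable_funM => //; exact: measurable_cst.
by apply: eq_integrable (integrableRZ (c ^+ 2) f2) => // x _ /=; congr (_%:E); ring.
Qed.

Lemma L2_bounded f M : (m D < +oo)%E -> measurable_fun D f ->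
  (forall x, D x -> `|f x| <= M) -> L2 m D f.
Proof.
move=> Doo mf fM; split=> //.
apply: (@integrable_le _ (fun=> M ^+ 2)).
- exact: measurable_funX.
- apply: measurable_bounded_integrable => //.
  exists `|M ^+ 2|; split; first by rewrite num_real.
  by move=> y yM x _ /=; apply: ltW; exact: yM.
- move=> x Dx; rewrite normrX; have := fM x Dx; have := normr_ge0 (f x); nra.
Qed.

End L2.

Local Notation contract := Defs.contract.

(** * The isotropic tensor under signed permutations *)

Section Contraction.
Context {R : realType}.
Implicit Types (S T U : 'M[R]_3) (a : elasticity_tensor (R := R)).

Lemma contractDl a S T U : contract a (S + T) U = contract a S U + contract a T U.
Proof.
rewrite /contract -big_split/=; apply: eq_bigr => i _.
rewrite -big_split/=; apply: eq_bigr => j _.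
rewrite -big_split/=; apply: eq_bigr => k _.
by rewrite -big_split/=; apply: eq_bigr => l _; rewrite mxE; ring.
Qed.

Lemma contractZl a c S T : contract a (c *: S) T = c * contract a S T.
Proof.
rewrite /contract mulr_sumr; apply: eq_bigr => i _.
rewrite mulr_sumr; apply: eq_bigr => j _.
rewrite mulr_sumr; apply: eq_bigr => k _.
by rewrite mulr_sumr; apply: eq_bigr => l _; rewrite mxE; ring.
Qed.

(** The major symmetry a_ijkl = a_klij. It makes the energy symmetric, so that the weak formulations
    can be tested against one another. *)
Lemma contract_isotropicC lambda mu S T :
  contract (isotropic lambda mu) S T = contract (isotropic lambda mu) T S.
Proof.
have E (f : 'I_3 -> 'I_3 -> 'I_3 -> 'I_3 -> R) :
    \sum_i \sum_j \sum_k \sum_l f i j k l = \sum_k \sum_l \sum_i \sum_j f i j k l.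
  rewrite pair_bigA/=; under eq_bigr do rewrite pair_bigA/=.
  rewrite exchange_big/= [RHS]pair_bigA/=; apply: eq_bigr => q _.
  by rewrite [RHS]pair_bigA.
rewrite /contract E; apply: eq_bigr => k _; apply: eq_bigr => l _.
apply: eq_bigr => i _; apply: eq_bigr => j _.
by rewrite /isotropic (eq_sym i k) (eq_sym j l) (eq_sym i l) (eq_sym j k); ring.
Qed.

(** Conjugation of S by a signed permutation matrix. If the displacement u is pulled back to [eps i]
    * (u_(pi i) o T), its strain is the image under [act] of the strain of u at T y. *)
Definition act (pi : 'I_3 -> 'I_3) (eps : 'I_3 -> R) S : 'M[R]_3 :=
  \matrix_(i, j) (eps i * eps j * S (pi i) (pi j)).

Lemma actD pi eps S T : act pi eps (S + T) = act pi eps S + act pi eps T.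
Proof. by apply/matrixP => i j; rewrite !mxE mulrDr. Qed.

Lemma actK pi eps S : involutive pi -> (forall i, eps i * eps i = 1) ->
  (forall i, eps (pi i) = eps i) -> act pi eps (act pi eps S) = S.
Proof.
move=> piK e1 ep; apply/matrixP => i j; rewrite !mxE !ep !piK.
rewrite (_ : _ * _ = (eps i * eps i) * (eps j * eps j) * S i j); last by ring.
by rewrite !e1 !mul1r.
Qed.

(** Isotropy: the tensor is invariant under orthogonal matrices. The permutation is absorbed by
    reindexing the four sums, and the signs cancel in pairs. *)
Lemma contract_act lambda mu pi eps S T : involutive pi -> (forall i, eps i * eps i = 1) ->
  contract (isotropic lambda mu) (act pi eps S) (act pi eps T) =
  contract (isotropic lambda mu) S T.
Proof.
move=> piK e1; have pI := inv_inj piK.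
rewrite /contract [RHS](reindex_inj pI)/=; apply: eq_bigr => i _.
rewrite [RHS](reindex_inj pI)/=; apply: eq_bigr => j _.
rewrite [RHS](reindex_inj pI)/=; apply: eq_bigr => k _.
rewrite [RHS](reindex_inj pI)/=; apply: eq_bigr => l _.
rewrite !mxE /isotropic !(inj_eq pI).
(* Where a Kronecker delta does not vanish, its two indices carry the same sign, whose square is
   1. *)
have H (x y : 'I_3) : (x == y)%:R * eps x * eps y = (x == y)%:R :> R.
  by case: eqP => [->|_]; rewrite ?mul0r// mul1r e1.
rewrite -!mulrA; rewrite [RHS]mulrCA.
rewrite (_ : _ * (eps i * _) = S (pi i) (pi j) * T (pi k) (pi l) *
  (lambda * (((i == j)%:R * eps i * eps j) * ((k == l)%:R * eps k * eps l)) +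
   mu * (((i == k)%:R * eps i * eps k) * ((j == l)%:R * eps j * eps l) +
         ((i == l)%:R * eps i * eps l) * ((j == k)%:R * eps j * eps k)))); last by ring.
by rewrite !H; ring.
Qed.

End Contraction.

(** * Energies and coefficients under a symmetry of the cell *)

Section Homogenized.
Context {R : realType} (D : set (R3 R)) (lambda mu : R).
Hypothesis mD : measurable (D : set (measurableTypeR R * measurableTypeR R * measurableTypeR R)).
Local Notation a := (isotropic lambda mu).
Implicit Types (F G X Y : R3 R -> 'M[R]_3).

Definition L2field F := forall i j, L2 leb3 D (fun y => F y i j).

Definition energy X Y := \int[leb3]_(y in D) contract a (X y) (Y y).

Lemma contract_integrable X Y : L2field X -> L2field Y ->
  leb3.-integrable D (EFin \o (fun y => contract a (X y) (Y y))).
Proof.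
move=> LX LY; do 4 (apply: (integrableR_sum mD) => ?).
apply: eq_integrable (integrableRZ mD _ (L2M_integrable mD (LX _ _) (LY _ _))) => //.
by move=> y _ /=; rewrite mulrA.
Qed.

(** Fields are compared off a null set because the seam map is the identity on the wall y1 = 1,
    where a bending strain fails to change its sign. For the affine symmetries the set is empty. *)
Lemma energy_null (N : set (measurableTypeR R * measurableTypeR R * measurableTypeR R)) X X' Y Y' :
    measurable N -> leb3 N = 0%E -> L2field X -> L2field X' -> L2field Y -> L2field Y' ->
    (forall y, D y -> ~ N y -> X y = X' y) -> (forall y, D y -> ~ N y -> Y y = Y' y) ->
  energy X Y = energy X' Y'.
Proof.
move=> mN N0 LX LX' LY LY' XX' YY'.
rewrite /energy /Rintegral (negligible_integral mN mD (contract_integrable LX LY) N0).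
rewrite (negligible_integral mN mD (contract_integrable LX' LY') N0); congr fine.
by apply: eq_integral => y /set_mem[Dy nN] /=; rewrite XX'// YY'.
Qed.

Lemma energyC X Y : energy X Y = energy Y X.
Proof. by apply: eq_Rintegral => y _; rewrite contract_isotropicC. Qed.

Lemma energyDl X X' Y : L2field X -> L2field X' -> L2field Y ->
  energy (fun y => X y + X' y) Y = energy X Y + energy X' Y.
Proof.
move=> LX LX' LY; rewrite /energy -RintegralD//; try exact: contract_integrable.
by apply: eq_Rintegral => y _; rewrite contractDl.
Qed.

Lemma energyZl c X Y : L2field X -> L2field Y ->
  energy (fun y => c *: X y) Y = c * energy X Y.
Proof.
move=> LX LY; rewrite /energy -RintegralZl//; last exact: contract_integrable.
by apply: eq_Rintegral => y _; rewrite contractZl.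
Qed.

Lemma L2field_sym_grad (w : 'I_3 -> H1 D) : L2field (sym_grad w).
Proof.
move=> i j; have := L2Z mD 2^-1 (L2D mD (H1grad_L2 (w i) j) (H1grad_L2 (w j) i)).
by congr L2; apply/funext => y; rewrite mxE.
Qed.

Lemma L2fieldD X Y : L2field X -> L2field Y -> L2field (fun y => X y + Y y).
Proof.
move=> LX LY i j; have := L2D mD (LX i j) (LY i j).
by congr L2; apply/funext => y; rewrite mxE.
Qed.

Lemma L2fieldZ c X : L2field X -> L2field (fun y => c *: X y).
Proof.
move=> LX i j; have := L2Z mD c (LX i j).
by congr L2; apply/funext => y; rewrite mxE.
Qed.

(** Here [pi] and [eps] describe the linear part of [T] where [T] is affine. This link is carried by
    [pulls_back] instead, so that the discontinuous seam map is covered as well. *)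
Definition cell_symmetry (T : R3 R -> R3 R) (pi : 'I_3 -> 'I_3) (eps : 'I_3 -> R) :=
  [/\ preserves leb3 T, T @^-1` D = D, involutive T, involutive pi &
      (forall i, eps i * eps i = 1) /\ (forall i, eps (pi i) = eps i)].

(** The intended v is c * (u o T); only its gradient is recorded, since the energies see nothing
    else. The factor c is there to attach the sign [eps i] to the i-th component of a
    displacement. *)
Definition pulls_back (T : R3 R -> R3 R) (pi : 'I_3 -> 'I_3) (eps : 'I_3 -> R) :=
  forall c (u : H1 D), H1per0 u -> exists v : H1 D, H1per0 v /\
    forall i y, H1grad v i y = c * (eps i * H1grad u (pi i) (T y)).

Section Symmetry.
Variables (T : R3 R -> R3 R) (pi : 'I_3 -> 'I_3) (eps : 'I_3 -> R).
Hypotheses (symT : cell_symmetry T pi eps) (pullT : pulls_back T pi eps).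

Lemma L2_comp_symmetry f : L2 leb3 D f -> L2 leb3 D (f \o T).
Proof.
have [pT TD _ _ _] := symT; move=> [mf f2]; split.
  rewrite -TD; apply: (measurable_comp mD _ mf); last exact: measurable_funTS pT.1.
  by move=> _ [x Dx <-].
by rewrite -TD; exact: (preserves_integrable pT mD f2).
Qed.

Lemma L2field_act X : L2field X -> L2field (fun y => act pi eps (X (T y))).
Proof.
move=> LX i j; have := L2Z mD (eps i * eps j) (L2_comp_symmetry (LX (pi i) (pi j))).
by congr L2; apply/funext => y; rewrite mxE.
Qed.

Lemma energy_act X Y : L2field X -> L2field Y ->
  energy (fun y => act pi eps (X (T y))) (fun y => act pi eps (Y (T y))) = energy X Y.
Proof.
have [pT TD _ piK [e1 _]] := symT; move=> LX LY.
rewrite /energy; under eq_Rintegral do rewrite contract_act//.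
have mh : measurable_fun D (fun y => contract a (X y) (Y y)).
  by have /integrableP[/measurable_EFinP] := contract_integrable LX LY.
by rewrite -{1}TD (preserves_Rintegral pT mD mh).
Qed.

Lemma pull_sym_grad (w : 'I_3 -> H1 D) : (forall i, H1per0 (w i)) ->
  exists2 v : 'I_3 -> H1 D, (forall i, H1per0 (v i)) &
    forall y, sym_grad v y = act pi eps (sym_grad w (T y)).
Proof.
move=> pw.
have ex i := cid (pullT (eps i) (pw (pi i))).
exists (fun i => sval (ex i)) => [i|y]; first by case: (svalP (ex i)).
apply/matrixP => i j; rewrite !mxE.
have [_ ->] := svalP (ex i); have [_ ->] := svalP (ex j); ring.
Qed.

(** Let w be the pull-back of chi and E the energy. Testing the problem of xi0 with w and with chi0
    gives E(G0, e(w)) = - E(e(xi0), e(w)) = cF E(F0, e(xi0)) and E(G0, e(chi0)) = - E(e(xi0),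
    e(chi0)) = E(F0, e(xi0)). Both coefficients are thus expressed by the same two energies E(F0,
    G0) and E(F0, e(xi0)). *)
Lemma hom_coef_symmetry (N : set (measurableTypeR R * measurableTypeR R * measurableTypeR R))
    F F0 G G0 cF cG (chi chi0 xi0 : 'I_3 -> H1 D) :
    measurable N -> leb3 N = 0%E ->
    L2field F -> L2field F0 -> L2field G -> L2field G0 ->
    (forall y, D y -> ~ N y -> act pi eps (F (T y)) = cF *: F0 y) ->
    (forall y, D y -> ~ N y -> act pi eps (G (T y)) = cG *: G0 y) ->
    corrector a F chi -> corrector a F0 chi0 -> corrector a G0 xi0 ->
  hom_coef a F chi G = cF * cG * hom_coef a F0 chi0 G0.
Proof.
have [pT TD TK piK [e1 ep]] := symT.
move=> mN N0 LF LF0 LG LG0 actF actG [pchi cchi] [pchi0 cchi0] [pxi0 cxi0].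
have [w pw ew] := pull_sym_grad pchi.
have [x px ex] := pull_sym_grad pxi0.
have Lchi := L2field_sym_grad chi; have Lchi0 := L2field_sym_grad chi0.
have Lxi0 := L2field_sym_grad xi0; have Lw := L2field_sym_grad w.
have Lx := L2field_sym_grad x.
have sumE F' G' (v : 'I_3 -> H1 D) : L2field F' -> L2field G' ->
    \int[leb3]_(y in D) contract a (F' y + sym_grad v y) (G' y) =
    energy F' G' + energy (sym_grad v) G'.
  by move=> LF' LG'; rewrite -energyDl//; exact: L2field_sym_grad.
have actFw y : D y -> ~ N y -> act pi eps (F (T y) + sym_grad chi (T y)) = cF *: F0 y + sym_grad w y.
  by move=> Dy nN; rewrite actD actF// -ew.
(* The field w solves the problem with strain cF F0, at least against xi0: the problem of chi is
   tested with the pull-back x of xi0, and [T] being an involution, a change of variables turns the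
   strain of x back into that of xi0. *)
have wcor : cF * energy F0 (sym_grad xi0) + energy (sym_grad w) (sym_grad xi0) = 0.
  rewrite -energyZl// -energyDl//; last exact: L2fieldZ.
  rewrite -(cchi x px).
  rewrite -[RHS](energy_act (X := fun y => F y + sym_grad chi y) (Y := sym_grad x))//; last exact: L2fieldD.
  apply: (energy_null mN N0) => [||||y Dy nN|y Dy nN].
  - by apply: L2fieldD => //; exact: L2fieldZ.
  - by apply: (@L2field_act (fun y => F y + sym_grad chi y)); exact: L2fieldD.
  - exact: Lxi0.
  - exact: L2field_act.
  - by rewrite actFw.
  - by rewrite ex TK actK.
have e1' := cxi0 w pw; rewrite (sumE _ _ _ LG0 Lw) in e1'.
have e2 := cxi0 chi0 pchi0; rewrite (sumE _ _ _ LG0 Lchi0) in e2.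
have e3 := cchi0 xi0 pxi0; rewrite (sumE _ _ _ LF0 Lxi0) in e3.
rewrite /hom_coef mulrCA; congr (_ * _).
rewrite (sumE _ _ _ LF0 LG0).
transitivity (energy (fun y => cF *: F0 y + sym_grad w y) (fun y => cG *: G0 y)).
  rewrite -[LHS](energy_act (X := fun y => F y + sym_grad chi y) (Y := G))//; last exact: L2fieldD.
  apply: (energy_null mN N0) => [||||y Dy nN|y Dy nN].
  - by apply: (@L2field_act (fun y => F y + sym_grad chi y)); exact: L2fieldD.
  - by apply: L2fieldD => //; exact: L2fieldZ.
  - exact: L2field_act.
  - exact: L2fieldZ.
  - by rewrite actFw.
  - by rewrite actG.
rewrite energyC energyZl//; last by apply: L2fieldD => //; exact: L2fieldZ.
rewrite energyC energyDl ?energyZl//; last exact: L2fieldZ.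
rewrite (energyC (sym_grad w) G0) (energyC (sym_grad chi0) G0).
rewrite (energyC (sym_grad xi0) (sym_grad w)) in e1'.
rewrite (energyC (sym_grad xi0) (sym_grad chi0)) in e2.
have -> : energy G0 (sym_grad w) = cF * energy F0 (sym_grad xi0) by lra.
have -> : energy G0 (sym_grad chi0) = energy F0 (sym_grad xi0) by lra.
ring.
Qed.

End Symmetry.
End Homogenized.

(** * Symmetries of the yarns *)

Section DeriveReflection.
Context {R : realType}.
Implicit Types f : R -> R.

Lemma derive1_default f x : ~ derivable f x 1 -> f^`()%classic x = 0.
Proof. by rewrite derive1E /derivable /derive => /dvgP ->. Qed.

Lemma is_derive_pm f e a b x : derivable f (a * x + b) 1 ->
  is_derive x (1 : R) (fun s => e * f (a * s + b)) (e * (f^`()%classic (a * x + b) * a)).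
Proof.
move=> df.
have dl : is_derive x (1 : R) (fun s : R => a * s + b) a.
  have H := is_deriveD (is_deriveZ a (is_derive_id x (1 : R))) (is_derive_cst b x (1 : R)).
  rewrite [X in is_derive _ _ _ X](_ : _ = a *: 1 + 0); last first.
    by rewrite addr0 /GRing.scale /= mulr1.
  exact H.
have df' : is_derive (a * x + b) (1 : R) f (f^`()%classic (a * x + b)).
  by rewrite derive1E; exact: derivableP.
have dc := @is_derive1_comp R f (fun s : R => a * s + b) x _ _ df' dl.
have H := is_deriveZ e dc.
exact H.
Qed.

(** Where f has no derivative both sides take the default value 0, so the symmetries of the slope of
    [Phi] follow from those of [Phi] alone. *)
Lemma derive1_pm f e a b x : e * e = 1 -> a * a = 1 ->
  (fun s => e * f (a * s + b))^`()%classic x = e * a * f^`()%classic (a * x + b).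
Proof.
move=> e1 a1; have [df|ndf] := pselect (derivable f (a * x + b) 1).
  by rewrite derive1E; have [_ ->] := is_derive_pm e df; ring.
rewrite (derive1_default ndf) mulr0; apply: derive1_default => dg; apply: ndf.
set g := fun s => _ in dg.
(* As e and a are their own inverses, the substitution can be undone, and a derivative of g would
   give one of f. *)
have -> : f = fun u => e * g (a * u + - (a * b)).
  apply/funext => u; rewrite /g mulrA e1 mul1r; congr f.
  by rewrite mulrDr mulrA a1 mul1r mulrN mulrA a1 mul1r subrK.
have E : a * (a * x + b) + - (a * b) = x by rewrite mulrDr mulrA a1 mul1r addrK.
have dg' : derivable g (a * (a * x + b) + - (a * b)) 1 by rewrite E.
by have [] := is_derive_pm e dg'.
Qed.

Lemma near_eq_derive1 f g x : (\forall s \near x, f s = g s) ->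
  f^`()%classic x = g^`()%classic x.
Proof. by move=> fg; rewrite !derive1E; exact: near_eq_derive. Qed.

(** Converts a Lipschitz bound of a chart into a bound on the slope of [Phi]; at a point without
    derivative the default value 0 satisfies it. *)
Lemma derive1_lipschitz f x C e0 : 0 <= C -> 0 < e0 ->
    (forall s, `|s - x| < e0 -> `|f s - f x| <= C * `|s - x|) ->
  `|f^`()%classic x| <= C.
Proof.
move=> C0 e00 fC; have [df|ndf] := pselect (derivable f x 1); last first.
  by rewrite derive1_default// normr0.
rewrite derive1E.
have cq : `|h^-1 *: ((f \o shift x) (h *: 1) - f x)| @[h --> (0:R)^'] --> `|'D_1 f x|.
  by apply: cvg_norm; exact: df.
have nC : \forall h \near (0:R)^', `|h^-1 *: ((f \o shift x) (h *: 1) - f x)| <= C.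
  near=> h.
  have h0 : h != 0 by near: h; exact: nbhs_dnbhs_neq.
  rewrite normrM normfV ler_pdivrMl ?normr_gt0// /= [_%:A]mulr1 mulrC.
  have := fC (h + x); rewrite addrK; apply.
  by near: h; exact: dnbhs0_lt.
have := limr_le (cvgP _ cq) nC.
by rewrite (cvg_lim (@norm_hausdorff _ _) cq); apply.
Unshelve. all: by end_near. Qed.

End DeriveReflection.

(** * Reflections, half-period shifts and straightness of the yarns *)

Section PhiSymmetries.
Context {R : realType} (kappa : R).
Hypotheses (k0 : 0 < kappa) (k1 : kappa * 2 < 1).
Local Ltac klra := have ? := k0; have ? := k1; blra.
Local Ltac knra := have ? := k0; have ? := k1; nra.
Local Notation Phi := (Phi kappa).

Definition ramp (t : R) : R :=
  if t <= kappa then - kappa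
  else if t <= 1 - kappa then
    kappa * (6 * ((t - kappa) / (1 - 2 * kappa)) ^+ 2 - 4 * ((t - kappa) / (1 - 2 * kappa)) ^+ 3 - 1)
  else kappa.

Lemma PhiE z : 0 < z < 2 -> Phi z = ramp (if z <= 1 then z else 2 - z).
Proof.
move=> z02; rewrite /Defs.Phi.
have -> : Num.floor (z / 2) = 0.
  by apply: floor_def; rewrite add0r mulr1z mulr0z; klra.
by rewrite mulr0 subr0.
Qed.

(** The cubic 6 s^2 - 4 s^3 - 1 changes its sign under s -> 1 - s, and the plateaus are exchanged.
    At t = kappa and t = 1 - kappa the two sides fall into different branches, which match there by
    continuity. *)
Lemma ramp_opp t : ramp (1 - t) = - ramp t.
Proof.
have kn : 1 - 2 * kappa != 0 by rewrite gt_eqF//; klra.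
rewrite /ramp.
have [t1|t1] := leP t kappa; have [t2|t2] := leP t (1 - kappa);
  have [t3|t3] := leP (1 - t) kappa; have [t4|t4] := leP (1 - t) (1 - kappa); try klra.
- have -> : t = kappa by klra.
  by field.
- have -> : t = 1 - kappa by klra.
  by field.
- by field.
Qed.

Lemma Phi_reflect z : 0 < z < 2 -> Phi (2 - z) = Phi z.
Proof.
move=> z02; rewrite !PhiE; [|klra|klra].
have [z1|z1|->] := ltgtP z 1.
- by rewrite ifF; [rewrite opprB addrC subrK|apply/negbTE; rewrite -ltNge; klra].
- by rewrite ifT//; klra.
- by rewrite ifT; [congr ramp; klra|klra].
Qed.

Lemma Phi_shift z : 0 < z < 1 -> Phi (z + 1) = - Phi z.
Proof.
move=> z01; rewrite !PhiE; [|klra|klra].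
rewrite ifF; last by apply/negbTE; rewrite -ltNge; klra.
by rewrite ifT; [rewrite -ramp_opp; congr ramp; klra|klra].
Qed.

Lemma Phi_top z : `|z - 1| < kappa -> Phi z = kappa.
Proof.
rewrite ltr_distl => /andP[z1 z1']; rewrite PhiE; last by apply/andP; split; klra.
have H t : 1 - kappa < t -> ramp t = kappa.
  by move=> t1; rewrite /ramp !ifF//; apply/negbTE; rewrite -ltNge; klra.
by apply: H; case: ifP => _; klra.
Qed.

Lemma near_itv (a b z : R) : a < z < b -> \forall s \near z, a < s < b.
Proof.
move=> /andP[az zb]; near=> s; apply/andP; split; near: s.
  exact: lt_nbhsr.
exact: lt_nbhsl.
Unshelve. all: by end_near. Qed.

Definition dPhi z := Phi^`()%classic z.

Lemma dPhi_reflect z : 0 < z < 2 -> dPhi (2 - z) = - dPhi z.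
Proof.
move=> z02.
have E : dPhi z = (fun s => 1 * Phi (-1 * s + 2))^`()%classic z.
  apply: near_eq_derive1; apply: filterS (near_itv z02) => s s02.
  by rewrite mul1r mulN1r addrC Phi_reflect.
rewrite E derive1_pm; [|klra|klra].
by rewrite /dPhi mulN1r addrC; klra.
Qed.

Lemma dPhi_shift z : 0 < z < 1 -> dPhi (z + 1) = - dPhi z.
Proof.
move=> z02.
have E : dPhi z = (fun s => (-1) * Phi (1 * s + 1))^`()%classic z.
  apply: near_eq_derive1; apply: filterS (near_itv z02) => s s02.
  by rewrite mul1r mulN1r Phi_shift// opprK.
rewrite E derive1_pm; [|klra|klra].
by rewrite /dPhi mul1r; klra.
Qed.

Lemma dPhi_top z : `|z - 1| < kappa -> dPhi z = 0.
Proof.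
move=> z1; rewrite /dPhi (near_eq_derive1 (g := cst kappa)); first by rewrite derive1_cst.
have z1' : 1 - kappa < z < 1 + kappa by move: z1; rewrite ltr_distlC; klra.
apply: filterS (near_itv z1') => s s1; rewrite Phi_top// ltr_distlC; klra.
Qed.

Lemma derive1_sign e z : e * e = 1 -> (fun s => e * Phi s)^`()%classic z = e * dPhi z.
Proof.
move=> e1; have := derive1_pm Phi 0 z e1 (mulr1 1).
rewrite mulr1 mul1r addr0 => <-; congr (_^`()%classic z).
by apply/funext => s; rewrite mul1r addr0.
Qed.

(** [tilt] and [rise] are the sine and the cosine of the angle of inclination of the curve: up to
    sign, the horizontal and vertical components of its unit normal. *)
Definition tilt z := dPhi z / Num.sqrt (1 + dPhi z ^+ 2).
Definition rise z := (Num.sqrt (1 + dPhi z ^+ 2))^-1.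

Lemma tilt_reflect z : 0 < z < 2 -> tilt (2 - z) = - tilt z.
Proof. by move=> z02; rewrite /tilt dPhi_reflect// sqrrN mulNr. Qed.

Lemma rise_reflect z : 0 < z < 2 -> rise (2 - z) = rise z.
Proof. by move=> z02; rewrite /rise dPhi_reflect// sqrrN. Qed.

Lemma tilt_shift z : 0 < z < 1 -> tilt (z + 1) = - tilt z.
Proof. by move=> z02; rewrite /tilt dPhi_shift// sqrrN mulNr. Qed.

Lemma rise_shift z : 0 < z < 1 -> rise (z + 1) = rise z.
Proof. by move=> z02; rewrite /rise dPhi_shift// sqrrN. Qed.

Lemma tilt_top z : `|z - 1| < kappa -> tilt z = 0.
Proof. by move=> z1; rewrite /tilt dPhi_top// mul0r. Qed.

Lemma rise_top z : `|z - 1| < kappa -> rise z = 1.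
Proof. by move=> z1; rewrite /rise dPhi_top// expr0n addr0 sqrtr1 invr1. Qed.

Lemma signr_sq n : (-1) ^+ n * (-1) ^+ n = 1 :> R.
Proof. by rewrite -expr2 sqrr_sign. Qed.

Lemma chart1E q a b c : chart1 kappa q (a, b, c) =
  (a - c * ((-1) ^+ q.+1 * tilt a), q%:R + b, (-1) ^+ q.+1 * Phi a + c * rise a).
Proof.
rewrite /chart1 /M1 /n1 /unit_normal derive1_sign ?signr_sq// exprMn sqrr_sign mul1r.
rewrite /coord3/= /tilt /rise.
by congr (_, _, _); rewrite /= /GRing.scale /=; ring.
Qed.

Lemma chart2E p a b c : chart2 kappa p (a, b, c) =
  (p%:R + a, b - c * ((-1) ^+ p * tilt b), (-1) ^+ p * Phi b + c * rise b).
Proof.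
rewrite /chart2 /M2 /n2 /unit_normal derive1_sign ?signr_sq// exprMn sqrr_sign mul1r.
rewrite /coord3/= /tilt /rise.
by congr (_, _, _); rewrite /= /GRing.scale /=; ring.
Qed.

Hypothesis hd : charts_diffeo kappa.

(** On the centre line of a yarn the chart is r -> (r, 0, - Phi r), so its upper Lipschitz constant
    bounds the slope. *)
Lemma dPhi_bounded : exists B, 0 <= B /\ forall z, 0 < z < 2 -> `|dPhi z| <= B.
Proof.
have [[c [C [c0 cC]]] _] := hd 0.
have L s t : 0 < s < 2 -> 0 < t < 2 -> `|Phi s - Phi t| <= `|C| * `|s - t|.
  move=> s02 t02.
  have box r : 0 < r < 2 -> box1 kappa (r, 0, 0) by split; rewrite /coord3 //= normr0.
  have /andP[_] := cC _ _ (box _ s02) (box _ t02).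
  have E r : chart1 kappa 0 (r, 0, 0) = (r, 0, - Phi r).
    by rewrite chart1E; congr (_, _, _); rewrite ?mul0r ?subr0 ?addr0// expr1 mulN1r.
  rewrite !E.
  have n2 (x : R3 R) : `|x.2| <= `|x| by rewrite [X in _ <= X]prod_normE le_max lexx orbT.
  move=> H; have := le_trans (n2 _) H; rewrite /=.
  have -> : `|(s, 0, 0) - (t, 0, 0) : R3 R| = `|s - t|.
    rewrite prod_normE /= prod_normE /= !subrr normr0.
    by rewrite (max_idPl _) ?normr_ge0// (max_idPl _).
  rewrite opprK addrC distrC => {}H; apply: (le_trans H); rewrite ler_wpM2r//; exact: ler_norm.
exists `|C|; split => // z z02.
(* Within this distance of z all points remain in (0, 2), where the Lipschitz bound holds. *)
apply: (@derive1_lipschitz _ _ _ _ (Num.min z (2 - z))) => //; first by rewrite lt_min; klra.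
by move=> s; rewrite lt_min !ltr_norml => sz; apply: L => //; klra.
Qed.

(** The function x / sqrt (1 + x^2) is increasing and below 1, so a bound on the slope keeps the
    sine away from 1. *)
Lemma tilt_bounded : exists m, 0 <= m < 1 /\ forall z, 0 < z < 2 -> `|tilt z| <= m.
Proof.
have [B [B0 dB]] := dPhi_bounded.
have sq0 x : 0 < Num.sqrt (1 + x ^+ 2) :> R by rewrite sqrtr_gt0; have := sqr_ge0 x; klra.
exists (B / Num.sqrt (1 + B ^+ 2)); split.
  rewrite divr_ge0//= ?sqrtr_ge0//.
  rewrite ltr_pdivrMr// mul1r -{1}(ger0_norm B0) -sqrtr_sqr ltr_sqrt//; last by have := sqr_ge0 B; klra.
  klra.
move=> z z02; have := dB z z02; set x := dPhi z => xB.
rewrite /tilt -/x normrM normfV (gtr0_norm (sq0 _)).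
rewrite ler_pdivrMr// mulrAC ler_pdivlMr//.
have x2 : `|x| ^+ 2 <= B ^+ 2 by rewrite lerXn2r// nnegrE.
rewrite -(@ler_pXn2r _ 2)// ?nnegrE ?mulr_ge0 ?sqrtr_ge0//.
rewrite !exprMn !sqr_sqrtr ?addr_ge0 ?sqr_ge0// -(real_normK (num_real x)).
klra.
Qed.

Definition swap3 (y : R3 R) : R3 R := (y.1.2, y.1.1, - y.2).

Lemma swap3K : involutive swap3.
Proof. by move=> [[x y] z]; rewrite /swap3/= opprK. Qed.

Lemma yarnP q y : yarn1 kappa q y <-> exists a b c,
  [/\ 0 < a < 2, `|b| < kappa, `|c| < kappa &
  y = (a - c * ((-1) ^+ q.+1 * tilt a), q%:R + b, (-1) ^+ q.+1 * Phi a + c * rise a)].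
Proof.
split=> [[[[a b] c]] [a02 bk ck] <-|[a [b [c [a02 bk ck ->]]]]].
  by exists a, b, c; split=> //; rewrite chart1E.
by exists (a, b, c); [split|rewrite chart1E].
Qed.

(** Lets every statement about the second family be read off from one about the first. *)
Lemma yarn2E p : yarn2 kappa p = [set y | yarn1 kappa p (swap3 y)].
Proof.
apply/seteqP; split=> [_ [[[a b] c] [a02 bk ck] <-]|y] /=.
  apply/yarnP; exists b, a, (- c); split=> //; first by rewrite normrN.
  by rewrite chart2E /swap3 /= exprS; congr (_, _, _); ring.
move=> /yarnP[b [a [c [a02 bk ck E]]]]; exists (a, b, - c).
  by split=> //; rewrite /coord3/= normrN.
rewrite chart2E -(swap3K y) E /swap3 /= exprS; congr (_, _, _); ring.
Qed.

(* The yarns are straight near their crossings, and their inclination is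
   bounded away from the vertical. *)
Lemma yarn_parameter : exists delta, 0 < delta <= kappa /\ forall a c e,
  0 < a < 2 -> `|c| < kappa -> e * e = 1 ->
  let y := a - c * (e * tilt a) in
  [/\ `|y - 1| < delta -> `|a - 1| < kappa /\ y = a,
      y < 1 -> a < 1 & 1 < y -> 1 < a].
Proof.
have [m [/andP[m0 m1] tm]] := tilt_bounded.
(* The point of parameter a is displaced horizontally by at most kappa * m. If it lands closer than
   kappa * (1 - m) to 1, then a lies on the plateau |a - 1| < kappa, where the displacement is zero.
   Off the plateau, a displacement below kappa cannot cross 1. *)
exists (kappa * (1 - m)); split; first by apply/andP; split; knra.
move=> a c e a02 ck e1 y.
have en : `|e| = 1.
  have : `|e| * `|e| = 1 by rewrite -normrM e1 normr1.
  have := normr_ge0 e; knra.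
have ym : `|y - a| <= kappa * m.
  rewrite /y addrAC subrr add0r normrN normrM (normrM e) en mul1r.
  by apply: ler_pM => //; [exact: ltW|exact: tm].
have top : `|a - 1| < kappa -> y = a by move=> ak; rewrite /y tilt_top// !mulr0 subr0.
have [ak|ak] := ltP `|a - 1| kappa.
  by rewrite top.
move: ym; rewrite ler_norml => /andP[ym1 ym2].
have [a1|a1] := leP a 1.
  have {}ak : a <= 1 - kappa by move: ak; rewrite ler0_norm; klra.
  split => //; first by rewrite ltr_norml => /andP[]; knra.
  - by move=> _; klra.
  - by knra.
have {}ak : 1 + kappa <= a by move: ak; rewrite ger0_norm; klra.
split => //; first by rewrite ltr_norml => /andP[]; knra.
by knra.
Qed.

Lemma yarn_reflect1 (q : 'I_3) y : yarn1 kappa q y -> yarn1 kappa q (2 - y.1.1, y.1.2, y.2).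
Proof.
move=> /yarnP[a [b [c [a02 bk ck ->]]]]; apply/yarnP; exists (2 - a), b, c.
split; [by klra|exact: bk|exact: ck|].
by rewrite (tilt_reflect a02) (rise_reflect a02) (Phi_reflect a02) /=; congr (_, _, _); ring.
Qed.

(** Read after the exchange of the families, this is the effect of y1 -> 2 - y1 on the second
    family: p becomes 2 - p, which has the same parity and hence the same sign. *)
Lemma yarn_reflect2 (q : 'I_3) y : yarn1 kappa q y -> yarn1 kappa (rev_ord q) (y.1.1, 2 - y.1.2, y.2).
Proof.
move=> /yarnP[a [b [c [a02 bk ck ->]]]]; apply/yarnP; exists a, (- b), c.
split=> //; first by rewrite normrN.
have [E1 E2] : (rev_ord q)%:R = 2 - q%:R :> R /\ (-1) ^+ (rev_ord q) = (-1) ^+ q :> R.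
  by case: q => [[|[|[|//]]] hq] /=; rewrite !subSS ?subn0 ?expr0 ?sqrrN ?expr1n; split=> //; lra.
by rewrite /= !exprS E1 E2; congr (_, _, _); ring.
Qed.

(** Half a period along the yarn changes the sign of [Phi] and of its slope, and reversing y3
    compensates. By [yarn_parameter] the parameter lies in the first half period when y1 does. *)
Lemma yarn_shift1 (q : 'I_3) y : yarn1 kappa q y -> 0 < y.1.1 < 1 ->
  yarn1 kappa q (y.1.1 + 1, y.1.2, - y.2).
Proof.
have [delta [_ h]] := yarn_parameter.
move=> /yarnP[a [b [c [a02 bk ck ->]]]] /= y1; apply/yarnP; exists (a + 1), b, (- c).
have [_ /(_ ltac:(klra)) a1 _] := h a c ((-1) ^+ q.+1) a02 ck (signr_sq _).
have a01 : 0 < a < 1 by klra.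
split=> //; [by klra|by rewrite normrN|].
by rewrite tilt_shift// rise_shift// Phi_shift//=; congr (_, _, _); ring.
Qed.

Lemma yarn_unshift1 (q : 'I_3) y : yarn1 kappa q y -> 1 < y.1.1 < 2 ->
  yarn1 kappa q (y.1.1 - 1, y.1.2, - y.2).
Proof.
have [delta [_ h]] := yarn_parameter.
move=> /yarnP[a [b [c [a02 bk ck ->]]]] /= y1; apply/yarnP; exists (a - 1), b, (- c).
have [_ _ /(_ ltac:(klra)) a1] := h a c ((-1) ^+ q.+1) a02 ck (signr_sq _).
have a01 : 0 < a - 1 < 1 by klra.
split=> //; [by klra|by rewrite normrN|].
have := tilt_shift a01; have := rise_shift a01; have := Phi_shift a01; rewrite subrK.
by move=> -> -> ->; congr (_, _, _); rewrite /=; ring.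
Qed.

(** Across the yarns the shift leads from yarn q to yarn q + 1, which has the opposite sign. The
    last yarn does not occur: it stays within kappa < 1/2 of y2 = 2. *)
Lemma yarn_shift2 (q : 'I_3) y : yarn1 kappa q y -> 0 < y.1.2 < 1 ->
  exists q' : 'I_3, yarn1 kappa q' (y.1.1, y.1.2 + 1, - y.2).
Proof.
move=> /yarnP[a [b [c [a02 bk ck ->]]]] /= y1.
have [q' E] : exists q' : 'I_3, q' = q.+1 :> nat.
  move: y1 bk; case: q => [[|[|[|//]]] hq] /= y1; rewrite ltr_norml => bk.
  - by exists (@Ordinal 3 1 isT).
  - by exists (@Ordinal 3 2 isT).
  - by exfalso; klra.
exists q'; apply/yarnP; exists a, b, (- c); split=> //; first by rewrite normrN.
by rewrite E [in RHS]exprS -natr1; congr (_, _, _); ring.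
Qed.

Lemma yarn_unshift2 (q : 'I_3) y : yarn1 kappa q y -> 1 < y.1.2 < 2 ->
  exists q' : 'I_3, yarn1 kappa q' (y.1.1, y.1.2 - 1, - y.2).
Proof.
move=> /yarnP[a [b [c [a02 bk ck ->]]]] /= y1.
have [q' E] : exists q' : 'I_3, q = q'.+1 :> nat.
  move: y1 bk; case: q => [[|[|[|//]]] hq] /= y1; rewrite ltr_norml => bk.
  - by exfalso; klra.
  - by exists (@Ordinal 3 0 isT).
  - by exists (@Ordinal 3 1 isT).
exists q'; apply/yarnP; exists a, b, (- c); split=> //; first by rewrite normrN.
by rewrite E [in LHS]exprS -[q'.+1%:R]natr1; congr (_, _, _); ring.
Qed.

(** Along a yarn, y1 near 1 means the plateau. Across it, only the middle yarn q = 1 meets y2 near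
    1, and t stays within its width; after the exchange of the families this second clause treats
    the second family. *)
Lemma yarn_straight : exists delta, 0 < delta <= kappa /\ forall (q : 'I_3) y t, yarn1 kappa q y ->
  `|t - 1| < delta ->
  (`|y.1.1 - 1| < delta -> yarn1 kappa q (t, y.1.2, y.2)) /\
  (`|y.1.2 - 1| < delta -> yarn1 kappa q (y.1.1, t, y.2)).
Proof.
have [delta [dk h]] := yarn_parameter; exists delta; split=> // q y t.
move=> /yarnP[a [b [c [a02 bk ck ->]]]] /= td; split=> yd.
  have [/(_ yd)[ak E] _ _] := h a c ((-1) ^+ q.+1) a02 ck (signr_sq _).
  have tk : `|t - 1| < kappa by apply: lt_le_trans td _; case/andP: dk.
  apply/yarnP; exists t, b, c; split; [by move: tk; rewrite ltr_norml; klra|exact: bk|exact: ck|].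
  by rewrite (tilt_top tk) (rise_top ak) (rise_top tk) (Phi_top ak) (Phi_top tk) !mulr0 subr0.
apply/yarnP; exists a, (t - q%:R), c; split=> //; last by congr (_, _, _); ring.
by move: yd td bk; case: q => [[|[|[|//]]] hq] /=; rewrite !ltr_norml => ? ? ?; klra.
Qed.

End PhiSymmetries.

(** * Symmetries of the cell *)

Section Moves.
Context {R : realType}.
Lemma closure_move (T : topologicalType) (A : T -> T) (X U : set T) :
  continuous A -> (forall y, U y -> nbhs y U) -> (forall y, X y -> U y -> X (A y)) ->
  forall y, closure X y -> U y -> closure X (A y).
Proof.
move=> cA oU XU y cX Uy B nB.
have nAB : nbhs y (A @^-1` B) by exact: cA.
have [z [Xz [/= Bz Uz]]] := cX _ (filterI nAB (oU y Uy)).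
by exists (A z); split => //; exact: XU.
Qed.

(** The cell is cut out by the interior of a closure, so a map of the yarns has to be carried
    through both operations. The shifts respect the yarns on a part of the space only, hence the
    open set U. *)
Lemma interior_closure_move (T : topologicalType) (A A' : T -> T) (X U : set T) :
  continuous A -> continuous A' -> cancel A A' -> cancel A' A ->
  (forall y, U y -> nbhs y U) -> (forall y, X y -> U y -> X (A y)) ->
  forall y, (closure X)° y -> U y -> (closure X)° (A y).
Proof.
move=> cA cA' AK A'K oU XU y iX Uy.
have n1 : nbhs (A' (A y)) (closure X `&` U) by rewrite AK; apply: filterI => //; exact: oU.
have n2 : nbhs (A y) (A' @^-1` (closure X `&` U)) by exact: cA'.
rewrite /interior; apply: filterS n2 => z [cXz Uz].
by rewrite -(A'K z); apply: closure_move Uz.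
Qed.

Implicit Types y : R3 R.

Lemma near_continuous (S T : topologicalType) (A : S -> T) (s : S) (P : T -> Prop) :
  continuous A -> (\forall z \near A s, P z) -> \forall z \near s, P (A z).
Proof. by move=> cA; exact: cA. Qed.

Definition diag3 (e c y : R3 R) : R3 R :=
  (e.1.1 * y.1.1 + c.1.1, e.1.2 * y.1.2 + c.1.2, e.2 * y.2 + c.2).

Lemma continuous_affine_coord i (a b : R) : continuous (fun y : R3 R => a * coord3 i y + b).
Proof.
move=> y; apply: cvgD; last exact: cvg_cst.
by apply: cvgM; [exact: cvg_cst|exact: continuous_coord3].
Qed.

Lemma continuous_diag3 e c : continuous (diag3 e c).
Proof.
apply: continuous_R3.
- exact: (@continuous_affine_coord 0).
- exact: (@continuous_affine_coord 1).
- exact: (@continuous_affine_coord 2).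
Qed.

Lemma monomial_diag3 e c : monomial_affine (diag3 e c) id (fun i => coord3 i e).
Proof.
split; first exact: continuous_diag3.
move=> i h y; rewrite /diag3; elim/I3P: i; congr (_, _, _);
  rewrite /= /coord3 /= /GRing.scale /=; ring.
Qed.

Definition reflect1 y : R3 R := (2 - y.1.1, y.1.2, y.2).
Definition shift1 (s : R) y : R3 R := (y.1.1 + s, y.1.2, - y.2).
Definition trans1 (s : R) y : R3 R := (y.1.1 + s, y.1.2, y.2).

Lemma reflect1E : reflect1 = diag3 (-1, 1, 1) (2, 0, 0).
Proof. by apply/funext => y; congr (_, _, _); rewrite /=; ring. Qed.

Lemma shift1E s : shift1 s = diag3 (1, 1, -1) (s, 0, 0).
Proof. by apply/funext => y; congr (_, _, _); rewrite /=; ring. Qed.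

Lemma trans1E s : trans1 s = diag3 (1, 1, 1) (s, 0, 0).
Proof. by apply/funext => y; congr (_, _, _); rewrite /=; ring. Qed.

Lemma continuous_reflect1 : continuous reflect1.
Proof. by rewrite reflect1E; exact: continuous_diag3. Qed.

Lemma continuous_shift1 s : continuous (shift1 s).
Proof. by rewrite shift1E; exact: continuous_diag3. Qed.

Lemma continuous_trans1 s : continuous (trans1 s).
Proof. by rewrite trans1E; exact: continuous_diag3. Qed.

Lemma reflect1K : involutive reflect1.
Proof. by move=> [[a b] c]; congr (_, _, _); rewrite /=; ring. Qed.

Lemma shift1K s t : s + t = 0 -> cancel (shift1 s) (shift1 t).
Proof. by move=> st [[a b] c]; congr (_, _, _); rewrite /= ?opprK -?addrA ?st ?addr0. Qed.

Lemma trans1K s t : s + t = 0 -> cancel (trans1 s) (trans1 t).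
Proof. by move=> st [[a b] c]; congr (_, _, _); rewrite /= ?opprK -?addrA ?st ?addr0. Qed.

Lemma continuous_swap3 : continuous (@swap3 R).
Proof.
apply: continuous_R3; first exact: (@continuous_coord3 _ 1).
  exact: (@continuous_coord3 _ 0).
by move=> y; apply: cvgN; exact: (@continuous_coord3 _ 2).
Qed.

Lemma near_coord3 i a b y : a < coord3 i y < b -> \forall z \near y, a < coord3 i z < b.
Proof. by move=> h; exact: (near_continuous (@continuous_coord3 _ i) (near_itv h)). Qed.

Lemma near_lt_coord3 i a y : a < coord3 i y -> \forall z \near y, a < coord3 i z.
Proof.
move=> h; have h' : a < coord3 i y < coord3 i y + 1 by rewrite h/=; lra.
by apply: filterS (near_coord3 h') => z /andP[].
Qed.

Lemma near_coord3_lt i a y : coord3 i y < a -> \forall z \near y, coord3 i z < a.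
Proof.
move=> h; have h' : coord3 i y - 1 < coord3 i y < a by rewrite h andbT; lra.
by apply: filterS (near_coord3 h') => z /andP[].
Qed.

End Moves.

Section Cell.
Context {R : realType} (kappa : R).
Hypotheses (k0 : 0 < kappa) (k1 : kappa * 2 < 1) (hd : charts_diffeo kappa).
Local Ltac klra := have ? := k0; have ? := k1; blra.
Local Notation D := (textile_cell kappa).
Implicit Types y : R3 R.

Definition yarns : set (R3 R) := (\bigcup_q yarn1 kappa q) `|` (\bigcup_p yarn2 kappa p).

Lemma bigcup_closure3 (F : 'I_3 -> set (R3 R)) :
  \bigcup_q closure (F q) = closure (\bigcup_q F q).
Proof.
have E (G : 'I_3 -> set (R3 R)) : \bigcup_q G q = G 0 `|` G 1 `|` G 2.
  apply/seteqP; split=> y; last by move=> [[]|] ?; [exists 0|exists 1|exists 2].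
  by move=> [q _]; elim/I3P: q => h; [left; left|left; right|right].
by rewrite !E !closureU.
Qed.

Lemma cellE : D = full_cell kappa `&` (closure yarns)°.
Proof.
rewrite /textile_cell /yarns.
congr (_ `&` interior _).
rewrite closureU.
congr (_ `|` _).
exact: (bigcup_closure3 (yarn1 kappa)).
exact: (bigcup_closure3 (yarn2 kappa)).
Qed.

Lemma cell_bounds y : D y -> [/\ 0 < y.1.1 < 2, 0 < y.1.2 < 2 & - (2 * kappa) < y.2 < 2 * kappa].
Proof. by move=> [[]]. Qed.

Lemma full_cell_near y : full_cell kappa y -> nbhs y (full_cell kappa).
Proof.
move=> [h1 h2 h3].
apply: filterS3 (near_coord3 h1) (near_coord3 h2) (near_coord3 h3) => z ? ? ?.
by split.
Qed.

Lemma cell_nbhs y : D y -> nbhs y D.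
Proof.
rewrite cellE => -[h iX]; apply: filterI; first exact: full_cell_near.
exact: nbhs_interior.
Qed.

Lemma cell_open : open D.
Proof. by rewrite openE => y /cell_nbhs. Qed.

Lemma yarns_move (A : R3 R -> R3 R) (U : set (R3 R)) y :
  (forall q, yarn1 kappa q y -> U y -> exists q', yarn1 kappa q' (A y)) ->
  (forall q, yarn1 kappa q (swap3 y) -> U y -> exists q', yarn1 kappa q' (swap3 (A y))) ->
  yarns y -> U y -> yarns (A y).
Proof.
move=> h1 h2 [[q _ yq]|[p _ yp]] Uy.
  by have [q' ?] := h1 q yq Uy; left; exists q'.
rewrite yarn2E in yp; have [q' yq'] := h2 p yp Uy.
by right; exists q' => //; rewrite yarn2E.
Qed.

Lemma yarns_reflect y : yarns y -> yarns (reflect1 y).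
Proof.
move=> hy; apply: (@yarns_move reflect1 setT) hy I => q h _.
  by exists q; exact: yarn_reflect1.
by exists (rev_ord q); have := yarn_reflect2 h.
Qed.

Lemma yarns_swap y : yarns y -> yarns (swap3 y).
Proof.
move=> [[q _ yq]|[p _ yp]]; [right; exists q|left; exists p] => //.
  by rewrite yarn2E /= swap3K.
by rewrite yarn2E in yp.
Qed.

Lemma yarns_shift y : yarns y -> 0 < y.1.1 < 1 -> yarns (shift1 1 y).
Proof.
apply: (@yarns_move (shift1 1) [set y | 0 < y.1.1 < 1]) => q h /= y1.
  by exists q; exact: yarn_shift1.
by have := yarn_shift2 k0 k1 h y1.
Qed.

Lemma yarns_unshift y : yarns y -> 1 < y.1.1 < 2 -> yarns (shift1 (-1) y).
Proof.
apply: (@yarns_move (shift1 (-1)) [set y | 1 < y.1.1 < 2]) => q h /= y1.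
  by exists q; exact: yarn_unshift1.
by have := yarn_unshift2 k0 k1 h y1.
Qed.

Lemma cell_reflect y : D y -> D (reflect1 y).
Proof.
rewrite cellE => -[[h1 h2 h3] iX]; split.
  by split => //; move: h1; rewrite /coord3/= => h1; blra.
apply: (interior_closure_move (A' := reflect1) (U := setT)) => //; try exact: continuous_reflect1; try exact: reflect1K.
  by move=> z _; exact: filterT.
by move=> z hz _; exact: yarns_reflect.
Qed.

Lemma cell_swap y : D y -> D (swap3 y).
Proof.
rewrite cellE => -[[h1 h2 h3] iX]; split.
  by split => //; move: h3; rewrite /coord3/= => h3; blra.
apply: (interior_closure_move (A' := @swap3 R) (U := setT)) => //; try exact: continuous_swap3; try exact: swap3K.
  by move=> z _; exact: filterT.
by move=> z hz _; exact: yarns_swap.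
Qed.

Lemma cell_shift y : D y -> y.1.1 < 1 -> D (shift1 1 y).
Proof.
rewrite cellE => -[[h1 h2 h3] iX] y1; split.
  by split => //; [move: h1|move: h3]; rewrite /coord3/= => ?; blra.
apply: (interior_closure_move (A' := shift1 (-1)) (U := [set y | 0 < y.1.1 < 1])) => //; try exact: continuous_shift1.
- by apply: shift1K; rewrite subrr.
- by apply: shift1K; rewrite addNr.
- by move=> z; exact: (@near_coord3 _ 0).
- exact: yarns_shift.
- by rewrite /= y1 andbT; case/andP: h1.
Qed.

Lemma cell_unshift y : D y -> 1 < y.1.1 -> D (shift1 (-1) y).
Proof.
rewrite cellE => -[[h1 h2 h3] iX] y1; split.
  by split => //; [move: h1|move: h3]; rewrite /coord3/= => ?; blra.
apply: (interior_closure_move (A' := shift1 1) (U := [set y | 1 < y.1.1 < 2])) => //; try exact: continuous_shift1.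
- by apply: shift1K; rewrite addNr.
- by apply: shift1K; rewrite subrr.
- by move=> z; exact: (@near_coord3 _ 0).
- exact: yarns_unshift.
- by rewrite /= y1; case/andP: h1.
Qed.

Lemma cell_straight : exists delta, 0 < delta < 2^-1 /\ forall y t,
  D y -> `|y.1.1 - 1| < delta -> `|t - 1| < delta -> D (t, y.1.2, y.2).
Proof.
have [delta [/andP[d0 dk] h]] := yarn_straight k0 k1 hd.
exists delta; split; first by klra.
move=> y t; rewrite cellE => -[[h1 h2 h3] iX] yd td; split.
  split => //; rewrite /coord3/=; move: td; rewrite ltr_norml => td; klra.
set s := t - y.1.1.
have -> : (t, y.1.2, y.2) = trans1 s y by congr (_, _, _); rewrite /s; ring.
(* U collects the points in the straight region both before and after the translation by s; there
   the translation maps yarns to yarns. *)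
pose U := [set z : R3 R | 1 - delta < z.1.1 < 1 + delta /\ 1 - delta - s < z.1.1 < 1 + delta - s].
have UP z : U z <-> `|z.1.1 - 1| < delta /\ `|z.1.1 + s - 1| < delta.
  rewrite /U /= !ltr_norml; split=> -[/andP[? ?] /andP[? ?]]; split; apply/andP; split; lra.
apply: (interior_closure_move (A' := trans1 (- s)) (U := U)) => //; try exact: continuous_trans1.
- by apply: trans1K; rewrite subrr.
- by apply: trans1K; rewrite addNr.
- by move=> z [u1 u2]; apply: filterI; [exact: (@near_coord3 _ 0)|exact: (@near_coord3 _ 0)].
- move=> z; apply: (@yarns_move (trans1 s) U) => q hq /UP[z1 z2]; exists q.
    by have [/(_ z1)] := h q z _ hq z2.
  by have [_ /(_ z1)] := h q _ _ hq z2.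
- by apply/UP; split=> //; rewrite /s addrCA subrr addr0.
Qed.

Lemma lateral_face_open D' i side : open (@lateral_face R D' i side).
Proof.
rewrite openE => x hx; rewrite /interior.
have cf : continuous (@face_pt R i side).
  rewrite /face_pt; set c := if side then 2 else 0; case: (i == 0) => /=.
    apply: (@continuous_R3 _ _ (fun=> c) (fun x => x.1) (fun x => x.2)) => x'; [exact: cvg_cst|exact: cvg_fst|exact: cvg_snd].
  apply: (@continuous_R3 _ _ (fun x => x.1) (fun=> c) (fun x => x.2)) => x'; [exact: cvg_fst|exact: cvg_cst|exact: cvg_snd].
rewrite /lateral_face /= in hx.
exact: (near_continuous (P := fun w => \forall z \near w, 0 < coord3 (plane i) z < 2 -> D' z) cf (nbhs_interior hx)).
Qed.

(** Both faces are the wall y1 = 1 seen through the shift. A face is described by the cell on one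
    side of it, while the wall lies inside the cell; straightness brings a point found beside the
    wall onto the wall. *)
Lemma lateral_face0 side : lateral_face D 0 side = [set x | D (1, x.1, - x.2)].
Proof.
pose e : R := if side then 1 else -1.
have He : face_pt 0 side = fun x : R * R => (1 + e, x.1, x.2).
  apply/funext => x; rewrite /face_pt /= /e; case: (side); congr (_, _, _); lra.
have shE z : shift1 e (shift1 (- e) z) = z.
  by have := @shift1K R (- e) e (addNr e) z.
apply/seteqP; split => x.
  rewrite /lateral_face /= He => hx.
  have [delta [/andP[d0 d1] hD]] := cell_straight.
  have : \forall t \near (1 : R), D (t + e, x.1, x.2) \/ ~ (0 < t + e < 2).
    have ct : continuous (fun t : R => (t + e, x.1, x.2) : R3 R).
      apply: (@continuous_R3 R R (fun t => t + e) (fun=> x.1) (fun=> x.2)) => t; try exact: cvg_cst.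
      by apply: cvgD; [exact: cvg_id|exact: cvg_cst].
    have H := near_continuous (s := (1 : R)) (P := fun z => 0 < coord3 (plane 0) z < 2 -> D z) ct hx.
    apply: filterS H => t /= ht.
    by have [/ht|] := boolP (0 < t + e < 2); [left|move=> /negP; right].
  move=> /nbhs_ballP[r /= r0 hr].
  (* A step inwards from the face, small enough for the given neighbourhood and for the straight
     region. *)
  pose q := Num.min (r / 2) (delta / 2).
  have q0 : 0 < q by rewrite lt_min; apply/andP; split; lra.
  have qr : q <= r / 2 by rewrite ge_min lexx.
  have qd : q <= delta / 2 by rewrite ge_min lexx orbT.
  pose t : R := 1 - e * q.
  have e1 : e = 1 \/ e = -1 by rewrite /e; case: (side); [left|right].
  have rt : ball (1 : R) r t.
    by rewrite /ball /= /t ltr_norml; case: e1 => ->; apply/andP; split; lra.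
  have [h|[]] := hr _ rt; last by rewrite /t; case: e1 => ->; apply/andP; split; lra.
  have {}h : D (t, x.1, - x.2).
    rewrite /t /e in h *; case: (side) h => h.
      have -> : (1 - 1 * q, x.1, - x.2) = shift1 (-1) (1 - 1 * q + 1, x.1, x.2) by congr (_, _, _) => /=; lra.
      by apply: cell_unshift => //=; lra.
    have -> : (1 - -1 * q, x.1, - x.2) = shift1 1 (1 - -1 * q - 1, x.1, x.2) by congr (_, _, _) => /=; lra.
    by apply: cell_shift => //=; lra.
  apply: (hD _ 1 h); rewrite /= ?subrr ?normr0//.
  by rewrite /t addrAC subrr add0r normrN ltr_norml; case: e1 => ->; apply/andP; split; lra.
rewrite /= => h; rewrite /lateral_face /= He.
have E : shift1 (- e) (1 + e, x.1, x.2) = (1, x.1, - x.2) by congr (_, _, _); rewrite /=; ring.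
have n1 : \forall z \near (1 + e, x.1, x.2), D (shift1 (- e) z).
  by apply: (near_continuous (A := shift1 (- e)) (P := D)); [exact: continuous_shift1|rewrite E; exact: cell_nbhs].
apply: filterS n1 => z hz z1; rewrite -(shE z).
rewrite /coord3 /= in z1; rewrite /e in hz *; case: (side) hz => hz.
  by apply: cell_shift => //=; blra.
by rewrite opprK in hz *; apply: cell_unshift => //=; blra.
Qed.

Lemma lateral_face_shift side (x : R * R) : lateral_face D 1 side x -> x.1 < 1 ->
  lateral_face D 1 side (x.1 + 1, - x.2).
Proof.
rewrite /lateral_face /face_pt /= => hx x1; set c : R := if side then 2 else 0 in hx *.
have E : shift1 (-1) (x.1 + 1, c, - x.2) = (x.1, c, x.2) by congr (_, _, _); rewrite /=; ring.
have n1 : \forall z \near (x.1 + 1, c, - x.2),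
    (0 < coord3 1 (shift1 (-1) z) < 2 -> D (shift1 (-1) z)).
  by apply: (near_continuous (A := shift1 (-1)) (P := fun w => 0 < coord3 1 w < 2 -> D w)); [exact: continuous_shift1|rewrite E].
have n2 : \forall z \near (x.1 + 1, c, - x.2), coord3 0 z < 2.
  by apply: near_coord3_lt; rewrite /coord3/=; lra.
apply: filterS2 n1 n2 => z h1 h2 h3.
have <- : shift1 1 (shift1 (-1) z) = z by apply: shift1K; rewrite addNr.
apply: cell_shift; first exact: h1.
by move: h2; rewrite /coord3/=; lra.
Qed.

Lemma lateral_face_unshift side (x : R * R) : lateral_face D 1 side x -> 1 < x.1 ->
  lateral_face D 1 side (x.1 - 1, - x.2).
Proof.
rewrite /lateral_face /face_pt /= => hx x1; set c : R := if side then 2 else 0 in hx *.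
have E : shift1 1 (x.1 - 1, c, - x.2) = (x.1, c, x.2) by congr (_, _, _); rewrite /=; ring.
have n1 : \forall z \near (x.1 - 1, c, - x.2),
    (0 < coord3 1 (shift1 1 z) < 2 -> D (shift1 1 z)).
  by apply: (near_continuous (A := shift1 1) (P := fun w => 0 < coord3 1 w < 2 -> D w)); [exact: continuous_shift1|rewrite E].
have n2 : \forall z \near (x.1 - 1, c, - x.2), 0 < coord3 0 z.
  by apply: near_lt_coord3; rewrite /coord3/=; lra.
apply: filterS2 n1 n2 => z h1 h2 h3.
have <- : shift1 (-1) (shift1 1 z) = z by apply: shift1K; rewrite subrr.
apply: cell_unshift; first exact: h1.
by move: h2; rewrite /coord3/=; lra.
Qed.

Lemma cell_finite : (leb3 D < +oo)%E.
Proof.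
pose I : set (measurableTypeR R) := `[0, 2]%classic.
pose J : set (measurableTypeR R) := `[-1, 1]%classic.
have [mI mJ] : measurable I /\ measurable J by split; exact: measurable_itv.
have mII : measurable (I `*` I) by exact: measurableX.
have : (leb3 (I `*` I `*` J) < +oo)%E.
  have -> : leb3 (I `*` I `*` J) = (leb2 (I `*` I) * lebesgue_measure J)%E by exact: product_measure1E.
  have -> : leb2 (I `*` I) = (lebesgue_measure I * lebesgue_measure I)%E by exact: product_measure1E.
  rewrite !lebesgue_measure_itv/= !lte_fin.
  by rewrite !ifT ?ltry//; lra.
apply: le_lt_trans; apply: le_measure; rewrite ?inE.
- exact: open_measurable3 cell_open.
- exact: measurableX.
- by move=> y /cell_bounds[h1 h2 h3]; split; first split; rewrite /I /J /= in_itv /=; klra.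
Qed.

End Cell.

(** * Pulling back periodic functions *)

Section PullBack.
Context {R : realType} (D : set (R3 R)).
Hypotheses (oD : open D) (Doo : (leb3 D < +oo)%E).
Implicit Types (u : H1 D) (phi : R3 R -> R).
Let mD : measurable (D : set (measurableTypeR R * measurableTypeR R * measurableTypeR R)) := open_measurable3 oD.

Lemma L2_continuous phi M : continuous phi -> (forall y, `|phi y| <= M) -> L2 leb3 D phi.
Proof.
move=> cphi phiM; apply: (@L2_bounded _ _ _ _ _ mD _ M) => //.
exact: continuous_measurable3.
Qed.

Lemma L2_test_integrable f phi M : L2 leb3 D f -> continuous phi -> (forall y, `|phi y| <= M) ->
  leb3.-integrable D (EFin \o (fun y => f y * phi y)).
Proof. by move=> Lf cphi phiM; apply: L2M_integrable => //; exact: L2_continuous phiM. Qed.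

Lemma smooth_test_bounded phi (K : set (R3 R)) : smooth phi -> compact K -> supported_in K phi ->
  exists M, forall i y, `|phi y| <= M /\ `|partial i phi y| <= M.
Proof.
move=> sphi cK sK.
have [M [M0 phiM]] := supported_bounded cK (smooth_continuous sphi) sK.
have B i := supported_bounded cK (smooth_continuous (smooth_partial i sphi)) (supported_partial i cK sK).
have [M0' [M00 h0]] := B 0; have [M1' [M10 h1]] := B 1; have [M2' [M20 h2]] := B 2.
exists (M + M0' + M1' + M2') => i y; split; first by have := phiM y; lra.
elim/I3P: i.
- by apply: le_trans (h0 y) _; lra.
- by apply: le_trans (h1 y) _; lra.
- by apply: le_trans (h2 y) _; lra.
Qed.

(** The integrand of the Gauss-Green formula, formally the i-th derivative of u * phi. Keeping the
    two terms together lets weak derivatives and traces be treated by the same identities. *)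
Definition green_density u (i : 'I_3) phi y := u y * partial i phi y + H1grad u i y * phi y.

Lemma green_integrable u i phi (K : set (R3 R)) : smooth phi -> compact K -> supported_in K phi ->
  leb3.-integrable D (EFin \o green_density u i phi).
Proof.
move=> sphi cK sK; have [M hM] := smooth_test_bounded sphi cK sK.
apply: (integrableRD mD).
  apply: (L2_test_integrable (H1fun_L2 u) (M := M)) => [|y]; last by have [] := hM i y.
  exact: smooth_continuous (smooth_partial _ sphi).
apply: (L2_test_integrable (H1grad_L2 u i) (M := M)) => [|y]; last by have [] := hM i y.
exact: smooth_continuous.
Qed.

Lemma weak_partial_green (f : R3 R -> R) (g : R3 R -> R) i :
  L2 leb3 D f -> L2 leb3 D g ->
  (forall phi K, smooth phi -> compact K -> K `<=` D -> supported_in K phi ->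
    \int[leb3]_(y in D) (f y * partial i phi y + g y * phi y) = 0) ->
  weak_partial D i f g.
Proof.
move=> Lf Lg h phi [sphi [K [cK KD sK]]].
have [M hM] := smooth_test_bounded sphi cK sK.
have := h phi K sphi cK KD sK; rewrite RintegralD//; first lra.
  apply: (L2_test_integrable Lf (M := M)) => [|y]; last by have [] := hM i y.
  exact: smooth_continuous (smooth_partial _ sphi).
apply: (L2_test_integrable Lg (M := M)) => [|y]; last by have [] := hM i y.
exact: smooth_continuous.
Qed.

Lemma green_test u i phi (K : set (R3 R)) : smooth phi -> compact K -> K `<=` D -> supported_in K phi ->
  \int[leb3]_(y in D) green_density u i phi y = 0.
Proof.
move=> sphi cK KD sK; have [M hM] := smooth_test_bounded sphi cK sK.
rewrite RintegralD//.
- rewrite (H1gradP u i) ?addNr//; split => //; by exists K.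
- apply: (L2_test_integrable (H1fun_L2 u) (M := M)) => [|y]; last by have [] := hM i y.
  exact: smooth_continuous (smooth_partial _ sphi).
- apply: (L2_test_integrable (H1grad_L2 u i) (M := M)) => [|y]; last by have [] := hM i y.
  exact: smooth_continuous.
Qed.

Section Symmetry.
Variables (T : R3 R -> R3 R) (pi : 'I_3 -> 'I_3) (eps : 'I_3 -> R).
Hypothesis symT : cell_symmetry D T pi eps.

Lemma symmetry_Rintegral (h : R3 R -> R) : measurable_fun D h ->
  \int[leb3]_(y in D) h (T y) = \int[leb3]_(y in D) h y.
Proof.
move=> mh; have [pT TD _ _ _] := symT.
by rewrite -{1}TD; exact: (preserves_Rintegral pT mD mh).
Qed.

Lemma pull_back_H1 c u :
  (forall i, weak_partial D i (fun y => c * u (T y)) (fun y => c * (eps i * H1grad u (pi i) (T y)))) ->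
  exists v : H1 D, H1fun v = (fun y => c * u (T y)) /\
    forall i, H1grad v i = fun y => c * (eps i * H1grad u (pi i) (T y)).
Proof.
move=> hw.
have Lu : L2 leb3 D (fun y => c * u (T y)).
  exact: (L2Z mD c (L2_comp_symmetry mD symT (H1fun_L2 u))).
have Lg i : L2 leb3 D (fun y => c * (eps i * H1grad u (pi i) (T y))).
  exact: (L2Z mD c (L2Z mD (eps i) (L2_comp_symmetry mD symT (H1grad_L2 u (pi i))))).
by exists (MkH1 Lu Lg hw).
Qed.

Lemma pull_back_mean c u : \int[leb3]_(y in D) u y = 0 ->
  \int[leb3]_(y in D) (c * u (T y)) = 0.
Proof.
have mu := (H1fun_L2 u).1.
move=> u0; rewrite (symmetry_Rintegral (h := fun y => c * u y)).
  rewrite RintegralZl ?u0 ?mulr0//.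
  have := L2M_integrable mD (H1fun_L2 u) (@L2_continuous (cst 1) 1 _ _).
  move=> /(_ (fun _ => cvg_cst _)) h; apply: eq_integrable (h _) => //.
    by move=> y _ /=; rewrite mulr1.
  by move=> y; rewrite /= normr1.
by apply: measurable_funM => //; exact: measurable_cst.
Qed.

Hypothesis affT : monomial_affine T pi eps.

Lemma symmetry_test phi (K : set (R3 R)) : smooth phi -> compact K -> supported_in K phi ->
  [/\ smooth (phi \o T), compact (T @^-1` K), supported_in (T @^-1` K) (phi \o T) &
      forall i y, partial i phi y = eps i * partial (pi i) (phi \o T) (T y)].
Proof.
have [pT TD TK piK [e1 ep]] := symT.
move=> sphi cK sK; split.
- exact: smooth_monomial affT sphi.
- rewrite (_ : T @^-1` K = T @` K).
    by apply: continuous_compact => //; apply: continuous_subspaceT; exact: affT.1.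
  apply/seteqP; split=> [y Ky|_ [y Ky <-]]; last by rewrite /= TK.
  by exists (T y).
- by move=> y nK; exact: sK.
- move=> i y; rewrite (partial_monomial _ _ affT sphi) ep piK TK mulrA e1 mul1r //.
Qed.

Lemma pull_back_green c u i phi (K : set (R3 R)) : smooth phi -> compact K -> supported_in K phi ->
  \int[leb3]_(y in D) (c * u (T y) * partial i phi y + c * (eps i * H1grad u (pi i) (T y)) * phi y) =
  c * eps i * \int[leb3]_(y in D) green_density u (pi i) (phi \o T) y.
Proof.
move=> sphi cK sK; have [pT TD TK piK [e1 ep]] := symT.
have [sT cT sKT pT'] := symmetry_test sphi cK sK.
have ig := green_integrable u (pi i) sT cT sKT.
rewrite -RintegralZl// -[RHS]symmetry_Rintegral.
  by apply: eq_Rintegral => y _; rewrite /green_density (pT' i y) /= TK; ring.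
apply: measurable_funM; first exact: measurable_cst.
by have /integrableP[/measurable_EFinP] := ig.
Qed.

Lemma pull_back_weak c u i :
  weak_partial D i (fun y => c * u (T y)) (fun y => c * (eps i * H1grad u (pi i) (T y))).
Proof.
have [pT TD TK piK [e1 ep]] := symT.
apply: weak_partial_green.
- exact: (L2Z mD c (L2_comp_symmetry mD symT (H1fun_L2 u))).
- exact: (L2Z mD c (L2Z mD (eps i) (L2_comp_symmetry mD symT (H1grad_L2 u (pi i))))).
move=> phi K sphi cK KD sK; have [sT cT sKT _] := symmetry_test sphi cK sK.
rewrite (pull_back_green _ _ _ sphi cK sK) (green_test _ _ sT cT)// ?mulr0//.
by rewrite -TD => y; exact: KD.
Qed.

(** [T] carries the faces of direction i to those of direction [fi i], exchanging the two sides when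
    [flip i] holds. The induced map [tau i] of the face parameters is the same on both sides, and
    this is why equal traces stay equal. *)
Variables (fi : 'I_2 -> 'I_2) (flip : 'I_2 -> bool) (tau : 'I_2 -> R * R -> R * R).
Hypotheses (fiP : forall i, plane (fi i) = pi (plane i))
  (tauK : forall i, involutive (tau i))
  (ptau : forall i, preserves leb2 (tau i))
  (Tface : forall i side x, T (face_pt i side x) = face_pt (fi i) (flip i (+) side) (tau i x))
  (Tslab : forall i z, 0 < coord3 (plane i) z < 2 -> 0 < coord3 (pi (plane i)) (T z) < 2)
  (Tsign : forall i, eps (plane i) = (-1) ^+ flip i).

Lemma continuous_face_pt i side : continuous (@face_pt R i side).
Proof.
rewrite /face_pt; set c := if side then 2 else 0; case: (i == 0) => /=.
  apply: (@continuous_R3 _ _ (fun=> c) (fun x => x.1) (fun x => x.2)) => x'; [exact: cvg_cst|exact: cvg_fst|exact: cvg_snd].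
apply: (@continuous_R3 _ _ (fun x => x.1) (fun=> c) (fun x => x.2)) => x'; [exact: cvg_fst|exact: cvg_cst|exact: cvg_snd].
Qed.

Lemma lateral_face_symmetry i side :
  tau i @^-1` lateral_face D (fi i) (flip i (+) side) = lateral_face D i side.
Proof.
have [pT TD TK piK _] := symT.
have DT z : D (T z) = D z by rewrite -{2}TD.
apply/seteqP; split=> x; rewrite /lateral_face /= => hx.
  rewrite -Tface in hx.
  apply: filterS (near_continuous (P := fun z => 0 < coord3 (plane (fi i)) z < 2 -> D z) affT.1 hx) => z hz z0.
  by rewrite -DT; apply: hz; rewrite fiP; exact: Tslab.
rewrite -Tface.
have hx' : \forall z \near T (T (face_pt i side x)), 0 < coord3 (plane i) z < 2 -> D z by rewrite TK.
apply: filterS (near_continuous (P := fun z => 0 < coord3 (plane i) z < 2 -> D z) affT.1 hx') => z hz z0.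
by rewrite -DT; apply: hz; rewrite -[plane i]piK -fiP; exact: Tslab.
Qed.

Lemma closure_symmetry y : closure D y -> closure D (T y).
Proof.
have [_ TD TK _ _] := symT.
move=> cy; apply: (closure_move (U := setT) affT.1) cy I => z; first by move=> _; exact: filterT.
by rewrite -{1}TD => hz _; rewrite -TD /= TK -TD.
Qed.

Hypothesis Foo : forall i side, (leb2 (lateral_face D i side) < +oo)%E.

Lemma pull_back_trace c u (v : H1 D) i side g :
  H1fun v = (fun y => c * u (T y)) ->
  (forall i, H1grad v i = fun y => c * (eps i * H1grad u (pi i) (T y))) ->
  is_trace (fi i) (flip i (+) side) u g -> is_trace i side v (fun x => c * g (tau i x)).
Proof.
have [pT TD TK piK [e1 ep]] := symT.
move=> vE gE [Lg hg].
have mF j s : measurable (lateral_face D j s : set (measurableTypeR R * measurableTypeR R)).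
  by apply: open_measurable2; exact: lateral_face_open.
have Lg' : L2 leb2 (lateral_face D i side) (g \o tau i).
  move: Lg => [mg g2]; split.
    rewrite -lateral_face_symmetry; apply: (measurable_comp (mF _ _) _ mg); last exact: measurable_funTS (ptau i).1.
    by move=> _ [x ? <-].
  by rewrite -lateral_face_symmetry; exact: (preserves_integrable (ptau i) (mF _ _) g2).
split; first exact: (L2Z (mF _ _) c Lg').
move=> phi K sphi cK sK KD; have [sT cT sKT _] := symmetry_test sphi cK sK.
rewrite vE gE (pull_back_green _ _ _ sphi cK sK) /green_density -fiP.
rewrite (hg _ _ sT cT sKT).
  (* When the sides are exchanged the outer normal is reversed; by [Tsign] the factor [eps] is -1
     exactly then. *)
  rewrite Tsign.
  have -> : \int[leb2]_(x in lateral_face D (fi i) (flip i (+) side)) (g x * (phi \o T) (face_pt (fi i) (flip i (+) side) x)) =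
     \int[leb2]_(x in lateral_face D i side) (g (tau i x) * phi (face_pt i side x)).
    have mh : measurable_fun (lateral_face D i side) (fun x => g (tau i x) * phi (face_pt i side x)).
      apply: measurable_funM; first exact: Lg'.1.
      apply: continuous_measurable2 => x; apply: continuous_comp; first exact: continuous_face_pt.
      exact: smooth_continuous.
    rewrite -(preserves_Rintegral (ptau i) (mF i side) mh).
    have -> : tau i @^-1` lateral_face D i side = lateral_face D (fi i) (flip i (+) side).
      rewrite -lateral_face_symmetry; apply/seteqP; split=> x; by rewrite /= tauK.
    apply: eq_Rintegral => x _; congr (g _ * phi _); first by rewrite tauK.
    by have := TK (face_pt i side (tau i x)); rewrite Tface tauK.
  have [M hM] := smooth_test_bounded sphi cK sK.
  have ig : leb2.-integrable (lateral_face D i side) (EFin \o (fun x => g (tau i x) * phi (face_pt i side x))).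
    apply: L2M_integrable => //; apply: (L2_bounded (mF _ _) (M := M)) => // [|x _].
      apply: continuous_measurable2 => x; apply: continuous_comp; first exact: continuous_face_pt.
      exact: smooth_continuous.
    by have [] := hM (plane i) (face_pt i side x).
  under [in RHS]eq_Rintegral do rewrite -mulrA.
  rewrite RintegralZl//; case: (flip i); case: (side) => /=; ring.
move=> y [Ky cy]; have [|[x Fx xE]] := KD (T y) (conj Ky (closure_symmetry cy)).
  by move=> DTy; left; rewrite -TD.
right; exists (tau i x); last by rewrite -Tface xE TK.
by have := Fx; rewrite -lateral_face_symmetry.
Qed.

Lemma affine_pulls_back : pulls_back D T pi eps.
Proof.
move=> c u [tr u0].
have [v [vE gE]] := pull_back_H1 (fun i => pull_back_weak c u i).
exists v; split; last by move=> i y; rewrite gE.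
split; last by rewrite vE; exact: pull_back_mean.
move=> i; have [g [g0 g1]] := tr (fi i); exists (fun x => c * g (tau i x)).
by split; apply: (pull_back_trace vE gE); case: (flip i).
Qed.

End Symmetry.
End PullBack.

(** * Cutoffs and the seam map *)

Section DominatedConvergence.
Context d (T : measurableType d) {R : realType} (m : {measure set T -> \bar R}) (D : set T).
Hypothesis mD : measurable D.

Lemma Rintegral_dominated (f_ : nat -> T -> R) (f g : T -> R) :
  (forall n, measurable_fun D (f_ n)) ->
  (forall x, D x -> f_ ^~ x @ \oo --> f x) ->
  m.-integrable D (EFin \o g) ->
  (forall n x, D x -> `|f_ n x| <= g x) ->
  (fun n => \int[m]_(x in D) f_ n x) @ \oo --> \int[m]_(x in D) f x.
Proof.
move=> mf_ f_f ig fg.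
have f_f' x : D x -> (EFin \o f_ ^~ x) @ \oo --> (f x)%:E.
  by move=> Dx; apply: cvg_EFin; [exact: nearW|exact: f_f].
have mf_' n : measurable_fun D (EFin \o f_ n) by exact/measurable_EFinP.
have fg' n x : D x -> (`|(EFin \o f_ n) x| <= (EFin \o g) x)%E.
  by move=> Dx; rewrite /= lee_fin; exact: fg.
have mf' : measurable_fun D (EFin \o f) by apply/measurable_EFinP; exact: measurable_fun_cvg f_f.
have [intf _ cv] := dominated_convergence mD mf_' mf' (aeW m f_f') ig (aeW m (fun x n => fg' n x)).
apply: fine_cvg; rewrite fineK; first exact: cv.
exact: integrable_fin_num.
Qed.

End DominatedConvergence.

Section Cutoff.
Context {R : realType}.
Implicit Types (s t : R) (n : nat).

(* Smooth in s, it vanishes for s <= 1 / (n + 1) and tends to 1 for s > 0. *)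
Definition cutoff n s : R := flat 0 (n.+1%:R * s - 1).

Lemma cutoff_ge0 n s : 0 <= cutoff n s.
Proof. exact: flat_ge0. Qed.

Lemma cutoff_le1 n s : cutoff n s <= 1.
Proof. exact: flat0_le1. Qed.

Lemma cutoff_eq0 n s : s <= n.+1%:R^-1 -> cutoff n s = 0.
Proof.
move=> sn; apply: flat_neg; rewrite subr_le0 mulrC -ler_pdivlMr ?ltr0n//.
by rewrite mul1r.
Qed.

Lemma mulr_flatS k t : t * flat k.+1 t = flat k t.
Proof.
rewrite /flat; case: ifP => t0; last by rewrite mulr0.
by rewrite exprS !mulrA mulfV ?mul1r// gt_eqF.
Qed.

Lemma flat_le_inv k t : 0 < t -> flat k t <= t^-1 ^+ k.
Proof.
move=> t0; rewrite /flat t0 ler_piMr ?exprn_ge0 ?invr_ge0 ?(ltW t0)//.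
by rewrite -expR0 ler_expR oppr_le0 invr_ge0 ltW.
Qed.

Lemma near_large s M : 0 < s -> \forall n \near \oo, M <= n.+1%:R * s - 1.
Proof.
move=> s0; near=> n.
rewrite lerBrDr -ler_pdivrMr//.
apply: (@le_trans _ _ n%:R); last by rewrite ler_nat.
near: n; exact: nbhs_infty_ger.
Unshelve. all: by end_near. Qed.

Lemma cutoff_cvg s : cutoff ^~ s @ \oo --> ((0 < s)%R%:R : R).
Proof.
have [s0|s0] := ltP 0 s; last first.
  rewrite (_ : cutoff^~ s = cst 0); first exact: cvg_cst.
  by apply/funext => n; apply: cutoff_eq0; apply: le_trans s0 _; rewrite invr_ge0.
apply/cvgrPdist_le => e e0; near=> n.
have tn : e^-1 <= n.+1%:R * s - 1 by near: n; exact: near_large.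
have t0 : 0 < n.+1%:R * s - 1 by apply: lt_le_trans tn; rewrite invr_gt0.
have := flat0_ge t0; have := cutoff_le1 n s; rewrite /cutoff => h1 h2.
rewrite ger0_norm; last by rewrite subr_ge0.
have : (n.+1%:R * s - 1)^-1 <= e by rewrite invf_ple ?posrE//.
rewrite /=; lra.
Unshelve. all: by end_near. Qed.

(** The derivative of [cutoff n], since [flat 0] has derivative [flat 2]; its size is of order n. *)
Definition dcutoff n s : R := n.+1%:R * flat 2 (n.+1%:R * s - 1).

Lemma mulr_dcutoff n s : s * dcutoff n s = flat 1 (n.+1%:R * s - 1) + flat 2 (n.+1%:R * s - 1).
Proof.
rewrite -(mulr_flatS 1) /dcutoff; ring.
Qed.

(** The weight s compensates the factor n + 1: with t = (n + 1) s - 1 the product is (t + 1)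
    [flat 2 t]. The constant is 1! + 2!. *)
Lemma mulr_dcutoff_bound n s : 0 <= s * dcutoff n s <= 3.
Proof.
rewrite mulr_dcutoff addr_ge0 ?flat_ge0//=.
have := flat_bound 1 (n.+1%:R * s - 1); have := flat_bound 2 (n.+1%:R * s - 1).
rewrite /= !factS fact0 !mul1n muln1; lra.
Qed.

Lemma mulr_dcutoff_cvg s : (fun n => s * dcutoff n s) @ \oo --> (0 : R).
Proof.
have [s0|s0] := ltP 0 s; last first.
  rewrite (_ : (fun n => _) = cst 0); first exact: cvg_cst.
  apply/funext => n; rewrite /dcutoff flat_neg ?mulr0//.
  rewrite subr_le0 (le_trans _ ler01)// mulr_ge0_le0//.
apply/cvgrPdist_le => e e0; near=> n.
(* For t >= 1 the two terms are at most 1/t and 1/t^2 <= 1/t, so t >= 2/e suffices. *)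
have tn : 2 * e^-1 <= n.+1%:R * s - 1 by near: n; exact: near_large.
have t1 : 1 <= n.+1%:R * s - 1 by near: n; exact: near_large.
have [h0 _] := andP (mulr_dcutoff_bound n s).
rewrite sub0r normrN ger0_norm// mulr_dcutoff; move: tn t1; set t := _ - 1 => tn t1.
have t0 : 0 < t by apply: lt_le_trans t1.
have := flat_le_inv 1 t0; have := flat_le_inv 2 t0; rewrite expr1 => h2 h1.
have h3 : t^-1 <= 1 by rewrite invf_le1.
have h4 : 0 <= t^-1 by rewrite invr_ge0 ltW.
have h5 : t^-1 <= e / 2.
  by rewrite invf_ple ?posrE ?divr_gt0// invf_div.
nra.
Unshelve. all: by end_near. Qed.

End Cutoff.

(** * Measure preservation of the seam map *)

Section SeamMap.
Context {R : realType}.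
Local Notation M3 := (measurableTypeR R * measurableTypeR R * measurableTypeR R)%type.

(** The preimage of E splits into its parts in A, in B and outside, which have the measures of the
    parts of E in B, in A and outside. This serves for the seam map in space and for its restriction
    to the faces y2 = 0 and y2 = 2. *)
Lemma preserves_exchange d (T : measurableType d) (m : {measure set T -> \bar R})
    (f g : T -> T) (A B : set T) :
  preserves m f -> preserves m g -> measurable A -> measurable B -> A `&` B = set0 ->
  f @^-1` B = A -> g @^-1` A = B ->
  preserves m (fun x => if x \in A then f x else if x \in B then g x else x).
Proof.
move=> pf pg mA mB AB fB gA.
set h := (fun x => _).
have AnB x : A x -> B x -> False by move=> Ax Bx; have : set0 x by rewrite -AB.
have hE E : h @^-1` E = f @^-1` (B `&` E) `|` g @^-1` (A `&` E) `|` (E `\` (A `|` B)).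
  rewrite !preimage_setI fB gA; apply/seteqP; split=> x; rewrite /h /=.
    case: ifPn => [/set_mem Ax|/negP nA]; first by left; left.
    case: ifPn => [/set_mem Bx|/negP nB]; first by left; right.
    by right; split=> // -[] /mem_set.
  move=> [[[Ax Ex]|[Bx Ex]]|[Ex nAB]].
  - by rewrite mem_set.
  - rewrite ifF; last by apply/negbTE/negP => /set_mem Ax; exact: AnB Bx.
    by rewrite mem_set.
  - rewrite ifF; last by apply/negbTE/negP => /set_mem ?; apply: nAB; left.
    by rewrite ifF//; apply/negbTE/negP => /set_mem ?; apply: nAB; right.
have mE E : measurable E -> [/\ measurable (f @^-1` (B `&` E)), measurable (g @^-1` (A `&` E)) & measurable (E `\` (A `|` B))].
  move=> mE; split.
  - by apply: preserves_measurable pf _; exact: measurableI.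
  - by apply: preserves_measurable pg _; exact: measurableI.
  - by apply: measurableD => //; exact: measurableU.
split=> [_ E mE'|E mE']; have [m1 m2 m3] := mE E mE'.
  by rewrite setTI hE; apply: measurableU => //; exact: measurableU.
rewrite hE measureU//; last 2 first.
- exact: measurableU.
- apply/seteqP; split=> x //; rewrite !preimage_setI fB gA => -[[[Ax _]|[Bx _]] [_ nAB]].
    by apply: nAB; left.
  by apply: nAB; right.
rewrite measureU//; last first.
  by apply/seteqP; split=> x //; rewrite !preimage_setI fB gA => -[[Ax _] [Bx _]]; exact: AnB Bx.
have [_ fE] := pf; have [_ gE] := pg.
transitivity (m (B `&` E) + m (A `&` E) + m (E `\` (A `|` B)))%E.
  by congr (_ + _ + _)%E; [apply: fE|apply: gE]; exact: measurableI.
have mAE : measurable (A `&` E) by exact: measurableI.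
have mBE : measurable (B `&` E) by exact: measurableI.
rewrite -measureU//; last first.
  by apply/seteqP; split=> x // -[[Bx _] [Ax _]]; exact: AnB Bx.
rewrite -measureU//; last 2 first.
- exact: measurableU.
- apply/seteqP; split=> x // -[[[Bx _]|[Ax _]] [_ nAB]].
    by apply: nAB; right.
  by apply: nAB; left.
congr (m _); apply/seteqP; split=> x.
  by move=> [[[]|[]]|[]].
move=> Ex; have [Ax|nA] := pselect (A x); first by left; right.
have [Bx|nB] := pselect (B x); first by left; left.
by right; split=> // -[].
Qed.

Lemma preserves_shift1 (s : R) : preserves (@leb3 R) (shift1 s).
Proof.
apply: (@leb3_preserves R (fun x => (x.1 + s, x.2)) (fun x => - x)); last exact: lebesgue_preserves_opp.
apply: (@leb2_preserves R (fun x => x + s) id); first exact: lebesgue_preserves_shift.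
exact: preserves_id.
Qed.

(** Taken as the identity on the planes y1 = 0, 1, 2 and outside the slab, so that it is an
    involution of the whole space. *)
Definition seam (y : R3 R) : R3 R :=
  if 0 < y.1.1 < 1 then shift1 1 y else if 1 < y.1.1 < 2 then shift1 (-1) y else y.

Lemma slab_open (a b : R) : open [set y : R3 R | a < y.1.1 < b].
Proof. by rewrite openE => y; exact: (@near_coord3 _ 0). Qed.

Lemma preserves_seam : preserves (@leb3 R) seam.
Proof.
pose A : set M3 := [set y : R3 R | 0 < y.1.1 < 1].
pose B : set M3 := [set y : R3 R | 1 < y.1.1 < 2].
have mA : measurable A by apply: (@open_measurable3 R); exact: slab_open.
have mB : measurable B by apply: (@open_measurable3 R); exact: slab_open.
have := @preserves_exchange _ _ (@leb3 R) (shift1 1) (shift1 (-1)) A B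
  (preserves_shift1 1) (preserves_shift1 (-1)) mA mB.
rewrite (_ : (fun x => _) = seam).
  apply; apply/seteqP; split=> y //.
  - by rewrite /A /B /= => -[]; lra.
  - by rewrite /A /B /= => ?; blra.
  - by rewrite /A /B /= => ?; blra.
  - by rewrite /A /B /= => ?; blra.
  - by rewrite /A /B /= => ?; blra.
apply/funext => y; rewrite /seam.
have -> : (y \in A) = (0 < y.1.1 < 1) by apply/idP/idP => [/set_mem|h] //; exact: mem_set.
by have -> : (y \in B) = (1 < y.1.1 < 2) by apply/idP/idP => [/set_mem|h] //; exact: mem_set.
Qed.

Lemma seamL y : 0 < y.1.1 < 1 -> seam y = shift1 1 y.
Proof. by rewrite /seam => ->. Qed.

Lemma seamR y : 1 < y.1.1 < 2 -> seam y = shift1 (-1) y.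
Proof.
move=> h; rewrite /seam h ifF//; apply/negbTE/negP; blra.
Qed.

Lemma seamK : involutive seam.
Proof.
move=> y; have [h|h] := boolP (0 < y.1.1 < 1).
  rewrite (seamL h) seamR /=; last blra.
  by apply: shift1K; rewrite subrr.
have [h'|h'] := boolP (1 < y.1.1 < 2).
  rewrite (seamR h') seamL /=; last blra.
  by apply: shift1K; rewrite addNr.
by rewrite {2}/seam (negbTE h) (negbTE h') /seam (negbTE h) (negbTE h').
Qed.

End SeamMap.

(** * Gauss-Green formulas on a half cell *)

Section CutoffLimit.
Context d (T : measurableType d) {R : realType} (m : {measure set T -> \bar R}) (D P : set T).
Hypothesis mD : measurable D.

(** The sharp restriction to P is reached through weights that can be chosen smooth and put into a
    test function; |f| dominates. *)
Lemma cutoff_limit (f : T -> R) (w : nat -> T -> R) :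
  m.-integrable D (EFin \o f) -> (forall n, measurable_fun D (w n)) ->
  (forall n x, `|w n x| <= 1) -> (forall x, D x -> w ^~ x @ \oo --> (\1_P x : R)) ->
  (fun n => \int[m]_(x in D) (f x * w n x)) @ \oo --> \int[m]_(x in D `&` P) f x.
Proof.
move=> intf mw w1 wP.
have mf : measurable_fun D f by have /integrableP[/measurable_EFinP] := intf.
have -> : \int[m]_(x in D `&` P) f x = \int[m]_(x in D) (f x * \1_P x).
  rewrite Rintegral_mkcondr; apply: eq_Rintegral => x _.
  by rewrite patchE indicE; case: ifPn; rewrite ?mulr1 ?mulr0.
apply: (@Rintegral_dominated _ _ _ _ _ mD _ _ (fun x => `|f x|)).
- by move=> n; exact: measurable_funM.
- by move=> x Dx; apply: cvgM; [exact: cvg_cst|exact: wP].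
- exact: integrable_norm.
- by move=> n x _; rewrite normrM ler_piMr.
Qed.

Lemma Rintegral_split (P' : set T) (f : T -> R) N : measurable P -> measurable P' ->
  measurable N -> m N = 0%E -> P `&` P' = set0 -> D `<=` P `|` P' `|` N ->
  (forall x, N x -> P x -> False) -> (forall x, N x -> P' x -> False) ->
  m.-integrable D (EFin \o f) ->
  \int[m]_(x in D) f x = \int[m]_(x in D `&` P) f x + \int[m]_(x in D `&` P') f x.
Proof.
move=> mP mP' mN N0 PP DN NP NP' intf.
have mDP : measurable (D `&` P) by exact: measurableI.
have mDP' : measurable (D `&` P') by exact: measurableI.
rewrite -Rintegral_setU//.
- rewrite /Rintegral (negligible_integral mN mD intf N0); congr fine.
  congr integral; apply/seteqP; split=> x.
    by move=> [Dx nN]; have [[]|] := DN x Dx; [left|right|].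
  by move=> [[Dx Px]|[Dx Px]]; split=> // Nx; [exact: (NP x)|exact: (NP' x)].
- apply: integrableS intf => //; first exact: measurableU.
  by move=> x [[]|[]].
- apply/disj_setPS => x [[_ Px] [_ Px']].
  by rewrite -PP.
Qed.

End CutoffLimit.

Section Seam.
Context {R : realType} (kappa : R).
Hypotheses (k0 : 0 < kappa) (k1 : kappa * 2 < 1) (hd : charts_diffeo kappa).
Local Ltac klra := have ? := k0; have ? := k1; blra.
Local Notation D := (textile_cell kappa).
Local Notation M3 := (measurableTypeR R * measurableTypeR R * measurableTypeR R)%type.
Local Notation M2 := (measurableTypeR R * measurableTypeR R)%type.
Local Notation F := (lateral_face D).
Implicit Types (b : bool) (u : H1 D) (phi psi : R3 R -> R) (K : set (R3 R)).

Lemma cell_measurable : measurable (D : set M3).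
Proof. exact: (open_measurable3 (@cell_open R kappa)). Qed.

Lemma face_measurable i side : measurable (F i side : set M2).
Proof. exact: (open_measurable2 (@lateral_face_open R D i side)). Qed.

Let mD := cell_measurable.
Let mF := face_measurable.
Let oD := @cell_open R kappa.
Let Doo := cell_finite k0 k1.

(** The half of index b lies between the wall and the face y1 = 0 or y1 = 2 of side b. Its sign
    [sg b] is also the outer normal on that face, and [depth b] runs from 0 on the wall to 1 on the
    face. *)
Definition sg b : R := if b then 1 else -1.
Definition depth b (s : R) : R := sg b * (s - 1).
Definition side_of b : set (R3 R) := [set y | 0 < depth b y.1.1].
Definition half b : set (R3 R) := D `&` side_of b.

Lemma sgsg b : sg b * sg b = 1.
Proof. by case: b; rewrite /sg; lra. Qed.

Lemma side_ofE b : side_of b = if b then [set y : R3 R | 1 < y.1.1] else [set y : R3 R | y.1.1 < 1].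
Proof. by rewrite /side_of /depth /sg; case: b; apply/seteqP; split=> y /=; lra. Qed.

Lemma side_of_open b : open (side_of b).
Proof.
rewrite openE side_ofE; case: b => y h.
  exact: (@near_lt_coord3 _ 0).
exact: (@near_coord3_lt _ 0).
Qed.

Lemma half_open b : open (half b).
Proof. exact: openI oD (@side_of_open b). Qed.

Lemma half_measurable b : measurable (half b : set M3).
Proof. exact: (open_measurable3 (@half_open b)). Qed.

Lemma depth_lt1 b y : D y -> depth b y.1.1 < 1.
Proof. by move=> /cell_bounds[h _ _]; rewrite /depth /sg; case: b; blra. Qed.

Lemma wall_null : leb3 ([set y : R3 R | y.1.1 = 1] : set M3) = 0%E /\
  measurable ([set y : R3 R | y.1.1 = 1] : set M3).
Proof.
pose A : set (measurableTypeR R) := [set (1 : R)].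
have mA : measurable A by exact: measurable_set1.
have -> : [set y : R3 R | y.1.1 = 1] = (A `*` setT) `*` setT.
  by apply/seteqP; split=> y /=; [move=> ->|move=> [[]]].
have mAT : measurable (A `*` (setT : set (measurableTypeR R))) by exact: measurableX.
split; last exact: measurableX.
transitivity (leb2 (A `*` (setT : set (measurableTypeR R))) * lebesgue_measure (setT : set (measurableTypeR R)))%E.
  exact: product_measure1E.
have -> : leb2 (A `*` (setT : set (measurableTypeR R))) = (lebesgue_measure A * lebesgue_measure (setT : set (measurableTypeR R)))%E.
  exact: product_measure1E.
by rewrite lebesgue_measure_set1 !mul0e.
Qed.

Lemma line_null : leb2 ([set x : R * R | x.1 = 1] : set M2) = 0%E /\
  measurable ([set x : R * R | x.1 = 1] : set M2).
Proof.
pose A : set (measurableTypeR R) := [set (1 : R)].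
have mA : measurable A by exact: measurable_set1.
have -> : [set y : R * R | y.1 = 1] = A `*` setT.
  by apply/seteqP; split=> y /=; [move=> ->|move=> []].
split; last exact: measurableX.
transitivity (lebesgue_measure A * lebesgue_measure (setT : set (measurableTypeR R)))%E.
  exact: product_measure1E.
by rewrite lebesgue_measure_set1 mul0e.
Qed.

Lemma Rintegral_halves f : leb3.-integrable D (EFin \o f) ->
  \int[leb3]_(y in D) f y = \int[leb3]_(y in half false) f y + \int[leb3]_(y in half true) f y.
Proof.
have [N0 mN] := wall_null; move=> intf.
have mS b : measurable (side_of b : set M3) by exact: (open_measurable3 (@side_of_open b)).
apply: (Rintegral_split mD (mS false) (mS true) mN N0) => //.
- apply/seteqP; split=> y //; rewrite !side_ofE /= => -[]; lra.
- move=> y _; rewrite !side_ofE /=; have [h|h|h] := ltgtP y.1.1 1; [left; left|left; right|right] => //.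
- by move=> y /=; rewrite side_ofE /= => ->; lra.
- by move=> y /=; rewrite side_ofE /= => ->; lra.
Qed.

(** [chi] removes a neighbourhood of the wall and the other half, [chi'] a neighbourhood of the
    outer face. *)
Definition chi b n (y : R3 R) : R := cutoff n (depth b y.1.1).
Definition chi' b n (y : R3 R) : R := cutoff n (1 - depth b y.1.1).

Lemma chiE b n : chi b n = fun y => flat 0 ((n.+1%:R * sg b) * coord3 0 y + (- (n.+1%:R * sg b) - 1)).
Proof. by apply/funext => y; rewrite /chi /cutoff /depth; congr flat; rewrite /coord3 /=; ring. Qed.

Lemma chi'E b n : chi' b n = fun y => flat 0 ((- (n.+1%:R * sg b)) * coord3 0 y + (n.+1%:R * (1 + sg b) - 1)).
Proof. by apply/funext => y; rewrite /chi' /cutoff /depth; congr flat; rewrite /coord3 /=; ring. Qed.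

Lemma smooth_chi b n : smooth (chi b n).
Proof. by rewrite chiE; exact: smooth_flat. Qed.

Lemma smooth_chi' b n : smooth (chi' b n).
Proof. by rewrite chi'E; exact: smooth_flat. Qed.

Lemma partial_chi b n j y : partial j (chi b n) y = (j == 0)%:R * (sg b * dcutoff n (depth b y.1.1)).
Proof.
rewrite chiE; have [_] := is_derive_coord j (is_derive_flat 0 ((n.+1%:R * sg b) * coord3 0 y + (- (n.+1%:R * sg b) - 1))).
rewrite /partial => ->; rewrite mul0r subr0 /dcutoff eq_sym.
rewrite (_ : n.+1%:R * depth b y.1.1 - 1 = n.+1%:R * sg b * coord3 0 y + (- (n.+1%:R * sg b) - 1)); first by ring.
by rewrite /depth /coord3 /=; ring.
Qed.

Lemma partial_chi' b n j y : j != 0 -> partial j (chi' b n) y = 0.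
Proof.
move=> j0; rewrite chi'E; have [_] := is_derive_coord j (is_derive_flat 0 ((- (n.+1%:R * sg b)) * coord3 0 y + (n.+1%:R * (1 + sg b) - 1))).
by rewrite /partial => ->; rewrite eq_sym (negbTE j0) !mulr0.
Qed.

Lemma continuous_depth b : continuous (fun y : R3 R => depth b y.1.1).
Proof.
have -> : (fun y : R3 R => depth b y.1.1) = fun y => sg b * coord3 0 y + (- sg b).
  by apply/funext => y; rewrite /depth /coord3 /=; ring.
exact: continuous_affine_coord.
Qed.

Lemma compact_depth b K (l r : R) : compact K -> compact (K `&` [set y | l <= depth b y.1.1 <= r]).
Proof.
move=> cK; apply: compact_closedI => //.
rewrite (_ : [set y | _] = (fun y : R3 R => depth b y.1.1) @^-1` `[l, r]%classic).
  by apply: (continuous_closedP _).1; [exact: continuous_depth|exact: itv_closed].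
by apply/seteqP; split=> y; rewrite /= in_itv.
Qed.

Lemma chi_le1 b n y : `|chi b n y| <= 1.
Proof. by rewrite ger0_norm ?cutoff_ge0 ?cutoff_le1. Qed.

Lemma chi'_le1 b n y : `|chi' b n y| <= 1.
Proof. by rewrite ger0_norm ?cutoff_ge0 ?cutoff_le1. Qed.

Hypothesis Foo : forall i side, (leb2 (F i side) < +oo)%E.

Lemma face_integrable i side g psi K : L2 leb2 (F i side) g ->
  smooth psi -> compact K -> supported_in K psi ->
  leb2.-integrable (F i side) (EFin \o (fun x => g x * psi (face_pt i side x))).
Proof.
move=> Lg sp cK sK; have [M hM] := smooth_test_bounded sp cK sK.
apply: L2M_integrable => //; apply: (L2_bounded (mF _ _) (M := M)) => // [|x _].
  apply: continuous_measurable2 => x; apply: continuous_comp; first exact: continuous_face_pt.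
  exact: smooth_continuous.
by have [] := hM 0 (face_pt i side x).
Qed.

Lemma traceE i j side u g psi K : plane i = j -> is_trace i side u g ->
  smooth psi -> compact K -> supported_in K psi ->
  K `&` closure D `<=` D `|` face_pt i side @` F i side ->
  \int[leb3]_(y in D) green_density u j psi y =
  sg side * \int[leb2]_(x in F i side) (g x * psi (face_pt i side x)).
Proof. by move=> <- [_ h] sp cK sK KD; exact: (h psi K). Qed.

Lemma plane0 : plane 0 = 0.
Proof. exact: val_inj. Qed.

Lemma plane1 : plane 1 = 1.
Proof. exact: val_inj. Qed.

Lemma half_green0 u b g rho K : is_trace 0 b u g ->
  smooth rho -> compact K -> supported_in K rho -> (forall x z, rho (1, x, z) = 0) ->
  K `&` closure (half b) `<=` D `|` face_pt 0 b @` F 0 b ->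
  \int[leb3]_(y in half b) green_density u 0 rho y =
  sg b * \int[leb2]_(x in F 0 b) (g x * rho (face_pt 0 b x)).
Proof.
move=> tg srho cK sK rho1 KD.
have [M hM] := smooth_test_bounded srho cK sK.
have M0 : 0 <= M by have [h _] := hM 0 (0, 0, 0); have := normr_ge0 (rho (0, 0, 0)); lra.
pose rn n y := rho y * chi b n y.
have srn n : smooth (rn n) by apply: smoothM => //; exact: smooth_chi.
pose Ln n := K `&` [set y : R3 R | n.+1%:R^-1 <= depth b y.1.1].
have cLn n : compact (Ln n).
  apply: compact_closedI => //.
  rewrite (_ : [set y | _] = (fun y : R3 R => depth b y.1.1) @^-1` [set s : R | n.+1%:R^-1 <= s])//.
  by apply: (continuous_closedP _).1; [exact: continuous_depth|exact: closed_ge].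
have sLn n : supported_in (Ln n) (rn n).
  move=> y nL; rewrite /rn; have [Ky|nK] := pselect (K y); last by rewrite sK// mul0r.
  rewrite /chi cutoff_eq0 ?mulr0//; apply/ltW; rewrite ltNge; apply/negP => h.
  by apply: nL.
have KnD n : Ln n `&` closure D `<=` D `|` face_pt 0 b @` F 0 b.
  move=> y [[Ky /= dy] cy]; apply: KD; split=> // B nB.
  have d0 : side_of b y by rewrite /side_of /=; apply: lt_le_trans dy; rewrite invr_gt0.
  have nS : nbhs y (side_of b) by apply: open_nbhs_nbhs; split => //; exact: side_of_open.
  by have [z [Dz [Bz Sz]]] := cy _ (filterI nB nS); exists z.
set I := \int[leb2]_(x in F 0 b) (g x * rho (face_pt 0 b x)).
(* The outer face has depth 1, so the cutoff is constant there, and this constant tends to 1. *)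
have trn n : \int[leb3]_(y in D) green_density u 0 (rn n) y = sg b * (I * cutoff n 1).
  rewrite (traceE plane0 tg (srn n) (cLn n) (sLn n) (KnD n)); congr (_ * _).
  rewrite -RintegralZr//; last exact: (face_integrable tg.1 srho cK sK).
  apply: eq_Rintegral => x _; rewrite /rn mulrA; congr (_ * _).
  by rewrite /chi /depth /face_pt /= /sg; congr cutoff; case: (b); lra.
have igr := green_integrable oD Doo u 0 srho cK sK.
have iu (f : R3 R -> R) C : measurable_fun D f -> (forall y, `|f y| <= C) ->
    leb3.-integrable D (EFin \o (fun y => u y * f y)).
  move=> mf fC; apply: L2M_integrable; [exact: mD|exact: H1fun_L2|].
  by apply: (L2_bounded mD (M := C)).
pose q n y := rho y * (sg b * dcutoff n (depth b y.1.1)).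
(* At depth 0 the quotient takes the default value 0, consistently with rho vanishing on the
   wall. *)
have qE n y : q n y = (rho y / (depth b y.1.1)) * sg b * (depth b y.1.1 * dcutoff n (depth b y.1.1)).
  rewrite /q; have [e|e] := eqVneq (depth b y.1.1) 0.
    rewrite e mul0r mulr0; case: y e => [[s x] z] /=; rewrite /depth /= => e.
    have -> : s = 1 by have := sgsg b; move: e; rewrite /sg; case: (b); lra.
    by rewrite rho1 mul0r.
  by rewrite mulrA [in RHS]mulrACA divfK// mulrA; ring.
have rhoM y : `|rho y / depth b y.1.1| <= M.
  case: y => [[s x] z] /=; rewrite normrM normfV.
  have [->|e] := eqVneq (depth b s) 0; first by rewrite normr0 invr0 mulr0.
  rewrite ler_pdivrMr ?normr_gt0//.
  have := smooth_lipschitz0 srho (fun y => (hM 0 y).2) s 1 x z; rewrite rho1 subr0.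
  rewrite /depth normrM; have -> : `|sg b| = 1 by rewrite /sg; case: (b); rewrite ?normrN normr1.
  by rewrite mul1r.
have sgn : `|sg b| = 1 by rewrite /sg; case: (b); rewrite ?normrN normr1.
have qM n y : `|q n y| <= M * 3.
  rewrite qE normrM (normrM (rho y / _)) sgn mulr1; apply: ler_pM; [exact: normr_ge0|exact: normr_ge0|exact: rhoM|].
  by have /andP[h0 h3] := mulr_dcutoff_bound n (depth b y.1.1); rewrite ger0_norm.
have mq n : measurable_fun D (q n).
  apply: continuous_measurable3; rewrite (_ : q n = fun y => rho y * partial 0 (chi b n) y).
    apply: smooth_continuous; apply: smoothM => //; apply: smooth_partial; exact: smooth_chi.
  by apply/funext => y; rewrite partial_chi mul1r.
have dec n : \int[leb3]_(y in D) green_density u 0 (rn n) y =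
   \int[leb3]_(y in D) (green_density u 0 rho y * chi b n y) + \int[leb3]_(y in D) (u y * q n y).
  rewrite -RintegralD//; last exact: (iu _ _ (mq n) (qM n)).
    apply: eq_Rintegral => y _; rewrite /green_density /rn partialM; last 2 first.
    - exact: smooth_derivable.
    - exact: smooth_derivable (@smooth_chi b n).
    by rewrite partial_chi mul1r /q; ring.
  apply: (@integrable_le _ _ _ _ _ mD _ (fun y => `|green_density u 0 rho y|)).
  - apply: measurable_funM; first by have /integrableP[/measurable_EFinP] := igr.
    exact: continuous_measurable3 (smooth_continuous (@smooth_chi b n)).
  - exact: integrable_norm.
  - by move=> y _; rewrite normrM ler_piMr// chi_le1.
have lim1 : (fun n => \int[leb3]_(y in D) (green_density u 0 rho y * chi b n y)) @ \oo --> \int[leb3]_(y in half b) green_density u 0 rho y.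
  apply: cutoff_limit => //.
  - by move=> n; exact: continuous_measurable3 (smooth_continuous (@smooth_chi b n)).
  - by move=> n y; exact: chi_le1.
  - move=> y _; rewrite indicE; have := @cutoff_cvg R (depth b y.1.1).
    rewrite (_ : (y \in side_of b) = (0 < depth b y.1.1))//.
    by apply/idP/idP => [/set_mem|h] //; exact: mem_set.
have lim2 : (fun n => \int[leb3]_(y in D) (u y * q n y)) @ \oo --> \int[leb3]_(y in D) (0 : R).
  apply: (@Rintegral_dominated _ _ _ _ _ mD _ _ (fun y => `|u y * (M * 3)|)).
  - by move=> n; have [mu _] := H1fun_L2 u; apply: measurable_funM; [exact: mu|exact: mq].
  - move=> y _; rewrite -[X in _ --> X](mulr0 (u y)); apply: cvgM; first exact: cvg_cst.
    have -> : q^~ y = fun n => (rho y / depth b y.1.1 * sg b) * (depth b y.1.1 * dcutoff n (depth b y.1.1)).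
      by apply/funext => n; exact: qE.
    rewrite -[X in _ --> X](mulr0 (rho y / (depth b y.1.1) * sg b)).
    by apply: cvgM; [exact: cvg_cst|exact: mulr_dcutoff_cvg].
  - apply: integrable_norm; apply: (iu (cst (M * 3)) (M * 3)); first exact: measurable_cst.
    by move=> y; rewrite /= ger0_norm//; move: M0; lra.
  - move=> n y _; rewrite normrM (normrM (u y) (M * 3)) ler_wpM2l//; apply: le_trans (qM n y) _.
    exact: ler_norm.
have L : (fun n => \int[leb3]_(y in D) green_density u 0 (rn n) y) @ \oo --> \int[leb3]_(y in half b) green_density u 0 rho y.
  rewrite (funext dec) -[X in _ --> X]addr0; apply: cvgD => //.
  by have := lim2; rewrite Rintegral_cst// mul0r.
have L' : (fun n => \int[leb3]_(y in D) green_density u 0 (rn n) y) @ \oo --> sg b * I.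
  rewrite (funext trn); apply: cvgM; first exact: cvg_cst.
  rewrite -[X in _ --> X]mulr1; apply: cvgM; first exact: cvg_cst.
  by have := @cutoff_cvg R 1; rewrite ltr01.
exact: (cvg_unique _ L L').
Qed.

(** The cutoffs depend on y1 only, so derivatives in the other directions do not see them and no
    extra term arises. Hence psi may take any values on the wall. *)
Lemma half_cutoff_limit u b j psi K : j != 0 -> smooth psi -> compact K -> supported_in K psi ->
  (fun n => \int[leb3]_(y in D) green_density u j (fun y => psi y * (chi b n y * chi' b n y)) y) @ \oo
    --> \int[leb3]_(y in half b) green_density u j psi y.
Proof.
move=> j0 sp cK sK.
have igr := green_integrable oD Doo u j sp cK sK.
have E n y : green_density u j (fun y => psi y * (chi b n y * chi' b n y)) y = green_density u j psi y * (chi b n y * chi' b n y).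
  have sc := @smooth_chi b n; have sc' := @smooth_chi' b n.
  rewrite /green_density partialM; last 2 first.
  - exact: smooth_derivable.
  - exact: smooth_derivable (smoothM sc sc').
  rewrite partialM; last 2 first.
  - exact: smooth_derivable.
  - exact: smooth_derivable.
  by rewrite partial_chi partial_chi'// (negbTE j0) /= mul0r; ring.
under eq_fun do under eq_Rintegral do rewrite E.
apply: cutoff_limit => //.
- move=> n; apply: continuous_measurable3; apply: smooth_continuous; apply: smoothM.
    exact: smooth_chi.
  exact: smooth_chi'.
- by move=> n y; rewrite normrM mulr_ile1 ?chi_le1 ?chi'_le1.
- move=> y Dy; rewrite indicE.
  have -> : (y \in side_of b) = (0 < depth b y.1.1) by apply/idP/idP => [/set_mem|h] //; exact: mem_set.
  rewrite -[X in _ --> X]mulr1; apply: cvgM; first exact: cutoff_cvg.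
  have := @cutoff_cvg R (1 - depth b y.1.1).
  by rewrite subr_gt0 (depth_lt1 b Dy).
Qed.

Lemma support_cutoffs b n psi K : supported_in K psi ->
  supported_in (K `&` [set y | n.+1%:R^-1 <= depth b y.1.1 <= 1 - n.+1%:R^-1])
    (fun y => psi y * (chi b n y * chi' b n y)).
Proof.
move=> sK y nL; have [Ky|nK] := pselect (K y); last by rewrite sK// mul0r.
have [h1|h1] := leP n.+1%:R^-1 (depth b y.1.1); last first.
  by rewrite /chi cutoff_eq0 ?mul0r ?mulr0// ltW.
have [h2|h2] := leP (depth b y.1.1) (1 - n.+1%:R^-1).
  by exfalso; apply: nL; split=> //=; rewrite h1.
by rewrite /chi' cutoff_eq0 ?mulr0//; move: h2; move: (n.+1%:R^-1 : R) => q h2; lra.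
Qed.

Lemma half_green_test u b j psi K : j != 0 -> smooth psi -> compact K -> supported_in K psi ->
  (forall y, K y -> 0 < depth b y.1.1 < 1 -> D y) ->
  \int[leb3]_(y in half b) green_density u j psi y = 0.
Proof.
move=> j0 sp cK sK KD.
have L := @half_cutoff_limit u b _ psi K j0 sp cK sK.
have E n : \int[leb3]_(y in D) green_density u j (fun y => psi y * (chi b n y * chi' b n y)) y = 0.
  apply: (@green_test _ _ oD Doo u j _ (K `&` [set y | n.+1%:R^-1 <= depth b y.1.1 <= 1 - n.+1%:R^-1])).
  - by apply: smoothM => //; apply: smoothM; [exact: smooth_chi|exact: smooth_chi'].
  - exact: compact_depth.
  - move=> y [Ky /= h]; apply: KD => //.
    have : 0 < n.+1%:R^-1 :> R by rewrite invr_gt0.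
    by move: h; move: (n.+1%:R^-1 : R) => q h q0; blra.
  - exact: support_cutoffs.
have L' : (fun n => \int[leb3]_(y in D) green_density u j (fun y => psi y * (chi b n y * chi' b n y)) y) @ \oo --> (0 : R).
  by rewrite (funext E); exact: cvg_cst.
exact: (cvg_unique _ L L').
Qed.

Lemma half_green1 u b side g psi K : is_trace 1 side u g ->
  smooth psi -> compact K -> supported_in K psi ->
  (forall y, K y -> closure D y -> 0 < depth b y.1.1 < 1 -> (D `|` face_pt 1 side @` F 1 side) y) ->
  \int[leb3]_(y in half b) green_density u 1 psi y =
  sg side * \int[leb2]_(x in F 1 side `&` [set x | 0 < depth b x.1 < 1]) (g x * psi (face_pt 1 side x)).
Proof.
move=> tg sp cK sK KD.
have j0 : (1 : 'I_3) != 0 by [].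
have L := @half_cutoff_limit u b _ psi K j0 sp cK sK.
pose w n (x : R * R) := cutoff n (depth b x.1) * cutoff n (1 - depth b x.1) : R.
have E n : \int[leb3]_(y in D) green_density u 1 (fun y => psi y * (chi b n y * chi' b n y)) y =
    sg side * \int[leb2]_(x in F 1 side) (g x * psi (face_pt 1 side x) * w n x).
  rewrite (@traceE 1 1 side u g _ (K `&` [set y | n.+1%:R^-1 <= depth b y.1.1 <= 1 - n.+1%:R^-1]))//.
  - by congr (_ * _); apply: eq_Rintegral => x _; rewrite mulrA.
  - exact: plane1.
  - by apply: smoothM => //; apply: smoothM; [exact: smooth_chi|exact: smooth_chi'].
  - exact: compact_depth.
  - exact: support_cutoffs.
  - move=> y [[Ky /= h] cy]; apply: KD => //.
    have : 0 < n.+1%:R^-1 :> R by rewrite invr_gt0.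
    by move: h; move: (n.+1%:R^-1 : R) => q h q0; blra.
have cw n : continuous (w n).
  have -> : w n = (fun y => chi b n y * chi' b n y) \o (fun x : R * R => (x.1, 0, x.2) : R3 R) by [].
  move=> x; apply: continuous_comp.
    apply: (@continuous_R3 _ _ (fun x => x.1) (fun=> 0) (fun x => x.2)) => x'; [exact: cvg_fst|exact: cvg_cst|exact: cvg_snd].
  by apply: smooth_continuous; apply: smoothM; [exact: smooth_chi|exact: smooth_chi'].
have L' : (fun n => \int[leb3]_(y in D) green_density u 1 (fun y => psi y * (chi b n y * chi' b n y)) y) @ \oo -->
   sg side * \int[leb2]_(x in F 1 side `&` [set x | 0 < depth b x.1 < 1]) (g x * psi (face_pt 1 side x)).
  rewrite (funext E); apply: cvgM; first exact: cvg_cst.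
  apply: cutoff_limit => //.
  - exact: (face_integrable tg.1 sp cK sK).
  - by move=> n; exact: continuous_measurable2.
  - by move=> n x; rewrite normrM mulr_ile1 // ger0_norm ?cutoff_ge0 ?cutoff_le1.
  - move=> x _; rewrite indicE.
    have -> : (x \in [set x | 0 < depth b x.1 < 1]) = (0 < depth b x.1 < 1) by apply/idP/idP => [/set_mem|h] //; exact: mem_set.
    have -> : (0 < depth b x.1 < 1)%R%:R = (0 < depth b x.1)%R%:R * (0 < 1 - depth b x.1)%R%:R :> R.
      by rewrite subr_gt0 -natrM mulnb.
    by apply: cvgM; exact: cutoff_cvg.
exact: (cvg_unique _ L L').
Qed.

End Seam.

(** * The trace on the middle wall *)

Section Slices.
Context {R : realType}.
Local Notation lam := (@lebesgue_measure R).
Local Notation RT := (measurableTypeR R).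

(** Cauchy-Schwarz on an interval of length 1: with m the integral of h, the integral of (h - m)^2
    over the interval is nonnegative. An infinite right-hand side is set apart first. *)
Lemma square_integral_le (h : R -> R) : measurable_fun (setT : set RT) h ->
  (forall t, ~ (0 < t < 1) -> h t = 0) ->
  (((\int[lam]_t h t) ^+ 2)%:E <= \int[lam]_t ((h t) ^+ 2)%:E)%E.
Proof.
move=> mh h0; have sq (s m : R) : 0 <= s + (- 2 * m * m + m ^+ 2 * 1) -> m ^+ 2 <= s.
  by rewrite !expr2; lra.
pose I : set RT := `]0, 1[%classic.
have mI : measurable I by exact: measurable_itv.
have lI : lam I = 1%E by rewrite lebesgue_measure_itv/= lte_fin ltr01 oppr0 adde0.
have hI (f : R -> R) : (forall t, ~ (0 < t < 1) -> f t = 0) -> f \_ I = f.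
  move=> f0; apply/funext => t; rewrite patchE; case: ifPn => // /negP nI.
  by rewrite f0// => t01; apply: nI; rewrite mem_set// /I /= in_itv.
have mh2 : measurable_fun (setT : set RT) (fun t => (h t) ^+ 2) by exact: measurable_funX.
have [->|] := eqVneq (\int[lam]_t ((h t) ^+ 2)%:E)%E +oo%E; first by rewrite leey.
rewrite -ltey => fin2.
have i2 : lam.-integrable setT (EFin \o (fun t => (h t) ^+ 2)).
  apply/integrableP; split; first exact/measurable_EFinP.
  by under eq_integral do rewrite /= ger0_norm ?sqr_ge0//.
have i2I : lam.-integrable I (EFin \o (fun t => (h t) ^+ 2)).
  by apply: integrableS i2.
have icst c : lam.-integrable I (EFin \o (fun=> c : R)).
  apply: measurable_bounded_integrable => //; first by rewrite [ltLHS]lI ltry.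
  exists `|c|; split; first by rewrite num_real.
  by move=> y cy x _ /=; apply: ltW; exact: cy.
have i1I : lam.-integrable I (EFin \o h).
  apply: (@integrable_le _ _ _ _ _ mI _ (fun t => (h t) ^+ 2 + 1)).
  - exact: measurable_funTS.
  - by apply: (integrableRD mI i2I (icst 1)).
  - move=> t _; rewrite ler_norml; have := sqr_ge0 (h t - 1); have := sqr_ge0 (h t + 1).
    rewrite !expr2 => ? ?; apply/andP; split; nra.
set m := \int[lam]_t h t.
have mE : m = \int[lam]_(t in I) h t by rewrite Rintegral_mkcond hI.
have sE : \int[lam]_t (h t) ^+ 2 = \int[lam]_(t in I) (h t) ^+ 2.
  by rewrite [RHS]Rintegral_mkcond hI// => t nt; rewrite h0// expr0n.
rewrite -(fineK (integrable_fin_num measurableT i2)) lee_fin.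
rewrite -/(\int[lam]_t (h t) ^+ 2) sE.
have : 0 <= \int[lam]_(t in I) ((h t) ^+ 2 + ((- 2 * m) * h t + m ^+ 2)).
  apply: Rintegral_ge0 => t _; have := sqr_ge0 (h t - m); rewrite !expr2; nra.
rewrite RintegralD//; last by apply: (integrableRD mI (integrableRZ mI _ i1I) (icst _)).
rewrite RintegralD//; last exact: (integrableRZ mI).
by rewrite RintegralZl// -mE Rintegral_cst// [X in fine X]lI /=; exact: sq.
Qed.

Variable k : R3 R -> R.
Hypotheses (mk : measurable_fun (setT : set (RT * RT * RT)) k)
  (ik : leb3.-integrable setT (EFin \o k))
  (ik2 : leb3.-integrable setT (EFin \o (fun y => (k y) ^+ 2)))
  (k0 : forall y, ~ (0 < y.1.1 < 1) -> k y = 0).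

(** Integration in the direction orthogonal to the wall turns a function on half of the cell into a
    function on the wall. *)
Definition slice (x : R * R) : R := \int[lam]_t k (t, x.1, x.2).

Lemma assoc_integrable (f : R3 R -> R) : leb3.-integrable setT (EFin \o f) ->
  (lam \x @sleb2 R)%E.-integrable setT (EFin \o f \o @assoc3 R).
Proof.
move=> /integrableP[mf foo]; apply/integrableP; split.
  by apply: measurableT_comp mf _; exact: measurable_assoc3.
move: foo; rewrite leb3_integral_assoc//.
exact: measurableT_comp.
Qed.

Lemma measurable_slice : measurable_fun (setT : set (RT * RT)) slice.
Proof.
have h := @measurable_fubini_G _ _ _ _ _ lam (@sleb2 R) _ (assoc_integrable ik).
exact: (measurableT_comp _ h).
Qed.

(** As k is supported in a slab of width 1, on each line the square of the integral is at most the
    integral of the square; Tonelli concludes. *)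
Lemma slice_L2 : L2 (@leb2 R) setT slice.
Proof.
split; first exact: measurable_slice.
have mk2 : measurable_fun (setT : set (RT * RT * RT)) (EFin \o (fun y => (k y) ^+ 2)).
  by apply/measurable_EFinP; exact: measurable_funX.
have ms2 : measurable_fun (setT : set (RT * RT)) (EFin \o (fun x => (slice x) ^+ 2)).
  by apply/measurable_EFinP; apply: measurable_funX; exact: measurable_slice.
apply/integrableP; split; first exact: ms2.
have /integrableP[ma a2] := assoc_integrable ik2.
apply: le_lt_trans a2.
have -> : (\int[lam \x @sleb2 R]_x `|(EFin \o (fun y => (k y) ^+ 2)%R \o @assoc3 R) x|)%E =
   (\int[@sleb2 R]_x \int[lam]_t `|(EFin \o (fun y => (k y) ^+ 2)%R \o @assoc3 R) (t, x)|)%E.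
  rewrite (fubini_tonelli2 (m1 := lam) (m2 := @sleb2 R) (fun z => `|(EFin \o (fun y => (k y) ^+ 2)%R \o @assoc3 R) z|%E))//.
  exact: measurableT_comp.
apply: ge0_le_integral => //.
- exact: measurableT_comp.
- apply: (measurable_fun_fubini_tonelli_G (m1 := lam) (fun z => `|(EFin \o (fun y => (k y) ^+ 2)%R \o @assoc3 R) z|%E)) => //.
  exact: measurableT_comp.
- move=> x _; rewrite /= ger0_norm ?sqr_ge0//.
  under eq_integral do rewrite /= ger0_norm ?sqr_ge0//.
  apply: square_integral_le => [|t nt]; last exact: k0.
  have ma' : measurable_fun (setT : set (RT * (RT * RT))) (k \o @assoc3 R).
    by apply: measurableT_comp mk _; exact: measurable_assoc3.
  exact: (measurableT_comp ma' (measurable_pair2 x)).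
Qed.

Lemma slice_integral (psi : R * R -> R) M : continuous psi -> (forall x, `|psi x| <= M) ->
  \int[leb3]_y (psi (y.1.2, y.2) * k y) = \int[leb2]_x (psi x * slice x).
Proof.
move=> cpsi psiM; pose f (y : R3 R) := psi (y.1.2, y.2) * k y.
have mf : measurable_fun (setT : set (RT * RT * RT)) f.
  apply: measurable_funM => //; apply: continuous_measurable3 => y.
  apply: continuous_comp; last exact: cpsi.
  exact: (cvg_pair (@continuous_coord3 R 1 y) (@continuous_coord3 R 2 y)).
have if_ : leb3.-integrable setT (EFin \o f).
  apply: (@integrable_le _ _ _ (@leb3 R) _ measurableT f (fun y => M * `|k y|)) => //.
    by apply: integrableRZ => //; exact: integrable_norm.
  by move=> y _; rewrite /f normrM ler_wpM2r.
have ia := assoc_integrable if_.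
have E : (\int[leb3]_y (f y)%:E = \int[@sleb2 R]_x \int[lam]_t (f (t, x.1, x.2))%:E)%E.
  rewrite (leb3_integral_assoc (f := EFin \o f)); last exact/measurable_EFinP.
  exact: esym (integral21_prod_meas1 ia).
rewrite /Rintegral E; congr fine.
apply: ae_eq_integral => //.
- exact: (@measurable_fubini_G _ _ _ _ _ lam (@sleb2 R) _ ia).
- apply/measurable_EFinP; apply: measurable_funM; last exact: measurable_slice.
  exact: continuous_measurable2.
(* On almost every line k is integrable, so that psi, which is constant along the line, can be taken
   out of the integral. *)
have := @ae_integrable2 _ _ _ _ _ lam (@sleb2 R) _ (assoc_integrable ik).
apply: filterS => x ix _; rewrite /f /=.
under eq_integral do rewrite EFinM.
rewrite integralZl// EFinM; congr (_ * _)%E.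
  by case: (x).
by rewrite /slice /Rintegral fineK//; exact: integrable_fin_num.
Qed.

End Slices.

(** * A bump function of y1 *)

Section Bump.
Context {R : realType}.

Lemma bump_exists (r : R) : 0 < r -> exists Th : R3 R -> R, [/\ smooth Th,
  forall x z, Th (1, x, z) = 1,
  forall y, r <= `|y.1.1 - 1| -> Th y = 0 /\ partial 0 Th y = 0 &
  exists M, forall y, `|Th y| <= M /\ `|partial 0 Th y| <= M].
Proof.
(* This factor makes the bump equal to 1 on the wall, where both flat factors below are
   [flat 0 r]. *)
move=> r0; pose c : R := (flat 0 r * flat 0 r)^-1.
pose f1 (y : R3 R) := flat 0 (1 * coord3 0 y + (r - 1)).
pose f2 (y : R3 R) := flat 0 ((-1) * coord3 0 y + (1 + r)).
have s1 : smooth f1 by exact: smooth_flat.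
have s2 : smooth f2 by exact: smooth_flat.
have p1 y : partial 0 f1 y = flat 2 (1 * coord3 0 y + (r - 1)).
  have [_] := is_derive_coord 0 (is_derive_flat 0 (1 * coord3 0 y + (r - 1))).
  by rewrite /partial => ->; rewrite mul0r subr0 /= !mulr1.
have p2 y : partial 0 f2 y = - flat 2 ((-1) * coord3 0 y + (1 + r)).
  have [_] := is_derive_coord 0 (is_derive_flat 0 ((-1) * coord3 0 y + (1 + r))).
  by rewrite /partial => ->; rewrite mul0r subr0 /= mulr1 mulrN1.
pose Th y := cst c y * (f1 y * f2 y).
have sT : smooth Th by apply: smoothM; [exact: smooth_cst|exact: smoothM].
have pT y : partial 0 Th y = c * (f1 y * partial 0 f2 y + f2 y * partial 0 f1 y).
  rewrite partialM; last 2 first.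
  - exact: smooth_derivable (smooth_cst c).
  - exact: smooth_derivable (smoothM s1 s2).
  rewrite partialM; last 2 first.
  - exact: smooth_derivable.
  - exact: smooth_derivable.
  by rewrite /partial derive_cst mulr0 addr0.
have fr : flat 0 r != 0.
  by rewrite /flat r0 expr0 mul1r gt_eqF// expR_gt0.
exists Th; split => //.
- move=> x z; rewrite /Th /f1 /f2 /coord3 /= /c.
  rewrite (_ : 1 * 1 + (r - 1) = r); last by ring.
  rewrite (_ : -1 * 1 + (1 + r) = r); last by ring.
  by rewrite mulVf// mulf_neq0.
- move=> y ry.
  have [h|h] : 1 * coord3 0 y + (r - 1) <= 0 \/ (-1) * coord3 0 y + (1 + r) <= 0.
    by move: ry; rewrite /coord3 /= ler_normr => /orP[h|h]; [right|left]; lra.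
  + by rewrite pT /Th p1 p2 /f1 !(flat_neg _ h) !mul0r mulr0 add0r mulr0 mulr0.
  + by rewrite pT /Th p1 p2 /f2 !(flat_neg _ h) oppr0 !mulr0 mul0r addr0 mulr0.
(* Each of the two factors lies in [0, 1] and has a derivative of size at most 2!, so the product
   rule gives 4. *)
exists (`|c| * 4) => y.
have a1 : 0 <= f1 y <= 1 by rewrite flat_ge0 flat0_le1.
have a2 : 0 <= f2 y <= 1 by rewrite flat_ge0 flat0_le1.
have b1 : 0 <= partial 0 f1 y <= 2.
  by rewrite p1 flat_ge0; have := flat_bound 2 (1 * coord3 0 y + (r - 1)); rewrite !factS fact0.
have b2 : -2 <= partial 0 f2 y <= 0.
  by rewrite p2 oppr_le0 flat_ge0 andbT lerN2; have := flat_bound 2 (-1 * coord3 0 y + (1 + r)); rewrite !factS fact0.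
move: a1 a2 b1 b2; rewrite pT /Th.
move: (f1 y) (f2 y) (partial 0 f1 y) (partial 0 f2 y) => a b a' b' /andP[? ?] /andP[? ?] /andP[? ?] /andP[? ?].
rewrite !normrM; split; apply: ler_wpM2l => //.
  by rewrite -normrM ler_norml; apply/andP; split; nra.
by rewrite ler_norml; apply/andP; split; nra.
Qed.

End Bump.

Lemma L2M_bounded d (T : measurableType d) (R : realType) (m : {measure set T -> \bar R}) (D : set T)
    (f h : T -> R) M : measurable D -> L2 m D f -> measurable_fun D h ->
  (forall x, D x -> `|h x| <= M) -> L2 m D (fun x => f x * h x).
Proof.
move=> mD [mf f2] mh hM; split; first exact: measurable_funM.
apply: (@integrable_le _ _ _ _ _ mD _ (fun x => M ^+ 2 * f x ^+ 2)).
- by apply: measurable_funX; exact: measurable_funM.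
- exact: integrableRZ.
- move=> x Dx; rewrite ger0_norm ?sqr_ge0// exprMn mulrC ler_wpM2r ?sqr_ge0//.
  rewrite -[leLHS]real_normK ?num_real// lerXn2r ?nnegrE//; first exact: le_trans (hM x Dx).
  exact: hM.
Qed.

Lemma L2_restrict d (T : measurableType d) (R : realType) (m : {measure set T -> \bar R}) (D : set T)
    (f : T -> R) : measurable D -> L2 m D f -> L2 m setT (f \_ D).
Proof.
move=> mD [mf f2]; split; first exact: (measurable_restrictT f mD).1.
move: f2 => /(integrable_mkcond _ mD); apply: eq_integrable => // x _.
by rewrite !patchE; case: ifP => //=; rewrite expr0n.
Qed.

Section InteriorTrace.
Context {R : realType} (kappa : R).
Hypotheses (k0 : 0 < kappa) (k1 : kappa * 2 < 1) (hd : charts_diffeo kappa).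
Local Ltac klra := have ? := k0; have ? := k1; blra.
Local Notation D := (textile_cell kappa).
Local Notation M3 := (measurableTypeR R * measurableTypeR R * measurableTypeR R)%type.
Local Notation M2 := (measurableTypeR R * measurableTypeR R)%type.
Local Notation F := (lateral_face D).
Local Notation half := (half kappa).
Implicit Types (b : bool) (u : H1 D) (phi psi : R3 R -> R) (K : set (R3 R)).

Lemma near_side b (P : set R) (e : R) : nbhs (1 : R) P -> 0 < e -> exists t, [/\ P t, `|t - 1| < e & 0 < depth b t].
Proof.
move=> /nbhs_ballP[r /= r0 rP] e0.
pose s := Num.min r e / 2.
have m0 : 0 < Num.min r e by rewrite lt_min r0.
have [mr me] : Num.min r e <= r /\ Num.min r e <= e by rewrite !ge_min !lexx orbT.
have [s0 sr se] : [/\ 0 < s, s < r & s < e] by rewrite /s; split; lra.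
have E : `|1 + sg b * s - 1| = s.
  rewrite addrAC subrr add0r normrM (gtr0_norm s0) /sg; case: (b); rewrite ?normrN normr1 mul1r//.
exists (1 + sg b * s); split.
- by apply: rP; rewrite /ball /= distrC E.
- by rewrite E.
- by rewrite /depth addrAC subrr add0r mulrA sgsg mul1r.
Qed.

Lemma continuous_shear : continuous (fun z : R * R3 R => (z.1, z.2.1.2, z.2.2) : R3 R).
Proof.
apply: (@continuous_R3 _ _ (fun z : R * R3 R => z.1) (fun z => z.2.1.2) (fun z => z.2.2)) => z.
- exact: cvg_fst.
- apply: (continuous_comp (f := snd) (g := @coord3 R 1)); first exact: cvg_snd.
  exact: continuous_coord3.
- apply: (continuous_comp (f := snd) (g := @coord3 R 2)); first exact: cvg_snd.
  exact: continuous_coord3.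
Qed.

Definition straight (delta : R) := forall y t,
  D y -> `|y.1.1 - 1| < delta -> `|t - 1| < delta -> D (t, y.1.2, y.2).

(** Points of the cell close to y can be slid in the direction y1, by straightness, to either side
    of the wall. *)
Lemma closure_half delta b y : straight delta -> closure D y -> `|y.1.1 - 1| < delta ->
  closure (half b) (1, y.1.2, y.2).
Proof.
move=> sd cy yd B nB.
have d0 : 0 < delta by apply: le_lt_trans yd.
have := near_continuous (A := fun z : R * R3 R => (z.1, z.2.1.2, z.2.2) : R3 R) (s := (1, y)) (P := B) continuous_shear nB.
move=> [[P Q] /= [nP nQ] PQB].
have [t [Pt td t0]] := near_side b nP d0.
have yd' : 1 - delta < coord3 0 y < 1 + delta by move: yd; rewrite ltr_norml /coord3/= => ?; blra.
have [z [Dz [Qz zd]]] := cy _ (filterI nQ (near_coord3 yd')).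
exists (t, z.1.2, z.2); split; last by exact: (PQB (t, z)).
split => //; apply: sd => //.
by move: zd; rewrite /coord3/= ltr_norml => ?; blra.
Qed.

Lemma face_approach i side (x : R * R) (B : set (R3 R)) : nbhs (face_pt i side x) B ->
  exists t, 0 < t < 2 /\ B (if i == 0 then (t, x.1, x.2) else (x.1, t, x.2)).
Proof.
pose f t : R3 R := if i == 0 then (t, x.1, x.2) else (x.1, t, x.2).
set c : R := if side then 2 else 0.
have cf : continuous f.
  rewrite /f; case: (i == 0).
    apply: (@continuous_R3 _ _ id (fun=> x.1) (fun=> x.2)) => t; [exact: cvg_id|exact: cvg_cst|exact: cvg_cst].
  apply: (@continuous_R3 _ _ (fun=> x.1) id (fun=> x.2)) => t; [exact: cvg_cst|exact: cvg_id|exact: cvg_cst].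
rewrite (_ : face_pt i side x = f c) // => nB.
have := near_continuous (s := c) (P := B) cf nB.
move=> /nbhs_ballP[r /= r0 rP].
pose s := Num.min r 1 / 2.
have m0 : 0 < Num.min r 1 by rewrite lt_min r0 ltr01.
have [mr m1] : Num.min r 1 <= r /\ Num.min r 1 <= 1 by rewrite !ge_min !lexx orbT.
have [s0 sr s2] : [/\ 0 < s, s < r & s < 1] by rewrite /s; split; lra.
exists (c - (if side then s else - s)); split; first by rewrite /c; case: (side); blra.
apply: rP; rewrite /ball /= opprB addrC subrK; case: (side); rewrite ?normrN gtr0_norm//.
Qed.

Lemma lateral_face_bounds i side (x : R * R) : F i side x -> 0 < x.1 < 2 /\ `|x.2| < 1.
Proof.
rewrite /lateral_face /= => /face_approach[t [t02]].
have h0 z : D z -> [/\ 0 < z.1.1 < 2, 0 < z.1.2 < 2 & `|z.2| < 1].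
  by move=> /cell_bounds[? ? h']; split => //; rewrite ltr_norml; klra.
by elim/I2P: i; rewrite /= ?plane0 ?plane1 /coord3/= => /(_ t02) /h0[].
Qed.

Lemma closure_face i side (x : R * R) : F i side x -> closure D (face_pt i side x).
Proof.
move=> Fx B nB; have [t [t02]] := face_approach (filterI Fx nB).
move=> [Dt Bt]; eexists; split; last exact: Bt.
by apply: Dt; move: t02; elim/I2P: (i).
Qed.

Lemma face_finite i side : (leb2 (F i side) < +oo)%E.
Proof.
pose I : set (measurableTypeR R) := `[0, 2]%classic.
pose J : set (measurableTypeR R) := `[-1, 1]%classic.
have [mI mJ] : measurable I /\ measurable J by split; exact: measurable_itv.
have : (leb2 (I `*` J) < +oo)%E.
  have -> : leb2 (I `*` J) = (lebesgue_measure I * lebesgue_measure J)%E by exact: product_measure1E.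
  rewrite !lebesgue_measure_itv/= !lte_fin.
  by rewrite !ifT ?ltry//; lra.
apply: le_lt_trans; apply: le_measure; rewrite ?inE.
- exact: face_measurable.
- exact: measurableX.
- move=> x /lateral_face_bounds[h1]; rewrite ltr_norml => h2.
  by split; rewrite /I /J /= in_itv /=; blra.
Qed.

Let mD := @cell_measurable R kappa.
Let oD := @cell_open R kappa.
Let Doo := cell_finite k0 k1.

Definition wall : set (R * R) := [set x | D (1, x.1, x.2)].

Lemma wall_open : open wall.
Proof.
apply: (open_comp (f := fun x : R * R => (1, x.1, x.2) : R3 R)); last exact: oD.
move=> x _; apply: (@continuous_R3 _ _ (fun=> 1) (fun x => x.1) (fun x => x.2)) => x'; [exact: cvg_cst|exact: cvg_fst|exact: cvg_snd].
Qed.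

Lemma wall_measurable : measurable (wall : set M2).
Proof. exact: (open_measurable2 wall_open). Qed.

Lemma compact_wall_slab K (r : R) : compact K ->
  compact [set y : R3 R | `|y.1.1 - 1| <= r /\ K (1, y.1.2, y.2)].
Proof.
move=> cK.
have cimg := continuous_compact (continuous_subspaceT continuous_shear) (compact_setX (segment_compact (a := 1 - r) (b := 1 + r)) cK).
apply: (subclosed_compact _ cimg).
  rewrite (_ : [set y | _] = (fun y : R3 R => 1 * coord3 0 y + (-1)) @^-1` [set s : R | `|s| <= r] `&` diag3 (0, 1, 1) (1, 0, 0) @^-1` K).
    apply: closedI.
      apply: (continuous_closedP _).1; first exact: continuous_affine_coord.
      rewrite (_ : [set s | _] = `[- r, r]%classic); first exact: itv_closed.
      by apply/seteqP; split=> s; rewrite /= in_itv /= ler_norml.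
    apply: (continuous_closedP _).1; first exact: continuous_diag3.
    exact: compact_closed3.
  have E (y : R3 R) : diag3 (0, 1, 1) (1, 0, 0) y = (1, y.1.2, y.2) by congr (_, _, _); rewrite /=; ring.
  by apply/seteqP; split=> y; rewrite /= E /coord3 /= mul1r.
move=> y [yr Ky]; exists (y.1.1, (1, y.1.2, y.2)); last by case: (y) => [[]].
by split => //=; rewrite in_itv /=; move: yr; rewrite ler_norml => ?; blra.
Qed.

(** Formally u on the wall is the integral over y1 < 1 of the y1-derivative of u * Th, where Th is
    the bump; this defines g'. It serves both halves: psi frozen at the wall, times Th, is a test
    function supported inside the cell, so its integrals over the two halves are opposite. What
    remains of psi vanishes on the wall and falls under [half_green0]. *)
Lemma interior_trace u : exists g' : R * R -> R, L2 leb2 wall g' /\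
  forall g, is_trace 0 false u g -> is_trace 0 true u g ->
  forall b psi K, smooth psi -> compact K -> supported_in K psi ->
    K `&` closure (half b) `<=` D `|` face_pt 0 b @` F 0 b ->
    \int[leb3]_(y in half b) green_density u 0 psi y =
    sg b * (\int[leb2]_(x in F 0 b) (g x * psi (face_pt 0 b x)) -
            \int[leb2]_(x in wall) (g' x * psi (1, x.1, x.2))).
Proof.
have [delta [d01 sd]] := cell_straight k0 k1 hd.
have d0 : 0 < delta by blra.
(* Half the width, so that the closed support of the bump stays inside the straight region. *)
have [Th [sTh Th1 Th0 [M ThM]]] := @bump_exists R (delta / 2) (divr_gt0 d0 (ltr0Sn R 1)).
pose gd := green_density u 0 Th.
have Lgd : L2 leb3 D gd.
  apply: L2D => //; apply: (L2M_bounded (M := M)) => //; try exact: H1fun_L2; try exact: H1grad_L2.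
  - exact: continuous_measurable3 (smooth_continuous (smooth_partial 0 sTh)).
  - by move=> y _; have [] := ThM y.
  - exact: continuous_measurable3 (smooth_continuous sTh).
  - by move=> y _; have [] := ThM y.
have mhalf b : measurable (half b : set M3) by exact: half_measurable.
have Lgh : L2 leb3 (half false) gd.
  by have [m1 i1] := Lgd; split; [apply: measurable_funS m1|apply: integrableS i1] => // y [].
pose k := gd \_ (half false).
have [mk ik2] := L2_restrict (mhalf false) Lgh.
have igh : leb3.-integrable (half false) (EFin \o gd).
  have i1 : leb3.-integrable D (EFin \o (fun y => gd y * 1)).
    by apply: (L2_test_integrable oD Doo Lgd (phi := cst 1) (M := 1)) => y; [exact: cvg_cst|rewrite /= normr1].
  have i2 : leb3.-integrable D (EFin \o gd) by apply: eq_integrable i1 => // y _; rewrite /= mulr1.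
  by apply: integrableS i2 => // y [].
have ik : leb3.-integrable setT (EFin \o k) by rewrite /k -restrict_EFin; exact/(integrable_mkcond _ (mhalf false)).
have kN y : k y != 0 -> half false y /\ `|y.1.1 - 1| < delta / 2.
  rewrite /k patchE; case: ifPn => [/set_mem hy|]; last by rewrite eqxx.
  move=> gy; split => //; rewrite ltNge; apply: contra gy => /Th0[e1 e2].
  by rewrite /gd /green_density e1 e2 !mulr0 addr0.
have k01 y : ~ (0 < y.1.1 < 1) -> k y = 0.
  move=> h; apply/eqP; apply: contra_notT h => /kN[[/cell_bounds[h _ _]] h' _].
  by move: h'; rewrite /side_of /depth /sg /= => h'; blra.
have Ls := slice_L2 mk ik ik2 k01.
(* By straightness, a line on which k does not vanish identically meets the wall inside the cell. *)
have s0 x : ~ wall x -> slice k x = 0.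
  move=> nx; rewrite /slice /Rintegral integral0_eq// => t _.
  congr (_%:E); apply/eqP; apply: contra_notT nx => /kN[[Dt _]] /= td; rewrite /wall /=.
  by apply: (sd _ 1 Dt) => /=; [lra|rewrite subrr normr0].
exists (slice k); split.
  by have [m1 i1] := Ls; split; [apply: measurable_funS m1|apply: integrableS i1] => //; exact: wall_measurable.
move=> g tg0 tg1 b psi K sp cK sK KD.
have sE b' : is_trace 0 b' u g by case: b'.
(* The function psi frozen at its values on the wall. Its y1-derivative is zero, so it factors out
   of the Green density of the bump. *)
pose psi1 := psi \o diag3 (0, 1, 1) (1, 0, 0).
have p1E y : psi1 y = psi (1, y.1.2, y.2) by rewrite /psi1 /diag3 /=; congr (psi (_, _, _)); ring.
have sp1 : smooth psi1 by exact: smooth_monomial (monomial_diag3 _ _) sp.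
pose w y := psi1 y * Th y.
have sw : smooth w by exact: smoothM.
pose K1 := [set y : R3 R | `|y.1.1 - 1| <= delta / 2 /\ K (1, y.1.2, y.2)].
have cK1 : compact K1 by exact: compact_wall_slab.
have sK1 : supported_in K1 w.
  move=> y nK1; rewrite /w p1E; have [Ky|nK] := pselect (K (1, y.1.2, y.2)); last by rewrite sK// mul0r.
  have [yd|yd] := leP `|y.1.1 - 1| (delta / 2); first by exfalso; apply: nK1.
  by rewrite (Th0 y (ltW yd)).1 mulr0.
have K1D : K1 `&` closure D `<=` D.
  move=> y [[yd Ky] cy]; have yd' : `|y.1.1 - 1| < delta by lra.
  have [|h|[x _]] := KD (1, y.1.2, y.2) _; first by split => //; exact: (closure_half b sd cy).
    have := sd _ y.1.1 h; rewrite /= subrr normr0 => /(_ d0 yd'); by case: (y) => [[]].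
  by rewrite /face_pt /=; case: (b) => -[]; lra.
have gw y : green_density u 0 w y = psi1 y * gd y.
  rewrite /gd /green_density /w partialM; last 2 first.
  - exact: smooth_derivable.
  - exact: smooth_derivable.
  have -> : partial 0 psi1 y = 0 by rewrite /psi1 (partial_monomial _ _ (monomial_diag3 _ _) sp) /coord3 /= mul0r.
  by ring.
have iw := green_integrable oD Doo u 0 sw cK1 sK1.
have Iw0 : \int[leb3]_(y in half false) green_density u 0 w y = \int[leb2]_(x in wall) (slice k x * psi (1, x.1, x.2)).
  have [Mp hMp] := smooth_test_bounded sp cK sK.
  transitivity (\int[leb3]_y (psi (1, y.1.2, y.2) * k y)).
    rewrite Rintegral_mkcond; apply: eq_Rintegral => y _; rewrite /k !patchE.
    by case: ifP => _; rewrite ?mulr0// gw p1E.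
  rewrite (slice_integral mk ik (psi := fun x : R * R => psi (1, x.1, x.2)) (M := Mp)).
  - rewrite [RHS]Rintegral_mkcond; apply: eq_Rintegral => x _; rewrite patchE.
    by case: ifPn => [_|/negP nx]; rewrite mulrC// s0 ?mul0r// => hx; apply: nx; exact: mem_set.
  - move=> x; apply: (continuous_comp (f := fun x : R * R => (1, x.1, x.2) : R3 R) (g := psi)).
      apply: (@continuous_R3 _ _ (fun=> 1) (fun x => x.1) (fun x => x.2)) => x'; [exact: cvg_cst|exact: cvg_fst|exact: cvg_snd].
    exact: smooth_continuous.
  - by move=> x; have [] := hMp 0 (1, x.1, x.2).
have far b' x : Th (face_pt 0 b' x) = 0.
  apply: (Th0 (face_pt 0 b' x) _).1; rewrite /face_pt /=; case: b' => /=.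
    by rewrite ger0_norm; blra.
  by rewrite sub0r normrN normr1; blra.
have IwD : \int[leb3]_(y in D) green_density u 0 w y = 0.
  rewrite (traceE plane0 tg0 sw cK1 sK1); last by move=> y /K1D; left.
  rewrite [X in _ * X](_ : _ = 0) ?mulr0//.
  transitivity (\int[leb2]_(x in F 0 false) (0 : R)); last by rewrite Rintegral_cst ?mul0r//; exact: face_measurable.
  by apply: eq_Rintegral => x _; rewrite /w far !mulr0.
have Iw : \int[leb3]_(y in half b) green_density u 0 w y = - sg b * \int[leb2]_(x in wall) (slice k x * psi (1, x.1, x.2)).
  by move: IwD; rewrite (Rintegral_halves iw) Iw0 /sg; case: (b); rewrite ?Iw0; lra.
(* On the wall the bump is 1 and rho vanishes; on the faces y1 = 0 and y1 = 2 the bump is 0 and rho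
   equals psi. *)
pose rho y := psi y + cst (-1) y * w y.
have srho : smooth rho by apply: smoothD => //; apply: smoothM => //; exact: smooth_cst.
have cK2 : compact (K `|` K1) by exact: compactU.
have sK2 : supported_in (K `|` K1) rho.
  by move=> y nK; rewrite /rho sK ?sK1 ?mulr0 ?addr0// => h; apply: nK; [right|left].
have Irho := half_green0 k0 k1 face_finite (sE b) srho cK2 sK2.
have rE y : green_density u 0 psi y = green_density u 0 rho y + green_density u 0 w y.
  have -> : psi = fun y => rho y + w y by apply/funext => z; rewrite /rho /=; ring.
  rewrite /green_density /partial deriveD; last 2 first.
  - exact: smooth_derivable.
  - exact: smooth_derivable.
  by ring.
have hD : half b `<=` D by move=> y [].
have irho := integrableS mD (mhalf b) hD (green_integrable oD Doo u 0 srho cK2 sK2).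
have iwh := integrableS mD (mhalf b) hD iw.
transitivity (\int[leb3]_(y in half b) (green_density u 0 rho y + green_density u 0 w y)).
  by apply: eq_Rintegral => y _; exact: rE.
rewrite RintegralD// Iw Irho.
- rewrite mulrBr mulNr; congr (_ * _ - _); apply: eq_Rintegral => x _.
  by rewrite /rho /w far !mulr0 addr0.
- by move=> x z; rewrite /rho /w p1E Th1 /=; ring.
- move=> y [[Ky|K1y] cy]; first exact: KD.
  left; apply: K1D; split => // B nB; have [z [[Dz _] Bz]] := cy B nB; by exists z.
Qed.

End InteriorTrace.

(** * The seam map is a symmetry *)

Section SeamSymmetry.
Context {R : realType} (kappa : R).
Hypotheses (k0 : 0 < kappa) (k1 : kappa * 2 < 1) (hd : charts_diffeo kappa).
Local Ltac klra := have ? := k0; have ? := k1; blra.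
Local Notation D := (textile_cell kappa).
Local Notation M3 := (measurableTypeR R * measurableTypeR R * measurableTypeR R)%type.
Local Notation M2 := (measurableTypeR R * measurableTypeR R)%type.
Local Notation F := (lateral_face D).
Local Notation half := (half kappa).
Local Notation wall := (wall kappa).
Implicit Types (b : bool) (u : H1 D) (phi psi : R3 R -> R) (K : set (R3 R)).

Let mD := @cell_measurable R kappa.
Let oD := @cell_open R kappa.
Let Doo := cell_finite k0 k1.
Let mhalf b : measurable (half b : set M3) := @half_measurable R kappa b.
Let mF i side : measurable (F i side : set M2) := @face_measurable R kappa i side.

Definition seam_sign (i : 'I_3) : R := coord3 i (1, 1, -1).

(* [hop b] is the restriction of the seam map to [half kappa b], and [hop2 b] its
   trace on the faces y2 = 0 and y2 = 2. *)
Definition hop b : R3 R -> R3 R := shift1 (- sg b).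
Definition hop2 b (x : R * R) : R * R := (x.1 - sg b, - x.2).

Lemma hopK b : cancel (hop b) (hop (~~ b)).
Proof. by apply: shift1K; case: b; rewrite /sg /=; ring. Qed.

Lemma hop2K b : cancel (hop2 b) (hop2 (~~ b)).
Proof. by move=> [s t]; rewrite /hop2 /= opprK; congr (_, _); case: b; rewrite /sg /=; ring. Qed.

Lemma monomial_hop b : monomial_affine (hop b) id seam_sign.
Proof. by rewrite /hop shift1E; exact: monomial_diag3. Qed.

Lemma preserves_hop b : preserves (@leb3 R) (hop b).
Proof. exact: preserves_shift1. Qed.

Lemma preserves_hop2 b : preserves (@leb2 R) (hop2 b).
Proof.
apply: (@leb2_preserves R (fun x => x - sg b) (fun x => - x)); first exact: lebesgue_preserves_shift.
exact: lebesgue_preserves_opp.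
Qed.

Lemma hop_face1 b side x : hop b (face_pt 1 side x) = face_pt 1 side (hop2 b x).
Proof. by []. Qed.

Lemma hop_depth b (s : R) : depth (~~ b) (s - sg b) = 1 - depth b s.
Proof. by rewrite /depth /sg; case: b => /=; lra. Qed.

Lemma half_hop b y : half b y -> half (~~ b) (hop b y).
Proof.
move=> [Dy sy]; have lt1 := depth_lt1 b Dy; split.
  move: sy; rewrite side_ofE /hop /sg; case: (b) => /= h; first exact: cell_unshift.
  by rewrite opprK; exact: cell_shift.
by rewrite /side_of /= /hop /= hop_depth; lra.
Qed.

Lemma preimage_hop b : hop b @^-1` half (~~ b) = half b.
Proof.
apply/seteqP; split=> y; last exact: half_hop.
by move=> /half_hop; rewrite negbK hopK.
Qed.

Lemma closure_half_depth b y : closure (half b) y -> 0 <= depth b y.1.1 <= 1.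
Proof.
pose C := (fun y : R3 R => depth b y.1.1) @^-1` `[0, 1]%classic.
have cC : closed C by apply: (continuous_closedP _).1; [exact: continuous_depth|exact: itv_closed].
have CE z : C z = (0 <= depth b z.1.1 <= 1) by rewrite /C /= in_itv.
move=> cy; rewrite -CE; apply: cC => B nB; have [z [[Dz sz] Bz]] := cy B nB.
by exists z; split => //; rewrite CE; have := depth_lt1 b Dz; move: sz; rewrite /side_of /= => ? ?; blra.
Qed.

Lemma closure_half_hop b y : closure (half b) y -> closure (half (~~ b)) (hop b y).
Proof.
move=> cy B nB; have nB' := near_continuous (P := B) (@continuous_shift1 R (- sg b)) nB.
by have [z [hz Bz]] := cy _ nB'; exists (hop b z); split => //; exact: half_hop.
Qed.

Lemma closure_half_cell b y : closure (half b) y -> closure D y.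
Proof. by move=> cy B nB; have [z [[Dz _] Bz]] := cy B nB; exists z. Qed.

Lemma closure_cell_half b y : closure D y -> 0 < depth b y.1.1 -> closure (half b) y.
Proof.
move=> cy dy B nB.
have nS : nbhs y (side_of b) by apply: open_nbhs_nbhs; split => //; exact: side_of_open.
by have [z [Dz [Bz Sz]]] := cy _ (filterI nB nS); exists z.
Qed.

Lemma seam_half b y : half b y -> seam y = hop b y.
Proof.
move=> [/cell_bounds[h _ _]]; rewrite side_ofE /hop /sg; case: b => /= h'.
  by rewrite seamR//; blra.
by rewrite seamL ?opprK//; blra.
Qed.

Lemma seam_cell y : D y -> D (seam y).
Proof.
move=> Dy; have [h _ _] := cell_bounds Dy.
have [h'|h'|h'] := ltgtP y.1.1 1.
- have hy : half false y by split; rewrite // side_ofE.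
  by rewrite (seam_half hy); have [] := half_hop hy.
- have hy : half true y by split; rewrite // side_ofE.
  by rewrite (seam_half hy); have [] := half_hop hy.
- by rewrite /seam h' ltxx andbF.
Qed.

Lemma seam_symmetry : cell_symmetry D (@seam R) id seam_sign.
Proof.
split => //.
- exact: preserves_seam.
- by apply/seteqP; split=> y; [move=> /seam_cell; rewrite seamK|exact: seam_cell].
- exact: seamK.
- by split=> // i; rewrite /seam_sign; elim/I3P: i; rewrite /coord3 /=; ring.
Qed.

Lemma hop_test b phi K : smooth phi -> compact K -> supported_in K phi ->
  [/\ smooth (phi \o hop b), compact (hop b @^-1` K) & supported_in (hop b @^-1` K) (phi \o hop b)].
Proof.
move=> sphi cK sK; split.
- exact: smooth_monomial (monomial_hop b) sphi.
- rewrite (_ : _ @^-1` K = hop (~~ b) @` K).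
    by apply: continuous_compact => //; apply: continuous_subspaceT; exact: continuous_shift1.
  apply/seteqP; split=> [y Ky|_ [y Ky <-]]; first by exists (hop b y) => //; exact: hopK.
  by rewrite /= -{1}(negbK b) hopK.
- by move=> y nK; exact: sK.
Qed.

(** The wall being a null set, the change of variables is made half by half: on each half the seam
    map is a translation with reversal of y3 onto the other half. *)
Lemma seam_green c u j phi K : smooth phi -> compact K -> supported_in K phi ->
  \int[leb3]_(y in D) (c * u (seam y) * partial j phi y + c * (seam_sign j * H1grad u j (seam y)) * phi y) =
  c * seam_sign j * (\int[leb3]_(y in half false) green_density u j (phi \o hop false) y +
                     \int[leb3]_(y in half true) green_density u j (phi \o hop true) y).
Proof.
move=> sphi cK sK; have [M hM] := smooth_test_bounded sphi cK sK.
have [_ _ _ _ [e1 _]] := seam_symmetry.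
rewrite Rintegral_halves; last first.
  apply: (integrableRD mD).
    apply: (L2_test_integrable oD Doo _ (M := M)) => [||y]; last by have [] := hM j y.
      exact: (L2Z mD c (L2_comp_symmetry mD seam_symmetry (H1fun_L2 u))).
    exact: smooth_continuous (smooth_partial _ sphi).
  apply: (L2_test_integrable oD Doo _ (M := M)) => [||y]; last by have [] := hM j y.
    exact: (L2Z mD c (L2Z mD (seam_sign j) (L2_comp_symmetry mD seam_symmetry (H1grad_L2 u j)))).
  exact: smooth_continuous.
have E b : \int[leb3]_(y in half b) (c * u (seam y) * partial j phi y + c * (seam_sign j * H1grad u j (seam y)) * phi y) =
    c * seam_sign j * \int[leb3]_(y in half (~~ b)) green_density u j (phi \o hop (~~ b)) y.
  have [sT cT sKT] := hop_test (~~ b) sphi cK sK.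
  have ig : leb3.-integrable (half (~~ b)) (EFin \o green_density u j (phi \o hop (~~ b))).
    by apply: (integrableS mD (mhalf _)) (green_integrable oD Doo u j sT cT sKT) => y [].
  have mg : measurable_fun (half (~~ b)) (green_density u j (phi \o hop (~~ b))).
    by have /integrableP[/measurable_EFinP] := ig.
  rewrite -(preserves_Rintegral (preserves_hop b) (mhalf _) mg) preimage_hop -RintegralZl//; last first.
    by have := preserves_integrable (preserves_hop b) (mhalf _) ig; rewrite preimage_hop.
  apply: eq_Rintegral => y /set_mem hy.
  rewrite /green_density (partial_monomial _ _ (monomial_hop (~~ b)) sphi) /= hopK (seam_half hy).
  have := e1 j; move: (seam_sign j) => e ee.
  transitivity (c * u (hop b y) * ((e * e) * partial j phi y) + c * (e * H1grad u j (hop b y)) * phi y); last by ring.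
  by rewrite ee mul1r.
by rewrite !E /= -mulrDr addrC.
Qed.

(** Transports the condition on supports. The hop sends the outer face of its half to the wall and
    the wall to the opposite face; by [lateral_face0] these correspond as parts of the cell and of
    its faces. *)
Lemma hop_cover b side y : closure (half b) y -> (D `|` face_pt 0 side @` F 0 side) (hop b y) ->
  (D `|` face_pt 0 b @` F 0 b) y.
Proof.
(* From the closure of a half, the hop can reach only the face on the opposite side. *)
have key (b' s : bool) : 0 <= depth b' ((if s then 2 else 0 : R) - sg (~~ b')) <= 1 -> s = ~~ b'.
  rewrite /depth /sg; case: b'; case: s => //= /andP[h1 h2]; exfalso; lra.
move=> /[dup] /closure_half_depth dy cy [Dz|[x Fx xE]].
  have [e|ne] := eqVneq (depth b y.1.1) 1.
    right; exists (y.1.2, y.2).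
      rewrite lateral_face0// /=; move: Dz; rewrite /hop /shift1.
      have -> // : y.1.1 + - sg b = 1 by move: e; rewrite /depth /sg; case: (b); lra.
    have : y.1.1 = if b then 2 else 0 by move: e; rewrite /depth /sg; case: (b); lra.
    by rewrite /face_pt /= => <-; case: (y) => [[]].
  left; have hz : half (~~ b) (hop b y).
    split => //; rewrite /side_of /= hop_depth subr_gt0 lt_neqAle ne.
    by blra.
  by have := half_hop hz; rewrite negbK hopK => -[].
left; have yE : y = hop (~~ b) (face_pt 0 side x) by rewrite xE hopK.
have sE : side = ~~ b by apply: key; move: dy; rewrite yE.
move: Fx; rewrite lateral_face0// yE sE /hop /shift1 /face_pt /=.
have -> // : (if ~~ b then 2 else 0 : R) - sg (~~ b) = 1 by rewrite /sg; case: (b) => /=; lra.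
Qed.

Lemma hop_cell b y : 0 < depth b y.1.1 < 1 -> D (hop b y) -> D y.
Proof.
move=> dy Dz; have hz : half (~~ b) (hop b y).
  by split => //; rewrite /side_of /= hop_depth; blra.
by have := half_hop hz; rewrite negbK hopK => -[].
Qed.

(** The roles are exchanged: the wall trace g', with y3 reversed, becomes the common trace on the
    two faces, while the old face trace g now sits on the wall. The two halves see it there with
    opposite signs, and it cancels since periodicity provides one g for both faces. *)
Lemma seam_trace0 u : H1per0 u -> exists g : R * R -> R, (forall side, L2 leb2 (F 0 side) g) /\
  forall phi K, smooth phi -> compact K -> supported_in K phi ->
    K `&` closure D `<=` D `|` face_pt 0 false @` F 0 false `|` face_pt 0 true @` F 0 true ->
  \int[leb3]_(y in half false) green_density u 0 (phi \o hop false) y +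
  \int[leb3]_(y in half true) green_density u 0 (phi \o hop true) y =
  \int[leb2]_(x in F 0 true) (g x * phi (face_pt 0 true x)) -
  \int[leb2]_(x in F 0 false) (g x * phi (face_pt 0 false x)).
Proof.
move=> [/(_ 0)[g [tg0 tg1]] _].
have [g' [Lg' hg']] := interior_trace k0 k1 hd u.
pose N (x : R * R) : R * R := (x.1, - x.2).
have NK : involutive N by move=> [s t]; rewrite /N /= opprK.
have pN : preserves (@leb2 R) N.
  by apply: (@leb2_preserves R id (fun x => - x)); [exact: preserves_id|exact: lebesgue_preserves_opp].
have NF side : N @^-1` wall = F 0 side by rewrite lateral_face0.
have mW := @wall_measurable R kappa.
exists (g' \o N); split=> [side|phi K sphi cK sK KD].
  rewrite -(NF side); have [m1 i1] := Lg'; split; last exact: (preserves_integrable pN mW i1).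
  apply: (measurable_comp mW _ m1); last exact: measurable_funTS pN.1.
  by move=> _ [x ? <-].
have H b : \int[leb3]_(y in half b) green_density u 0 (phi \o hop b) y =
    sg b * (\int[leb2]_(x in wall) (g (N x) * phi (1, x.1, x.2)) -
            \int[leb2]_(x in F 0 (~~ b)) (g' (N x) * phi (face_pt 0 (~~ b) x))).
  have [sT cT sKT] := hop_test b sphi cK sK.
  have [M hM] := smooth_test_bounded sphi cK sK.
  rewrite (hg' g tg0 tg1 b _ _ sT cT sKT); last first.
    move=> y [Ky cy].
    have cz := closure_half_cell (closure_half_hop cy).
    by have [[Dz|Fz]|Fz] := KD _ (conj Ky cz);
      [apply: (hop_cover (side := b) cy); left|apply: (hop_cover cy); right; exact: Fz|apply: (hop_cover cy); right; exact: Fz].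
  have cw s : continuous (fun x : R * R => phi (s, x.1, x.2)).
    move=> x; apply: (continuous_comp (f := fun x : R * R => (s, x.1, x.2) : R3 R) (g := phi)).
      apply: (@continuous_R3 _ _ (fun=> s) (fun x => x.1) (fun x => x.2)) => x'; [exact: cvg_cst|exact: cvg_fst|exact: cvg_snd].
    exact: smooth_continuous.
  congr (_ * (_ - _)).
    have mh : measurable_fun (F 0 b) (fun x => g x * phi (1, x.1, - x.2)).
      have [mg _] : L2 leb2 (F 0 b) g by case: (b); [exact: tg1.1|exact: tg0.1].
      apply: measurable_funM => //; apply: measurable_funTS.
      exact: (measurableT_comp (continuous_measurable2 (cw 1)) pN.1).
    transitivity (\int[leb2]_(x in F 0 b) (g x * phi (1, x.1, - x.2))).
      apply: eq_Rintegral => x _; congr (_ * phi (_, _, _)).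
      by rewrite /face_pt /= /sg; case: (b) => /=; lra.
    rewrite -(preserves_Rintegral pN (mF 0 b) mh).
    have -> : N @^-1` F 0 b = wall by apply/seteqP; split=> x; rewrite -(NF b) /= NK.
    by apply: eq_Rintegral => x _; rewrite /N /= opprK.
  have mh : measurable_fun wall (fun x => g' x * (phi \o hop b) (1, x.1, x.2)).
    apply: measurable_funM; first exact: Lg'.1.
    apply: continuous_measurable2 => x; apply: (continuous_comp (f := fun x : R * R => (1, x.1, x.2) : R3 R) (g := phi \o hop b)).
      apply: (@continuous_R3 _ _ (fun=> 1) (fun x => x.1) (fun x => x.2)) => x'; [exact: cvg_cst|exact: cvg_fst|exact: cvg_snd].
    exact: smooth_continuous.
  rewrite -(preserves_Rintegral pN mW mh) (NF (~~ b)).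
  apply: eq_Rintegral => x _; congr (_ * _); rewrite /= /hop /shift1 /N /face_pt /= opprK; congr (phi (_, _, _)).
  by rewrite /sg; case: (b) => /=; lra.
by rewrite !H /sg /=; lra.
Qed.

Lemma seam_face1 b side x : 0 < depth b x.1 -> F 1 side x -> F 1 side (hop2 b x).
Proof.
rewrite /hop2 /depth /sg; case: b => h Fx.
  by have := lateral_face_unshift k0 k1 hd Fx; apply; lra.
by rewrite opprK; have := lateral_face_shift k0 k1 hd Fx; apply; lra.
Qed.

(** The seam map on a face y2 = 0 or y2 = 2, in the coordinates (y1, y3); the two bands are the
    traces of the two halves. *)
Definition seam2 (x : R * R) : R * R :=
  if 0 < depth false x.1 < 1 then hop2 false x else
  if 0 < depth true x.1 < 1 then hop2 true x else x.

Let A b : set (R * R) := [set x | 0 < depth b x.1 < 1].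

Lemma band_open b : open (A b).
Proof.
have cd : continuous (fun x : R * R => depth b x.1).
  have -> : (fun x : R * R => depth b x.1) = (fun y : R3 R => depth b y.1.1) \o (fun x : R * R => (x.1, 0, 0) : R3 R) by [].
  move=> x; apply: continuous_comp; last exact: continuous_depth.
  apply: (@continuous_R3 _ _ (fun x => x.1) (fun=> 0) (fun=> 0)) => x'; [exact: cvg_fst|exact: cvg_cst|exact: cvg_cst].
rewrite openE => x h; exact: (near_continuous cd (near_itv h)).
Qed.

Lemma band_measurable b : measurable (A b : set M2).
Proof. exact: open_measurable2 (@band_open b). Qed.

Lemma band_hop b x : A b x -> A (~~ b) (hop2 b x).
Proof. by rewrite /A /= hop_depth => h; blra. Qed.

Lemma band_disjoint x : A false x -> A true x -> False.
Proof. by rewrite /A /depth /sg /= => ? ?; blra. Qed.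

Lemma seam2_band b x : A b x -> seam2 x = hop2 b x.
Proof.
rewrite /seam2; case: b => h; last by rewrite ifT.
by rewrite ifF ?ifT//; apply/negP => h'; exact: (@band_disjoint x).
Qed.

Lemma preimage_hop2 b : hop2 b @^-1` A (~~ b) = A b.
Proof. by apply/seteqP; split=> x; [move=> /band_hop; rewrite negbK hop2K|exact: band_hop]. Qed.

Lemma preserves_seam2 : preserves (@leb2 R) seam2.
Proof.
have := @preserves_exchange R _ _ (@leb2 R) (hop2 false) (hop2 true) (A false) (A true)
  (preserves_hop2 false) (preserves_hop2 true) (band_measurable false) (band_measurable true).
rewrite (_ : (fun x => _) = seam2).
  apply; [|exact: preimage_hop2|exact: preimage_hop2].
  by apply/seteqP; split=> x // -[]; exact: band_disjoint.
apply/funext => x; rewrite /seam2.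
have E b : (x \in A b) = (0 < depth b x.1 < 1) by apply/idP/idP => [/set_mem|h] //; exact: mem_set.
by rewrite !E.
Qed.

Lemma seam2K : involutive seam2.
Proof.
move=> x; have [h|h] := pselect (A false x).
  by rewrite (seam2_band h) (seam2_band (band_hop h)) hop2K.
have [h'|h'] := pselect (A true x).
  by rewrite (seam2_band h') (seam2_band (band_hop h')) hop2K.
have E : seam2 x = x by rewrite /seam2; case: ifP => // _; case: ifP.
by rewrite !E.
Qed.

Lemma seam2_face side : seam2 @^-1` F 1 side = F 1 side.
Proof.
have h x : F 1 side x -> F 1 side (seam2 x).
  move=> Fx; rewrite /seam2; case: ifPn => [/andP[h _]|_]; first exact: seam_face1.
  by case: ifPn => [/andP[h _]|_] //; exact: seam_face1.
by apply/seteqP; split=> x; [move=> /h; rewrite seam2K|exact: h].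
Qed.

Lemma Rintegral_bands side f : leb2.-integrable (F 1 side) (EFin \o f) ->
  \int[leb2]_(x in F 1 side) f x = \int[leb2]_(x in F 1 side `&` A false) f x + \int[leb2]_(x in F 1 side `&` A true) f x.
Proof.
have [N0 mN] := @line_null R; move=> intf.
apply: (Rintegral_split (mF _ _) (band_measurable false) (band_measurable true) mN N0) => //.
- by apply/seteqP; split=> x // -[]; exact: band_disjoint.
- move=> x /(lateral_face_bounds k0 k1)[h _]; have [h'|h'|h'] := ltgtP x.1 1; [left; left|left; right|right] => //;
    by rewrite /A /depth /sg /=; blra.
- by move=> x /= e; rewrite /A /depth /= e subrr mulr0 ltxx.
- by move=> x /= e; rewrite /A /depth /= e subrr mulr0 ltxx.
Qed.

(** Inside a face y2 = 0 or y2 = 2 the wall is a line of measure zero, so the formulas of the two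
    halves are simply added. *)
Lemma seam_trace1 u side g phi K : is_trace 1 side u g ->
  smooth phi -> compact K -> supported_in K phi ->
  K `&` closure D `<=` D `|` face_pt 1 side @` F 1 side ->
  \int[leb3]_(y in half false) green_density u 1 (phi \o hop false) y +
  \int[leb3]_(y in half true) green_density u 1 (phi \o hop true) y =
  sg side * \int[leb2]_(x in F 1 side) (g (seam2 x) * phi (face_pt 1 side x)).
Proof.
move=> tg sphi cK sK KD.
have ig : leb2.-integrable (F 1 side) (EFin \o (fun x => g (seam2 x) * phi (face_pt 1 side x))).
  apply: (face_integrable _ _ sphi cK sK); first exact: face_finite.
  have [m1 i1] := tg.1; rewrite -seam2_face; split; last exact: (preserves_integrable preserves_seam2 (mF _ _) i1).
  apply: (measurable_comp (mF 1 side) _ m1); last exact: measurable_funTS preserves_seam2.1.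
  by move=> _ [x ? <-].
rewrite Rintegral_bands//.
have H b : \int[leb3]_(y in half b) green_density u 1 (phi \o hop b) y =
    sg side * \int[leb2]_(x in F 1 side `&` A (~~ b)) (g (seam2 x) * phi (face_pt 1 side x)).
  have [sT cT sKT] := hop_test b sphi cK sK.
  rewrite (half_green1 k0 k1 (face_finite k0 k1) tg sT cT sKT) => [|y Ky cy dy].
    congr (_ * _).
    have mh : measurable_fun (F 1 side `&` A b) (fun x => g x * phi (face_pt 1 side (hop2 b x))).
      apply: measurable_funM; first by apply: measurable_funS tg.1.1; [exact: mF|move=> x []].
      have cf : continuous (fun x => phi (face_pt 1 side x)).
        by move=> x; apply: continuous_comp; [exact: continuous_face_pt|exact: smooth_continuous].
      exact: measurable_funTS (measurableT_comp (continuous_measurable2 cf) (preserves_hop2 b).1).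
    have mFA : measurable (F 1 side `&` A b : set M2) by apply: measurableI; [exact: mF|exact: band_measurable].
    transitivity (\int[leb2]_(x in F 1 side `&` A b) (g x * phi (face_pt 1 side (hop2 b x)))); first by [].
    rewrite -(preserves_Rintegral (preserves_hop2 (~~ b)) mFA mh).
    have -> : hop2 (~~ b) @^-1` (F 1 side `&` A b) = F 1 side `&` A (~~ b).
      apply/seteqP; split=> x /= [Fx Ax].
        have := band_hop Ax; rewrite -{2}(negbK b) hop2K => Ax'; split => //.
        have := seam_face1 (b := b) _ Fx; rewrite -{3}(negbK b) hop2K; apply.
        by move: Ax => /andP[].
      split; first by apply: seam_face1 Fx; move: Ax => /andP[].
      by have := band_hop Ax; rewrite negbK.
    apply: eq_Rintegral => x /set_mem[_ Ax]; rewrite (seam2_band Ax).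
    by have := @hop2K (~~ b) x; rewrite negbK => ->.
  have cz := closure_half_cell (closure_half_hop (closure_cell_half cy (andP dy).1)).
  have [Dz|[x Fx xE]] := KD _ (conj Ky cz); first by left; exact: hop_cell Dz.
  right; exists (hop2 (~~ b) x); last by rewrite -hop_face1 xE hopK.
  apply: seam_face1 Fx.
  have -> : x.1 = y.1.1 - sg b by have := congr1 (fun z : R3 R => z.1.1) xE.
  by rewrite hop_depth; blra.
by rewrite !H /= -mulrDr addrC.
Qed.

(** Only the derivative in y1 crosses the wall, and there the periodicity of u is used through
    [seam_trace0]. In the other directions each half contributes zero. *)
Lemma seam_weak c u i : H1per0 u ->
  weak_partial D i (fun y => c * u (seam y)) (fun y => c * (seam_sign i * H1grad u i (seam y))).
Proof.
move=> pu; apply: (weak_partial_green oD Doo).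
- exact: (L2Z mD c (L2_comp_symmetry mD seam_symmetry (H1fun_L2 u))).
- exact: (L2Z mD c (L2Z mD (seam_sign i) (L2_comp_symmetry mD seam_symmetry (H1grad_L2 u i)))).
move=> phi K sphi cK KD sK; rewrite (seam_green _ _ _ sphi cK sK).
have j0 j : j != 0 -> \int[leb3]_(y in half false) green_density u j (phi \o hop false) y +
  \int[leb3]_(y in half true) green_density u j (phi \o hop true) y = 0.
  move=> jn.
  have H b : \int[leb3]_(y in half b) green_density u j (phi \o hop b) y = 0.
    have [sT cT sKT] := hop_test b sphi cK sK.
    apply: (half_green_test k0 k1 u (b := b) jn sT cT sKT) => y Ky dy.
    by apply: hop_cell dy _; exact: KD.
  by rewrite !H addr0.
rewrite [X in _ * X](_ : _ = 0) ?mulr0//.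
elim/I3P: i => [||]; [|exact: j0|exact: j0].
have [g [_ hg]] := seam_trace0 pu; rewrite (hg _ _ sphi cK sK).
- have H side : \int[leb2]_(x in F 0 side) (g x * phi (face_pt 0 side x)) = 0.
    transitivity (\int[leb2]_(x in F 0 side) (0 : R)); last by rewrite Rintegral_cst ?mul0r//; exact: mF.
    apply: eq_Rintegral => x _; rewrite sK ?mulr0// => /KD /cell_bounds[h _ _].
    by move: h; rewrite /face_pt /=; case: (side); rewrite ltxx ?andbF.
  by rewrite !H subrr.
- by move=> y [/KD Dy _]; left; left.
Qed.

Lemma seam_pulls_back : pulls_back D (@seam R) id seam_sign.
Proof.
move=> c u pu; have [v [vE gE]] := pull_back_H1 oD seam_symmetry (fun i => seam_weak c i pu).
exists v; split; last by move=> i y; rewrite gE.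
split; last by rewrite vE; apply: (pull_back_mean oD Doo seam_symmetry); exact: pu.2.
apply: I2P.
  have [g [Lg hg]] := seam_trace0 pu; exists (fun x => c * g x).
  have H side : is_trace 0 side v (fun x => c * g x).
    split=> [|phi K sphi cK sK KD]; first exact: (L2Z (mF _ _) c (Lg side)).
    rewrite vE gE plane0 (seam_green _ _ _ sphi cK sK) (hg _ _ sphi cK sK); last first.
      by move=> y /KD[Dy|Fy]; [left; left|case: (side) Fy => Fy; [right|left; right]].
    (* On the closure of the cell, phi is supported in the cell and the face [side], hence it
       vanishes on the opposite face. *)
    have Z : \int[leb2]_(x in F 0 (~~ side)) (g x * phi (face_pt 0 (~~ side) x)) = 0.
      transitivity (\int[leb2]_(x in F 0 (~~ side)) (0 : R)); last by rewrite Rintegral_cst ?mul0r//; exact: mF.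
      apply: eq_Rintegral => x /set_mem Fx; rewrite sK ?mulr0// => Kx.
      have [/cell_bounds[h _ _]|[x' _]] := KD _ (conj Kx (@closure_face _ _ _ _ _ Fx)).
        by move: h; rewrite /face_pt /=; case: (side); rewrite /= ltxx ?andbF.
      move=> /(congr1 (fun z : R3 R => z.1.1)); rewrite /face_pt /=.
      by case: (side) => /= /eqP; rewrite ?(eq_sym 0) pnatr_eq0.
    have ig := face_integrable (face_finite k0 k1) (Lg side) sphi cK sK.
    under [in RHS]eq_Rintegral do rewrite -mulrA.
    rewrite RintegralZl//.
    by move: Z; rewrite /seam_sign /coord3 /=; case: (side) => /= ->; ring.
  by split.
have [g [tg0 tg1]] := pu.1 1; exists (fun x => c * g (seam2 x)).
have H side : is_trace 1 side v (fun x => c * g (seam2 x)).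
  have tg : is_trace 1 side u g by case: side.
  have Lg : L2 leb2 (F 1 side) (g \o seam2).
    have [m1 i1] := tg.1; rewrite -seam2_face; split; last exact: (preserves_integrable preserves_seam2 (mF _ _) i1).
    apply: (measurable_comp (mF 1 side) _ m1); last exact: measurable_funTS preserves_seam2.1.
    by move=> _ [x ? <-].
  split=> [|phi K sphi cK sK KD]; first exact: (L2Z (mF _ _) c Lg).
  rewrite vE gE plane1 (seam_green _ _ _ sphi cK sK) (seam_trace1 tg sphi cK sK KD).
  have ig := face_integrable (face_finite k0 k1) Lg sphi cK sK.
  under [in RHS]eq_Rintegral do rewrite -mulrA.
  rewrite RintegralZl//.
  have -> : seam_sign 1 = 1 by [].
  by rewrite mulr1 mulrCA.
by split.
Qed.

End SeamSymmetry.

(** * The homogenized coefficients *)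

Section CellSymmetries.
Context {R : realType} (kappa : R).
Hypotheses (k0 : 0 < kappa) (k1 : kappa * 2 < 1).
Local Notation D := (textile_cell kappa).
Let oD := @cell_open R kappa.
Let Doo := cell_finite k0 k1.
Let Foo := face_finite k0 k1.

Definition reflect_sign (i : 'I_3) : R := coord3 i (-1, 1, 1).
Definition swap_sign (i : 'I_3) : R := coord3 i (1, 1, -1).
Definition swap_index (i : 'I_3) : 'I_3 := if i == 0 then 1 else if i == 1 then 0 else i.

Lemma lebesgue_preserves_reflect : preserves (@lebesgue_measure R) (fun s => 2 - s).
Proof.
have := preserves_comp (@lebesgue_preserves_shift R 2) (@lebesgue_preserves_opp R).
by congr preserves; apply/funext => s /=; rewrite addrC.
Qed.

Lemma reflect_symmetry : cell_symmetry D (@reflect1 R) id reflect_sign.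
Proof.
split => //.
- apply: (@leb3_preserves R (fun x => (2 - x.1, x.2)) id); last exact: preserves_id.
  apply: (@leb2_preserves R (fun s => 2 - s) id); last exact: preserves_id.
  exact: lebesgue_preserves_reflect.
- apply/seteqP; split=> y; last exact: cell_reflect.
  by move=> /= /(cell_reflect k0 k1); rewrite reflect1K.
- exact: reflect1K.
- by split=> // i; rewrite /reflect_sign; elim/I3P: i; rewrite /coord3 /=; ring.
Qed.

Lemma reflect_pulls_back : pulls_back D (@reflect1 R) id reflect_sign.
Proof.
(* The two faces orthogonal to y1 are exchanged pointwise; each face orthogonal to y2 is reflected
   into itself. *)
refine (@affine_pulls_back R D oD Doo reflect1 id reflect_sign reflect_symmetry _ id
  (fun i => i == 0) (fun i x => if i == 0 then x else (2 - x.1, x.2)) _ _ _ _ _ _ Foo) => //.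
- by rewrite reflect1E; exact: monomial_diag3.
- by move=> i; case: (i == 0) => // -[s t]; rewrite /= opprB addrC subrK.
- move=> i; case: (i == 0); first exact: preserves_id.
  apply: (@leb2_preserves R (fun s => 2 - s) id); last exact: preserves_id.
  exact: lebesgue_preserves_reflect.
- move=> i side x; elim/I2P: i; rewrite /reflect1 /face_pt //=.
  by case: side; rewrite /= ?subrr ?subr0.
- by move=> i z; elim/I2P: i; rewrite ?plane0 ?plane1 /coord3 /reflect1 //= => ?; blra.
- by move=> i; elim/I2P: i; rewrite ?plane0 ?plane1 /reflect_sign /coord3 /=.
Qed.

Lemma swap_indexK : involutive swap_index.
Proof. by move=> i; elim/I3P: i. Qed.

Lemma swap_symmetry : cell_symmetry D (@swap3 R) swap_index swap_sign.
Proof.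
split.
- apply: (@leb3_preserves R (fun x => (x.2, x.1)) (fun s => - s)); last exact: lebesgue_preserves_opp.
  exact: leb2_preserves_swap.
- apply/seteqP; split=> y; last exact: cell_swap.
  by move=> /cell_swap; rewrite swap3K.
- exact: swap3K.
- exact: swap_indexK.
- by split=> i; rewrite /swap_sign; elim/I3P: i; rewrite /coord3 /=; ring.
Qed.

Lemma swap_pulls_back : pulls_back D (@swap3 R) swap_index swap_sign.
Proof.
pose s (i : 'I_2) : 'I_2 := if i == 0 then 1 else 0.
refine (@affine_pulls_back R D oD Doo (@swap3 R) swap_index swap_sign swap_symmetry _ s
  (fun=> false) (fun=> fun x => (x.1, - x.2)) _ _ _ _ _ _ Foo) => //.
- split; first exact: continuous_swap3.
  move=> i h y; rewrite /swap3; elim/I3P: i; congr (_, _, _);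
    rewrite /= /swap_sign /coord3 /= /GRing.scale /=; ring.
- by move=> i; elim/I2P: i; apply: val_inj.
- by move=> i [a b]; rewrite /= opprK.
- move=> i; apply: (@leb2_preserves R id (fun s => - s)); first exact: preserves_id.
  exact: lebesgue_preserves_opp.
- by move=> i side x; elim/I2P: i.
- by move=> i z; elim/I2P: i; rewrite ?plane0 ?plane1 /coord3 /swap3.
- by move=> i; elim/I2P: i; rewrite ?plane0 ?plane1 /swap_sign /coord3 /=.
Qed.

Lemma membrane_L2 al be : L2field D (membrane (R := R) al be).
Proof.
move=> i j; apply: (@L2_continuous _ _ oD Doo _ `|Mstrain al be i j|) => y //.
exact: cvg_cst.
Qed.

Lemma bending_L2 al be : L2field D (bending (R := R) al be).
Proof.
move=> i j.
have L : L2 leb3 D (@coord3 R 2).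
  apply: (L2_bounded (@cell_measurable R kappa) (M := 1) Doo).
    exact: continuous_measurable3 (@continuous_coord3 R 2).
  move=> y /cell_bounds[_ _ h]; rewrite /coord3 /= ler_norml; have ? := k0; have ? := k1; blra.
have := L2Z (@cell_measurable R kappa) (- Mstrain al be i j) L.
by congr L2; apply/funext => y; rewrite /bending [in RHS]mxE; ring.
Qed.

End CellSymmetries.

Section Action.
Context {R : realType}.

Lemma actZ (pi : 'I_3 -> 'I_3) (eps : 'I_3 -> R) c S : act pi eps (c *: S) = c *: act pi eps S.
Proof. by apply/matrixP => i j; rewrite !mxE; ring. Qed.

(** The nonzero entries sit at (al, be) and (be, al), where the products of signs agree. *)
Lemma act_diag (eps : 'I_3 -> R) al be : act id eps (Mstrain al be) =
  (eps (plane al) * eps (plane be)) *: Mstrain al be.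
Proof.
apply/matrixP => i j; rewrite !mxE.
have [/andP[/eqP -> /eqP ->]|n1] := boolP ((i == plane al) && (j == plane be)) => //.
have [/andP[/eqP -> /eqP ->]|n2] := boolP ((i == plane be) && (j == plane al)) => /=; first by ring.
by ring.
Qed.

Lemma act_seam al be : act id (@seam_sign R) (Mstrain al be) = Mstrain al be.
Proof.
have p (g : 'I_2) : seam_sign (plane g) = 1 :> R by elim/I2P: g; rewrite ?plane0 ?plane1.
by rewrite act_diag !p mul1r scale1r.
Qed.

Lemma act_swap : act swap_index (@swap_sign R) (Mstrain 1 1) = Mstrain 0 0.
Proof.
apply/matrixP => i j; rewrite !mxE !plane0 !plane1.
by elim/I3P: i; elim/I3P: j; rewrite /swap_index /swap_sign /coord3 /=; ring.
Qed.

End Action.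

Theorem lemma6p9 (R : realType) (kappa lambda mu : R)
  (hkappa : 0 < kappa < 2^-1)
  (hdiffeo : charts_diffeo kappa)
  (hpos : positive_definite (isotropic lambda mu))
  (chim chib : 'I_2 -> 'I_2 -> 'I_3 -> H1 (textile_cell kappa))
  (hchim : forall al be,
     corrector (isotropic lambda mu) (membrane al be) (chim al be))
  (hchib : forall al be,
     corrector (isotropic lambda mu) (bending al be) (chib al be)) :
  let a := ahom (isotropic lambda mu) chim in
  let b := bhom (isotropic lambda mu) chib in
  let c := chom (isotropic lambda mu) chib in
  (forall al be al' be', b al be al' be' = 0) /\
  [/\ a 0 0 0 0 = a 1 1 1 1,
      forall al, a al al 0 1 = 0,
      c 0 0 0 0 = c 1 1 1 1 &
      forall al, c al al 0 1 = 0].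
Proof.
have [k0 k1] : 0 < kappa /\ kappa * 2 < 1 by split; blra.
have mD := @cell_measurable R kappa.
have Lm := membrane_L2 k0 k1; have Lb := bending_L2 k0 k1.
have z0 : leb3 (set0 : set (measurableTypeR R * measurableTypeR R * measurableTypeR R)) = 0%E by exact: measure0.
have m0 := @measurable0 _ (measurableTypeR R * measurableTypeR R * measurableTypeR R)%type.
have [N0 mN] := @wall_null R.
have opp0 (t : R) : t = - t -> t = 0 by lra.
have rs (al : 'I_2) : reflect_sign (plane al) * reflect_sign (plane al) = 1 :> R.
  by elim/I2P: al; rewrite ?plane0 ?plane1 /reflect_sign /coord3 /=; ring.
have r01 : reflect_sign (plane 0) * reflect_sign (plane 1) = -1 :> R.
  by rewrite plane0 plane1 /reflect_sign /coord3 /= mulr1.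
have rsym := reflect_symmetry k0 k1; have rpull := reflect_pulls_back k0 k1.
have ssym := swap_symmetry kappa; have spull := swap_pulls_back k0 k1.
move=> a b c; split=> [al be al' be'|].
  apply: opp0; rewrite {1}/b /bhom (hom_coef_symmetry mD (seam_symmetry k0 k1 hdiffeo) (seam_pulls_back k0 k1 hdiffeo) mN N0
    (F0 := bending al be) (G0 := membrane al' be') (cF := -1) (cG := 1) (Lb al be) (Lb al be) (Lm al' be') (Lm al' be') _ _
    (hchib al be) (hchib al be) (hchim al' be')); first by rewrite mulr1 mulN1r.
    move=> y /cell_bounds[h _ _] /eqP ny.
    have -> : bending al be (seam y) = (-1) *: bending al be y.
      rewrite /bending scalerA; congr (_ *: _); have [y1|y1|y1] := ltgtP y.1.1 1.
      - by rewrite seamL; [rewrite /coord3 /shift1 /=; ring|blra].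
      - by rewrite seamR; [rewrite /coord3 /shift1 /=; ring|blra].
      - by rewrite y1 eqxx in ny.
    by rewrite actZ /bending actZ act_seam.
  by move=> y _ _; rewrite /membrane act_seam scale1r.
split=> [|al||al].
- rewrite /a /ahom [RHS](hom_coef_symmetry mD ssym spull m0 z0
    (F0 := membrane 0 0) (G0 := membrane 0 0) (cF := 1) (cG := 1) (Lm 1 1) (Lm 0 0) (Lm 1 1) (Lm 0 0) _ _
    (hchim 1 1) (hchim 0 0) (hchim 0 0)); first by rewrite !mul1r.
    by move=> y _ _; rewrite /membrane act_swap scale1r.
  by move=> y _ _; rewrite /membrane act_swap scale1r.
- apply: opp0; rewrite {1}/a /ahom (hom_coef_symmetry mD rsym rpull m0 z0
    (F0 := membrane al al) (G0 := membrane 0 1) (cF := 1) (cG := -1) (Lm al al) (Lm al al) (Lm 0 1) (Lm 0 1) _ _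
    (hchim al al) (hchim al al) (hchim 0 1)); first by rewrite mul1r mulN1r.
    by move=> y _ _; rewrite /membrane act_diag rs.
  by move=> y _ _; rewrite /membrane act_diag r01.
(* The exchange of the families reverses y3, so each bending strain acquires a factor -1, and the
   two factors cancel. *)
- rewrite /c /chom [RHS](hom_coef_symmetry mD ssym spull m0 z0
    (F0 := bending 0 0) (G0 := bending 0 0) (cF := -1) (cG := -1) (Lb 1 1) (Lb 0 0) (Lb 1 1) (Lb 0 0) _ _
    (hchib 1 1) (hchib 0 0) (hchib 0 0)); first by rewrite mulrNN !mul1r.
    by move=> y _ _; rewrite /bending actZ act_swap [RHS]scalerA mulN1r.
  by move=> y _ _; rewrite /bending actZ act_swap [RHS]scalerA mulN1r.
- apply: opp0; rewrite {1}/c /chom (hom_coef_symmetry mD rsym rpull m0 z0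
    (F0 := bending al al) (G0 := bending 0 1) (cF := 1) (cG := -1) (Lb al al) (Lb al al) (Lb 0 1) (Lb 0 1) _ _
    (hchib al al) (hchib al al) (hchib 0 1)); first by rewrite mul1r mulN1r.
    by move=> y _ _; rewrite /bending actZ act_diag rs !scale1r.
  by move=> y _ _; rewrite /bending actZ act_diag r01 [LHS]scalerA [RHS]scalerA; congr (_ *: _); rewrite /coord3 /reflect1 /=; ring.
Qed.
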